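(* Let $f\colon(\mathbb{C}^2,\mathbf{0})\to(\mathbb{C},0)$ be an irreducible analytic germ with zero locus $X$, multiplicity $m$ at $\mathbf{0}$ and Puiseux pairs $(\beta_1,e_1),\dots,(\beta_s,e_s)$; set $e_0=m$, $\beta_0=0$, $\beta_{s+1}=+\infty$. Let $\Gamma$ be a real analytic half-branch at $\mathbf{0}\in\mathbb{C}^2$ with contact $c=c(\Gamma,X)<+\infty$, and let $k\in\{0,\dots,s\}$ be the unique integer with $\beta_k\le m\cdot c<\beta_{k+1}$. Then the order of $f$ along $\Gamma$ is $$\nu_f(\Gamma)=e_k\, c+(e_0-e_1)\frac{\beta_1}{m}+\dots+(e_{k-1}-e_k)\frac{\beta_k}{m}=e_k\Big(c-\frac{\beta_k}{m}\Big)+\sum_{i=0}^{k-1}e_i\Big(\frac{\beta_{i+1}}{m}-\frac{\beta_i}{m}\Big)$$ (empty sums being $0$ when $k=0$).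
   Context: Puiseux pairs: in suitable local holomorphic coordinates $(x,y)$ the zero locus $X$ is parameterized by $x\mapsto(x^m,\Psi(x))$, $\Psi(x)=\sum_{j>m}a_jx^j$; set $e_0=m$, $\beta_{i+1}=\min\{j:a_j\ne0,\ e_i\nmid j\}$, $e_{i+1}=\gcd(e_i,\beta_{i+1})$, until $e_s=1$. A map germ $\phi\colon(\mathbb{R}_{\ge0},0)\to\mathbb{C}^N$ is ramified analytic if $\phi(t)=\tilde\phi(t^{p/q})$ for some convergent power series $\tilde\phi$ and coprime positive integers $p,q$; a ramified analytic unit if moreover $\tilde\phi(0)\neq0$. A real analytic half-branch at $\mathbf{0}$ is the germ of the image of $[0,\varepsilon)$ under a nonconstant real analytic map $\gamma$ with $\gamma(0)=\mathbf{0}$. An analytic arc is a nonconstant germ $\alpha\colon[0,\varepsilon)\to\mathbb{C}^2$ with $\alpha(0)=\mathbf{0}$, such that $t\mapsto\alpha(t^e)$ is real analytic for some positive integer $e$, and $at\le|\alpha(t)|\le bt$ for small $t$ with constants $0<a<b$. Every half-branch $\Gamma$ is parameterized by analytic arcs. Order: for an analytic arc $\alpha$, $f(\alpha(t))=t^{\nu}V(t)$ with $V$ a ramified analytic unit and $\nu\in\mathbb{Q}_{>0}\cup\{+\infty\}$; $\nu_f(\Gamma):=\nu$ for any analytic arc $\alpha$ parameterizing $\Gamma$ (independent of the choice). Contact: with $X(r)=\{p\in X:|p|=r\}$, $c(\alpha,X)=\lim_{t\to0^+}\log(\mathrm{dist}(\alpha(t),X(|\alpha(t)|)))/\log t$,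 and $c(\Gamma,X):=c(\alpha,X)$ for any analytic arc $\alpha$ parameterizing $\Gamma$ (independent of the choice). *)

(* Defs.v *)
From Stdlib Require Import Reals Arith.
From Coquelicot Require Import Coquelicot.

Open Scope R_scope.

Definition C2 := (C * C)%type.
Definition norm2 (p : C2) : R := sqrt (Cmod (fst p) ^ 2 + Cmod (snd p) ^ 2).
Definition sub2 (p q : C2) : C2 := (Cminus (fst p) (fst q), Cminus (snd p) (snd q)).
Definition zero2 : C2 := (RtoC 0, RtoC 0).

Definition ser1 (a : nat -> C) (z : C) (l : C) : Prop :=
  is_series (fun n => Cmult (a n) (Cpow z n)) l.

Definition ser2 (c : nat -> nat -> C) (x y : C) (l : C) : Prop :=
  exists g : nat -> C,
    (forall i, is_series (fun j => Cmult (c i j) (Cmult (Cpow x i) (Cpow y j))) (g i))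
    /\ is_series g l.

(* f : C^2 -> C is represented near 0 by the convergent power series c:
   the coefficients are bounded by M r^-(i+j) (so the series converges
   absolutely on the polydisc of radius r) and f is the sum there. *)
Definition ser2_rep (r : R) (c : nat -> nat -> C) (f : C2 -> C) : Prop :=
  0 < r /\
  (exists M, forall i j, Cmod (c i j) * r ^ (i + j) <= M) /\
  (forall x y, Cmod x < r -> Cmod y < r -> ser2 c x y (f (x, y))).

Definition analytic0 (f : C2 -> C) : Prop := exists r c, ser2_rep r c f.

Definition irreducible_germ (f : C2 -> C) : Prop :=
  analytic0 f /\ f zero2 = RtoC 0 /\
  (forall eps, 0 < eps -> exists p, norm2 p < eps /\ f p <> RtoC 0) /\
  (forall g h, analytic0 g -> analytic0 h ->
     (exists eps, 0 < eps /\ forall p, norm2 p < eps -> f p = Cmult (g p) (h p)) ->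
     g zero2 <> RtoC 0 \/ h zero2 <> RtoC 0).

Definition germ_mult (f : C2 -> C) (m : nat) : Prop :=
  exists r c, ser2_rep r c f /\
    (exists i j, (i + j = m)%nat /\ c i j <> RtoC 0) /\
    (forall i j, (i + j < m)%nat -> c i j = RtoC 0).

Definition local_coords (Phi : C2 -> C2) : Prop :=
  exists r c1 c2,
    ser2_rep r c1 (fun p => fst (Phi p)) /\ ser2_rep r c2 (fun p => snd (Phi p)) /\
    c1 0%nat 0%nat = RtoC 0 /\ c2 0%nat 0%nat = RtoC 0 /\
    Cminus (Cmult (c1 1%nat 0%nat) (c2 0%nat 1%nat))
           (Cmult (c1 0%nat 1%nat) (c2 1%nat 0%nat)) <> RtoC 0.

Definition puiseux_param (f : C2 -> C) (Phi : C2 -> C2) (m : nat) (a : nat -> C) : Prop :=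
  local_coords Phi /\
  (forall j, (j <= m)%nat -> a j = RtoC 0) /\
  exists rho, 0 < rho /\
    (forall x, Cmod x < rho -> exists l, ser1 a x l) /\
    exists eps, 0 < eps /\ forall p, norm2 p < eps ->
      (f p = RtoC 0 <->
       exists x, Cmod x < rho /\ fst (Phi p) = Cpow x m /\ ser1 a x (snd (Phi p))).

Definition puiseux_pairs (m : nat) (a : nat -> C) (s : nat) (beta e : nat -> nat) : Prop :=
  e 0%nat = m /\ beta 0%nat = 0%nat /\ e s = 1%nat /\
  forall i, (i < s)%nat ->
    a (beta (S i)) <> RtoC 0 /\ ~ Nat.divide (e i) (beta (S i)) /\
    (forall j, a j <> RtoC 0 -> ~ Nat.divide (e i) j -> (beta (S i) <= j)%nat) /\
    e (S i) = Nat.gcd (e i) (beta (S i)).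

Definition same_germ (A B : C2 -> Prop) : Prop :=
  exists r, 0 < r /\ forall p, norm2 p < r -> (A p <-> B p).

Definition img (g : R -> C2) (eps : R) : C2 -> Prop :=
  fun p => exists t, 0 <= t < eps /\ g t = p.

Definition real_analytic_halfbranch_map (gamma : R -> C2) : Prop :=
  exists (g1 g2 : nat -> C) rho, 0 < rho /\
    (forall t, 0 <= t < rho -> ser1 g1 (RtoC t) (fst (gamma t)) /\
                               ser1 g2 (RtoC t) (snd (gamma t))) /\
    g1 0%nat = RtoC 0 /\ g2 0%nat = RtoC 0 /\
    (exists n, (1 <= n)%nat /\ (g1 n <> RtoC 0 \/ g2 n <> RtoC 0)).

Definition analytic_arc (alpha : R -> C2) : Prop :=
  alpha 0 = zero2 /\
  (exists eps, 0 < eps /\ exists t, 0 <= t < eps /\ alpha t <> alpha 0) /\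
  (exists (e : nat) (d1 d2 : nat -> C) rho, (1 <= e)%nat /\ 0 < rho /\
     forall t, 0 <= t < rho -> ser1 d1 (RtoC t) (fst (alpha (t ^ e))) /\
                              ser1 d2 (RtoC t) (snd (alpha (t ^ e)))) /\
  (exists a b eps, 0 < a < b /\ 0 < eps /\
     forall t, 0 <= t < eps -> a * t <= norm2 (alpha t) <= b * t).

Definition parameterizes (alpha gamma : R -> C2) : Prop :=
  exists eta, 0 < eta /\ forall eps1 eps2, 0 < eps1 < eta -> 0 < eps2 < eta ->
    same_germ (img alpha eps1) (img gamma eps2).

Definition ramified_analytic_unit (phi : R -> C) : Prop :=
  exists (p q : nat) (v : nat -> C) rho,
    (0 < p)%nat /\ (0 < q)%nat /\ Nat.gcd p q = 1%nat /\ 0 < rho /\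
    v 0%nat <> RtoC 0 /\
    forall t, 0 < t < rho -> ser1 v (RtoC (Rpower t (INR p / INR q))) (phi t).

Definition order_along (f : C2 -> C) (alpha : R -> C2) (nu : R) : Prop :=
  exists V, ramified_analytic_unit V /\
    exists eps, 0 < eps /\ forall t, 0 < t < eps ->
      f (alpha t) = Cmult (RtoC (Rpower t nu)) (V t).

Definition Xr (f : C2 -> C) (r : R) : C2 -> Prop :=
  fun p => f p = RtoC 0 /\ norm2 p = r.

(* distance from a point to a set (glb, +oo for the empty set) *)
Definition dist_set (p : C2) (S : C2 -> Prop) : Rbar :=
  Glb_Rbar (fun d => exists q, S q /\ d = norm2 (sub2 p q)).

(* c(alpha, X) = c with c a finite real:  log dist(alpha(t), X(|alpha(t)|)) / log t -> c
   as t -> 0+.  (A finite value forces the distance to be eventually positive,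
   which we make explicit so that log is meaningful.) *)
Definition contact_eq (f : C2 -> C) (alpha : R -> C2) (c : R) : Prop :=
  (exists eps, 0 < eps /\ forall t, 0 < t < eps ->
     Rbar_lt (Finite 0) (dist_set (alpha t) (Xr f (norm2 (alpha t)))) /\
     Rbar_lt (dist_set (alpha t) (Xr f (norm2 (alpha t)))) p_infty) /\
  filterlim (fun t => ln (real (dist_set (alpha t) (Xr f (norm2 (alpha t))))) / ln t)
            (at_right 0) (locally c).

Fixpoint rsum (g : nat -> R) (n : nat) : R :=
  match n with O => 0 | S n' => rsum g n' + g n' end.

(* Main.v *)
(**
Since f(alpha(t^e)) is a convergent power series in t, the order nu exists as soon
as f does not vanish along alpha, and it is the limit of log|f(alpha(t))| / log t.

Exchange the two coordinates of C^2 if necessary, so that the lines u = const are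
transverse to X.  A fixed-point argument shows that such a line, u <> 0 small, meets
X in m distinct points q(x_i), with x_i close to zeta^i x for zeta a primitive m-th
root of unity and some x.  Dividing the power series v |-> f(u,v) successively by
v - v(q(x_i)) gives f(u,v) = U * prod_i (v - v(q(x_i))), where U tends to the
coefficient of v^m in f; that coefficient is nonzero because f has multiplicity m.
Hence |f(p)| is comparable to the product of the m distances D_i = |p - q(x_i)|.

Let d be the distance from p to X(|p|), attained (up to a factor 2) at q(x_0).
Comparing x_i with zeta^i x_0 shows that D_i is comparable to d up to an error of
size |Psi(x_0) - Psi(zeta^i x_0)|, which is of exact order |x_0|^(B_i) with B_i a
characteristic exponent, and that D_i >= d / 7 since q(x_i) can be moved along X onto
the sphere through p.  So along alpha the exponent of D_i is min(c, B_i / m), and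
summing over i, with e_l of the indices satisfying zeta^(i e_l) = 1, gives the formula.
*)
Require Import Defs.
From Stdlib Require Import Reals Arith Lra Lia Classical ClassicalEpsilon Ranalysis5.
From Coquelicot Require Import Coquelicot.
Open Scope R_scope.

(** Only comparisons up to constant factors are made, since an exponent does not see them; distances
    in C^2, in the slice and in the chart may therefore be exchanged freely. Weierstrass preparation
    is replaced by division: f has multiplicity m and the slice already contains m distinct zeros,
    so nothing but a unit can be left. The coefficient of v^m cannot vanish: the m zeros have size
    O(u), and this would force every coefficient of degree m to be 0.

    The main obstacle is that the point of X nearest to p on the sphere lies in general outside the
    slice through p. When d is small against |p|, this point still determines the slice up to a
    small relative error, and x_i is sought as zeta^i x_0 times a factor near 1. When d is
    comparable to |p| this fails, but then every D_i is comparable to |p|, and the terms |x|^(B_i)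
    are dominated because B_i >= m. These are the near and the far case below. *)

Local Notation cser := (@is_series C_AbsRing C_NormedModule).

(** * Series of complex numbers *)

Lemma choice_fun {A B : Type} (P : A -> B -> Prop) :
  (forall x, exists y, P x y) -> exists F, forall x, P x (F x).
Proof.
  intros H. exists (fun x => proj1_sig (constructive_indefinite_description _ (H x))).
  intros x. apply proj2_sig.
Qed.

Lemma sum_n_S_C (a : nat -> C) (n : nat) : sum_n a (S n) = (sum_n a n + a (S n))%C.
Proof. exact (sum_Sn a n). Qed.

Lemma sum_n_S_R (a : nat -> R) (n : nat) : sum_n a (S n) = sum_n a n + a (S n).
Proof. exact (sum_Sn a n). Qed.

Lemma cser_eps (a : nat -> C) (l : C) :
  cser a l <->
  (forall eps, 0 < eps -> exists N, forall n, (N <= n)%nat ->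
     Cmod (sum_n a n - l) < eps).
Proof.
  split.
  - intros H eps He.
    assert (H2 := proj1 (filterlim_locally_ball_norm
      (K := C_AbsRing) (U := C_NormedModule) (fun n => sum_n a n) l) H (mkposreal eps He)).
    exact H2.
  - intros H.
    apply (proj2 (filterlim_locally_ball_norm
      (K := C_AbsRing) (U := C_NormedModule) (fun n => sum_n a n) l)).
    intros [eps He]. exact (H eps He).
Qed.

Lemma cser_unique (a : nat -> C) (l l' : C) : cser a l -> cser a l' -> l = l'.
Proof.
  intros H H'. 
  destruct (Req_dec (Cmod (l - l')) 0) as [E|E].
  { apply Cmod_eq_0 in E. replace l with (l - l' + l')%C by ring. rewrite E. ring. }
  exfalso. assert (Hp : 0 < Cmod (l - l') / 2).
  { assert (h := Cmod_ge_0 (l - l')%C). lra. }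
  destruct (proj1 (cser_eps a l) H _ Hp) as [N HN].
  destruct (proj1 (cser_eps a l') H' _ Hp) as [N' HN'].
  assert (h1 := HN (N + N')%nat ltac:(lia)). assert (h2 := HN' (N + N')%nat ltac:(lia)).
  assert (h3 := Cmod_triangle (- (sum_n a (N+N') - l))%C (sum_n a (N+N') - l')%C).
  rewrite Cmod_opp in h3.
  replace (- (sum_n a (N+N') - l) + (sum_n a (N+N') - l'))%C with (l - l')%C in h3 by ring.
  lra.
Qed.

Lemma cser_ext (a b : nat -> C) (l : C) : (forall n, a n = b n) -> cser a l -> cser b l.
Proof. exact (is_series_ext a b l). Qed.

Lemma cser_plus (a b : nat -> C) (l l' : C) :
  cser a l -> cser b l' -> cser (fun n => (a n + b n)%C) (l + l')%C.
Proof. exact (is_series_plus a b l l'). Qed.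

Lemma cser_scal (k : C) (a : nat -> C) (l : C) :
  cser a l -> cser (fun n => (k * a n)%C) (k * l)%C.
Proof. exact (is_series_scal k a l). Qed.

Lemma cser_minus (a b : nat -> C) (l l' : C) :
  cser a l -> cser b l' -> cser (fun n => (a n - b n)%C) (l - l')%C.
Proof.
  intros H H'.
  apply cser_ext with (fun n => (a n + - 1 * b n)%C).
  - intros n. ring.
  - replace (l - l')%C with (l + - 1 * l')%C by ring.
    apply cser_plus; [exact H|]. apply cser_scal, H'.
Qed.

Lemma cser_dominated (a : nat -> C) (b : nat -> R) :
  (forall n, Cmod (a n) <= b n) -> ex_series b -> exists l, cser a l.
Proof. intros H Hb. exact (ex_series_le (V := C_CompleteNormedModule) a b H Hb). Qed.

Lemma is_series_nonneg_partial (b : nat -> R) (L : R) :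
  (forall n, 0 <= b n) -> is_series b L -> forall n, sum_n b n <= L.
Proof.
  intros Hb HL n.
  apply (is_lim_seq_incr_compare (sum_n b) L).
  - exact HL.
  - intros k. rewrite sum_Sn. unfold plus; simpl. specialize (Hb (S k)). lra.
Qed.

Lemma Cmod_sum_n_le (a : nat -> C) (b : nat -> R) :
  (forall n, Cmod (a n) <= b n) -> forall n, Cmod (sum_n a n) <= sum_n b n.
Proof.
  intros H n. induction n as [|n IH].
  - rewrite !sum_O. apply H.
  - rewrite !sum_Sn. unfold plus; simpl.
    eapply Rle_trans; [apply Cmod_triangle|]. specialize (H (S n)). lra.
Qed.

Lemma cser_norm_le (a : nat -> C) (b : nat -> R) (l : C) (L : R) :
  (forall n, Cmod (a n) <= b n) -> cser a l -> is_series b L -> Cmod l <= L.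
Proof.
  intros H Hl HL. apply Rnot_lt_le. intros Hlt.
  destruct (proj1 (cser_eps a l) Hl (Cmod l - L) ltac:(lra)) as [N HN].
  specialize (HN N (le_n _)).
  assert (h1 := Cmod_sum_n_le a b H N).
  assert (h2 : sum_n b N <= L).
  { apply is_series_nonneg_partial; [|exact HL]. intros n.
    eapply Rle_trans; [apply Cmod_ge_0|apply H]. }
  assert (h3 := Cmod_triangle (- (sum_n a N - l))%C (sum_n a N)).
  rewrite Cmod_opp in h3.
  replace (- (sum_n a N - l) + sum_n a N)%C with l in h3 by ring. lra.
Qed.

Lemma cser_S (a : nat -> C) (l : C) :
  cser a l <-> cser (fun n => a (S n)) (l - a 0%nat)%C.
Proof.
  split; intros H.
  - apply (is_series_incr_1 a (l - a 0%nat)%C).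
    replace l with (l - a 0%nat + a 0%nat)%C in H by ring. exact H.
  - apply (is_series_decr_1 a l). exact H.
Qed.

Lemma cser_shift_zero (n : nat) : forall (a : nat -> C) (l : C),
  (forall j, (j < n)%nat -> a j = RtoC 0) ->
  (cser a l <-> cser (fun j => a (n + j)%nat) l).
Proof.
  induction n as [|n IH]; intros a l H.
  - split; apply cser_ext; reflexivity.
  - rewrite cser_S, (H 0%nat) by lia. replace (l - 0)%C with l by ring.
    apply (IH (fun j => a (S j)) l). intros j Hj. apply H. lia.
Qed.

Lemma cser_bounded (a : nat -> C) (l : C) :
  cser a l -> exists M, 0 < M /\ forall n, Cmod (a n) <= M.
Proof.
  intros H. destruct (proj1 (cser_eps a l) H 1 ltac:(lra)) as [N HN].
  assert (Hb : exists M, 0 < M /\ forall n, (n <= N)%nat -> Cmod (a n) <= M).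
  { clear. induction N as [|N [M [HM IH]]].
    - exists (Cmod (a 0%nat) + 1). split; [assert (h := Cmod_ge_0 (a 0%nat)); lra|].
      intros n Hn. replace n with 0%nat by lia. lra.
    - exists (M + Cmod (a (S N))). assert (h := Cmod_ge_0 (a (S N))). split; [lra|].
      intros n Hn. destruct (Nat.eq_dec n (S N)) as [->|E]; [lra|].
      specialize (IH n ltac:(lia)). lra. }
  destruct Hb as [M [HM Hb]]. exists (M + 2). split; [lra|]. intros n.
  destruct (le_lt_dec n N) as [h|h]; [specialize (Hb n h); lra|].
  destruct n as [|n]; [lia|].
  assert (h1 := HN n ltac:(lia)). assert (h2 := HN (S n) ltac:(lia)).
  rewrite sum_Sn in h2. unfold plus in h2; simpl in h2.
  assert (h3 := Cmod_triangle (sum_n a n + a (S n) - l)%C (- (sum_n a n - l))%C).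
  rewrite Cmod_opp in h3.
  replace (sum_n a n + a (S n) - l + - (sum_n a n - l))%C
    with (a (S n)) in h3 by ring. lra.
Qed.

Lemma cser_zero : cser (fun _ => RtoC 0) (RtoC 0).
Proof.
  apply cser_eps. intros eps He. exists 0%nat. intros n _.
  assert (E : forall n, sum_n (fun _ : nat => RtoC 0) n = RtoC 0 :> C).
  { clear. induction n as [|n IH]; [apply sum_O|]. rewrite sum_Sn, IH. unfold plus; simpl. ring. }
  rewrite E. replace (0 - 0)%C with (RtoC 0) by ring. rewrite Cmod_0. exact He.
Qed.

Lemma cser_sum_n (a : nat -> nat -> C) (q : nat -> C) (J : nat) :
  (forall j, cser (fun i => a i j) (q j)) ->
  cser (fun i => sum_n (a i) J) (sum_n q J).
Proof.
  intros H. induction J as [|J IH].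
  - rewrite sum_O. apply cser_ext with (fun i => a i 0%nat); [|apply H].
    intros n. now rewrite sum_O.
  - rewrite sum_Sn. apply cser_ext with (fun i => (sum_n (a i) J + a i (S J))%C).
    + intros n. now rewrite sum_Sn.
    + apply cser_plus; [exact IH|apply H].
Qed.

Lemma eventually_finite (P : nat -> nat -> Prop) (n : nat) :
  (forall i, exists N, forall J, (N <= J)%nat -> P i J) ->
  exists N, forall J i, (N <= J)%nat -> (i <= n)%nat -> P i J.
Proof.
  intros H. induction n as [|n [N IH]].
  - destruct (H 0%nat) as [N HN]. exists N. intros J i HJ Hi. replace i with 0%nat by lia. auto.
  - destruct (H (S n)) as [N' HN']. exists (N + N')%nat. intros J i HJ Hi.
    destruct (Nat.eq_dec i (S n)) as [->|E]; [apply HN'; lia|apply IH; lia].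
Qed.

(** Dominated convergence for series: beyond a suitable index the tail of [S] bounds all rows at
    once, and the finitely many earlier terms tend to 0. *)
Lemma tannery (d : nat -> nat -> C) (S : nat -> R) (L : nat -> C) :
  (forall J i, Cmod (d J i) <= S i) -> ex_series S ->
  (forall J, cser (d J) (L J)) ->
  (forall i eps, 0 < eps -> exists N, forall J, (N <= J)%nat -> Cmod (d J i) < eps) ->
  forall eps, 0 < eps -> exists N, forall J, (N <= J)%nat -> Cmod (L J) < eps.
Proof.
  intros Hd [T HT] HL Hlim eps He.
  assert (Hconv := proj2 (is_lim_seq_spec (sum_n S) T) HT (mkposreal (eps / 4) ltac:(lra))).
  destruct Hconv as [n Hn]. specialize (Hn n (le_n _)). simpl in Hn.
  assert (HS0 : forall i, 0 <= S i).
  { intros i. eapply Rle_trans; [apply Cmod_ge_0|apply (Hd 0%nat)]. }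
  assert (Hpos : 0 < eps / (4 * (INR n + 1))).
  { apply Rdiv_lt_0_compat; [lra|]. assert (h := pos_INR n). lra. }
  destruct (eventually_finite (fun i J => Cmod (d J i) < eps / (4 * (INR n + 1))) n
              (fun i => Hlim i _ Hpos)) as [N HN].
  exists N. intros J HJ.
  assert (Hpart : forall k, (k <= n)%nat -> Cmod (sum_n (d J) k) <= (INR k + 1) * (eps / (4 * (INR n + 1)))).
  { induction k as [|k IH]; intros Hk.
    - rewrite sum_O. simpl. specialize (HN J 0%nat HJ Hk). simpl in HN. lra.
    - rewrite sum_n_S_C, S_INR.
      eapply Rle_trans; [apply Cmod_triangle|].
      specialize (IH ltac:(lia)). specialize (HN J (Datatypes.S k) HJ Hk). simpl in HN. lra. }
  specialize (Hpart n (le_n _)).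
  replace ((INR n + 1) * (eps / (4 * (INR n + 1)))) with (eps / 4) in Hpart
    by (field; assert (h := pos_INR n); lra).
  apply Rle_lt_trans with (eps / 4 + eps / 2); [|lra].
  apply Rnot_lt_le. intros Hlt.
  destruct (proj1 (cser_eps _ _) (HL J) (Cmod (L J) - (eps / 4 + eps / 2)) ltac:(lra)) as [K HK].
  specialize (HK (K + n)%nat ltac:(lia)).
  assert (Htail : forall k, Cmod (sum_n (d J) (k + n) - sum_n (d J) n)
                            <= sum_n S (k + n) - sum_n S n).
  { induction k as [|k IH].
    - simpl. replace (sum_n (d J) n - sum_n (d J) n)%C with (RtoC 0) by ring. rewrite Cmod_0. lra.
    - simpl. rewrite sum_n_S_C, !sum_n_S_R.
      replace (sum_n (d J) (k + n) + d J (Datatypes.S (k + n)) - sum_n (d J) n)%C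
        with (sum_n (d J) (k + n) - sum_n (d J) n + d J (Datatypes.S (k + n)))%C by ring.
      eapply Rle_trans; [apply Cmod_triangle|].
      specialize (Hd J (Datatypes.S (k + n))). lra. }
  specialize (Htail K).
  assert (hT := is_series_nonneg_partial S T HS0 HT (K + n)).
  apply Rabs_def2 in Hn.
  assert (h1 := Cmod_triangle (- (sum_n (d J) (K + n) - L J) + (sum_n (d J) (K + n) - sum_n (d J) n))%C (sum_n (d J) n)).
  assert (h2 := Cmod_triangle (- (sum_n (d J) (K + n) - L J))%C (sum_n (d J) (K + n) - sum_n (d J) n)%C).
  rewrite Cmod_opp in h2.
  replace (- (sum_n (d J) (K + n) - L J) + (sum_n (d J) (K + n) - sum_n (d J) n) + sum_n (d J) n)%C with (L J) in h1 by ring.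
  lra.
Qed.

Lemma is_series_term_le (b : nat -> R) (L : R) (n : nat) :
  (forall n, 0 <= b n) -> is_series b L -> b n <= L.
Proof.
  intros Hb HL. apply Rle_trans with (sum_n b n); [|now apply is_series_nonneg_partial].
  destruct n as [|n]; [rewrite sum_O; lra|]. rewrite sum_Sn. unfold plus; simpl.
  assert (0 <= sum_n b n); [|lra].
  induction n as [|n IH]; [rewrite sum_O; apply Hb|].
  rewrite sum_Sn. unfold plus; simpl. specialize (Hb (S n)). lra.
Qed.

(** Tannery's theorem in the row index i, applied to the errors left after J columns: they are
    dominated by [2 * S i] and tend to 0 for each i. *)
Lemma cser_fubini (a : nat -> nat -> C) (S : nat -> R) (R : nat -> C) (l : C) :
  (forall i, is_series (fun j => Cmod (a i j)) (S i)) -> ex_series S ->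
  (forall i, cser (a i) (R i)) -> cser R l ->
  exists Q, (forall j, cser (fun i => a i j) (Q j)) /\ cser Q l.
Proof.
  intros HS HSum HR Hl.
  assert (Haij : forall i j, Cmod (a i j) <= S i).
  { intros i j. apply (is_series_term_le (fun j => Cmod (a i j))); [intros; apply Cmod_ge_0|apply HS]. }
  assert (HQ : forall j, exists q, cser (fun i => a i j) q).
  { intros j. apply cser_dominated with S; [intros; apply Haij|exact HSum]. }
  destruct (choice_fun _ HQ) as [Q HQ']. exists Q.
  split; [exact HQ'|].
  apply cser_eps.
  apply (tannery (fun J i => (sum_n (a i) J - R i)%C) (fun i => 2 * S i)
    (fun J => (sum_n Q J - l)%C)).
  - intros J i. 
    assert (h1 : Cmod (sum_n (a i) J) <= S i).
    { eapply Rle_trans; [apply Cmod_sum_n_le with (b := fun j => Cmod (a i j)); intros; lra|].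
      apply is_series_nonneg_partial; [intros; apply Cmod_ge_0|apply HS]. }
    assert (h2 : Cmod (R i) <= S i).
    { eapply cser_norm_le; [intros n; apply Rle_refl|apply HR|apply HS]. }
    unfold Cminus. eapply Rle_trans; [apply Cmod_triangle|]. rewrite Cmod_opp. lra.
  - destruct HSum as [T HT]. exists (2 * T). exact (is_series_scal 2 S T HT).
  - intros J. apply cser_minus; [|exact Hl]. apply cser_sum_n. exact HQ'.
  - intros i eps He. destruct (proj1 (cser_eps _ _) (HR i) eps He) as [N HN]. exists N. exact HN.
Qed.

(** * Power series in one variable *)

Ltac rmin_le :=
  solve [ apply Rle_refl
        | eapply Rle_trans; [apply Rmin_l|rmin_le]
        | eapply Rle_trans; [apply Rmin_r|rmin_le] ].

(** Cauchy's estimate on the circle of radius r. Series bounded in this way are estimated for moduli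
    at most r / 2, where a geometric series of ratio 1/2 majorizes them; this is the origin of most
    factors 2 below. *)
Definition coef_bound (M r : R) (a : nat -> C) : Prop := forall n, Cmod (a n) * r ^ n <= M.

Lemma Cmod_le_0 (x : C) : Cmod x <= 0 -> x = RtoC 0.
Proof. intros H. apply Cmod_eq_0. assert (h := Cmod_ge_0 x). lra. Qed.

Lemma Cmod_minus_le (x y : C) : Cmod (x - y) <= Cmod x + Cmod y.
Proof. unfold Cminus. eapply Rle_trans; [apply Cmod_triangle|]. rewrite Cmod_opp. lra. Qed.

Lemma Cmod_minus_sym (x y : C) : Cmod (x - y) = Cmod (y - x).
Proof. rewrite <- Cmod_opp. f_equal. ring. Qed.

Lemma Cmod_minus_ge (x y : C) : Cmod x - Cmod y <= Cmod (x - y).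
Proof.
  assert (h := Cmod_triangle (x - y)%C y).
  replace (x - y + y)%C with x in h by ring. lra.
Qed.

Lemma Cmod_minus_triangle (x y z : C) :
  Cmod (x - z) <= Cmod (x - y) + Cmod (y - z).
Proof.
  replace (x - z)%C with (x - y + (y - z))%C by ring. apply Cmod_triangle.
Qed.

Lemma coef_bound_div (M r : R) (a : nat -> C) (n : nat) :
  0 < r -> coef_bound M r a -> Cmod (a n) <= M / r ^ n.
Proof.
  intros HR H. apply Rmult_le_reg_r with (r ^ n); [now apply pow_lt|].
  unfold Rdiv. rewrite Rmult_assoc, Rinv_l, Rmult_1_r; [apply H|]. apply pow_nonzero. lra.
Qed.

Lemma coef_bound_ge0 (M r : R) (a : nat -> C) : coef_bound M r a -> 0 <= M.
Proof.
  intros H. specialize (H 0%nat). simpl in H. assert (h := Cmod_ge_0 (a 0%nat)). lra.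
Qed.

Lemma is_series_half (K : R) : is_series (fun n => K * (/ 2) ^ n) (2 * K).
Proof.
  replace (2 * K) with (K * / (1 - / 2)) by field.
  apply (is_series_scal K (fun n => (/ 2) ^ n)). apply is_series_geom.
  rewrite Rabs_pos_eq; lra.
Qed.

Lemma cser_half (a : nat -> C) (K : R) :
  (forall n, Cmod (a n) <= K * (/ 2) ^ n) -> exists l, cser a l /\ Cmod l <= 2 * K.
Proof.
  intros H.
  destruct (cser_dominated a _ H) as [l Hl]; [eexists; apply is_series_half|].
  exists l. split; [exact Hl|]. eapply cser_norm_le; [exact H|exact Hl|apply is_series_half].
Qed.

Lemma cser_half_le (a : nat -> C) (K : R) (l : C) :
  (forall n, Cmod (a n) <= K * (/ 2) ^ n) -> cser a l -> Cmod l <= 2 * K.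
Proof. intros H Hl. eapply cser_norm_le; [exact H|exact Hl|apply is_series_half]. Qed.

Lemma coef_bound_term (M r : R) (a : nat -> C) (x : C) (n k : nat) :
  0 < r -> coef_bound M r a -> Cmod x <= r / 2 ->
  Cmod (a (n + k)%nat * x ^ k) <= M / r ^ n * (/ 2) ^ k.
Proof.
  intros HR Ha Hx. rewrite Cmod_mult, Cmod_pow.
  apply Rle_trans with (M / r ^ (n + k) * (r / 2) ^ k).
  - apply Rmult_le_compat; [apply Cmod_ge_0|apply pow_le, Cmod_ge_0|now apply coef_bound_div|].
    apply pow_incr. split; [apply Cmod_ge_0|exact Hx].
  - right. unfold Rdiv. rewrite pow_add, Rpow_mult_distr. field.
    split; apply pow_nonzero; lra.
Qed.

Lemma ser1_exists (M r : R) (a : nat -> C) (x : C) :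
  0 < r -> coef_bound M r a -> Cmod x <= r / 2 -> exists l, ser1 a x l /\ Cmod l <= 2 * M.
Proof.
  intros HR Ha Hx. apply cser_half. intros n.
  assert (h := coef_bound_term M r a x 0 n HR Ha Hx). simpl in h.
  replace (M / 1) with M in h by field. exact h.
Qed.

(** Once the vanishing head and the term of degree n are removed, x^(n+1) factors out of the rest,
    and the cofactor is majorized by a geometric series. *)
Lemma ser1_leading (M r : R) (a : nat -> C) (n : nat) (x l : C) :
  0 < r -> coef_bound M r a -> (forall j, (j < n)%nat -> a j = RtoC 0) ->
  Cmod x <= r / 2 -> ser1 a x l ->
  Cmod (l - a n * x ^ n) <= 2 * M / r ^ (S n) * Cmod x ^ S n.
Proof.
  intros HR Ha H0 Hx Hl. unfold ser1 in Hl.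
  rewrite (cser_shift_zero n) in Hl.
  2:{ intros j Hj. rewrite H0 by exact Hj. ring. }
  rewrite cser_S, Nat.add_0_r in Hl.
  replace (2 * M / r ^ S n * Cmod x ^ S n) with (2 * (M / r ^ S n * Cmod x ^ S n)).
  2:{ field. apply pow_nonzero; lra. }
  eapply cser_half_le; [|exact Hl]. intros k. cbv beta.
  replace (n + S k)%nat with (S n + k)%nat by lia.
  rewrite Cpow_add_r.
  replace (a (S n + k)%nat * (x ^ (S n) * x ^ k))%C
    with (a (S n + k)%nat * x ^ k * x ^ (S n))%C by ring.
  rewrite Cmod_mult, Cmod_pow.
  assert (h := coef_bound_term M r a x (S n) k HR Ha Hx).
  assert (h2 : 0 <= Cmod x ^ S n) by apply pow_le, Cmod_ge_0.
  apply Rle_trans with (M / r ^ S n * (/ 2) ^ k * Cmod x ^ S n); [|right; ring].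
  apply Rmult_le_compat_r; assumption.
Qed.

Lemma ser1_factor (a : nat -> C) (n : nat) (x l : C) :
  (forall j, (j < n)%nat -> a j = RtoC 0) -> x <> RtoC 0 -> ser1 a x l ->
  ser1 (fun j => a (n + j)%nat) x (l / x ^ n)%C.
Proof.
  intros H0 Hx Hl. unfold ser1 in *. rewrite (cser_shift_zero n) in Hl.
  2:{ intros j Hj. rewrite H0 by exact Hj. ring. }
  assert (h := cser_scal (/ x ^ n)%C _ _ Hl).
  replace (l / x ^ n)%C with (/ x ^ n * l)%C by (unfold Cdiv; ring).
  eapply cser_ext; [|exact h]. intros k. cbv beta. rewrite Cpow_add_r. field. now apply Cpow_nz.
Qed.

Lemma Cpow_diff_le (x y : C) (X : R) (n : nat) :
  Cmod x <= X -> Cmod y <= X ->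
  Cmod (x ^ (S n) - y ^ (S n)) <= INR (S n) * X ^ n * Cmod (x - y).
Proof.
  intros Hx Hy. assert (HX : 0 <= X) by (eapply Rle_trans; [apply Cmod_ge_0|exact Hx]).
  induction n as [|n IH].
  - rewrite !Cpow_1_r. simpl. lra.
  - replace (x ^ (S (S n)) - y ^ (S (S n)))%C with
      (x * (x ^ (S n) - y ^ (S n)) + y ^ (S n) * (x - y))%C
      by (rewrite (Cpow_S x (S n)), (Cpow_S y (S n)); ring).
    eapply Rle_trans; [apply Cmod_triangle|]. rewrite !Cmod_mult, Cmod_pow.
    replace (INR (S (S n)) * X ^ S n * Cmod (x - y)) with
      (X * (INR (S n) * X ^ n * Cmod (x - y)) + X ^ S n * Cmod (x - y))
      by (rewrite (S_INR (S n)); simpl (X ^ S n); ring).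
    apply Rplus_le_compat.
    + apply Rmult_le_compat; auto using Cmod_ge_0.
    + apply Rmult_le_compat_r; [apply Cmod_ge_0|]. apply pow_incr. split; [apply Cmod_ge_0|exact Hy].
Qed.

Lemma INR_le_pow2 (n : nat) : INR n <= 2 ^ n.
Proof.
  induction n as [|n IH]; [simpl; lra|]. rewrite S_INR. simpl.
  assert (h : 1 <= 2 ^ n) by (apply pow_R1_Rle; lra). lra.
Qed.

(** A difference of k-th powers costs a factor k, bounded by 2^k; this doubles the ratio of the
    majorant and explains the radius r / 4. For a series that starts above degree n the Lipschitz
    constant has size X^n, which later makes [Psi] negligible against x^m. *)
Lemma ser1_lipschitz (M r : R) (a : nat -> C) (n : nat) (X : R) (x y l l' : C) :
  0 < r -> coef_bound M r a -> (forall j, (j <= n)%nat -> a j = RtoC 0) ->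
  Cmod x <= X -> Cmod y <= X -> X <= r / 4 -> ser1 a x l -> ser1 a y l' ->
  Cmod (l - l') <= 2 * M * (2 / r) ^ S n * X ^ n * Cmod (x - y).
Proof.
  intros HR Ha H0 Hx Hy HX Hl Hl'.
  assert (HX0 : 0 <= X) by (eapply Rle_trans; [apply Cmod_ge_0|exact Hx]).
  assert (HM := coef_bound_ge0 _ _ _ Ha).
  assert (h := cser_minus _ _ _ _ Hl Hl'). cbv beta in h.
  rewrite (cser_shift_zero (S n)) in h.
  2:{ intros j Hj. rewrite H0 by lia. ring. }
  replace (2 * M * (2 / r) ^ S n * X ^ n * Cmod (x - y)) with
    (2 * (M * (2 / r) ^ S n * X ^ n * Cmod (x - y))) by ring.
  eapply cser_half_le; [|exact h]. intros k. cbv beta. clear h.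
  replace (a (S n + k)%nat * x ^ (S n + k)%nat - a (S n + k)%nat * y ^ (S n + k)%nat)%C
    with (a (S n + k)%nat * (x ^ (S (n + k)) - y ^ (S (n + k))))%C by (simpl; ring).
  rewrite Cmod_mult.
  apply Rle_trans with (M / r ^ (S n + k) * (2 ^ (S n + k) * X ^ (n + k) * Cmod (x - y))).
  - apply Rmult_le_compat; try apply Cmod_ge_0; [now apply coef_bound_div|].
    eapply Rle_trans; [apply (Cpow_diff_le x y X); assumption|].
    apply Rmult_le_compat_r; [apply Cmod_ge_0|]. apply Rmult_le_compat_r; [now apply pow_le|].
    apply INR_le_pow2.
  - replace (M / r ^ (S n + k) * (2 ^ (S n + k) * X ^ (n + k) * Cmod (x - y))) with
      (M * (2 / r) ^ S n * X ^ n * Cmod (x - y) * (2 * X / r) ^ k).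
    + apply Rmult_le_compat_l.
      * apply Rmult_le_pos; [|apply Cmod_ge_0].
        apply Rmult_le_pos; [|now apply pow_le]. apply Rmult_le_pos; [exact HM|].
        apply pow_le, Rlt_le, Rdiv_lt_0_compat; lra.
      * apply pow_incr. split.
        { apply Rmult_le_pos; [lra|]. apply Rlt_le, Rinv_0_lt_compat, HR. }
        apply Rmult_le_reg_r with r; [lra|]. unfold Rdiv. rewrite Rmult_assoc, Rinv_l; lra.
    + unfold Rdiv. rewrite !pow_add, !Rpow_mult_distr, !pow_inv. field.
      split; apply pow_nonzero; lra.
Qed.

Lemma ser1_coef_bound (a : nat -> C) (rho : R) :
  0 < rho -> (forall x, Cmod x < rho -> exists l, ser1 a x l) ->
  exists M, coef_bound M (rho / 2) a.
Proof.
  intros Hr H. destruct (H (RtoC (rho / 2))) as [l Hl].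
  { rewrite Cmod_R, Rabs_pos_eq; lra. }
  destruct (cser_bounded _ _ Hl) as [M [_ HM]]. exists M. intros n.
  specialize (HM n). rewrite Cmod_mult, Cmod_pow, Cmod_R, Rabs_pos_eq in HM by lra. exact HM.
Qed.

(** Synthetic division. The tails s_k, sums of c_(k+n) z^n over n, satisfy s_k = c_k + z s_(k+1),
    and s_0 = 0 because z is a zero; the quotient has coefficients s_(k+1). *)
Lemma deflate (M r : R) (c : nat -> C) (z : C) :
  0 < r -> coef_bound M r c -> Cmod z <= r / 2 -> ser1 c z (RtoC 0) ->
  exists c', coef_bound (2 * M / r) r c' /\
    (forall k, Cmod (c' k - c (S k)) <= 2 * M / r ^ (S (S k)) * Cmod z) /\
    c 0%nat = (- (z * c' 0%nat))%C /\
    (forall k, c (S k) = (c' k - z * c' (S k))%C) /\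
    (forall v l, Cmod v <= r / 2 -> ser1 c v l ->
       exists l', ser1 c' v l' /\ l = ((v - z) * l')%C).
Proof.
  intros HR Hc Hz H0. assert (HM := coef_bound_ge0 _ _ _ Hc).
  assert (Hs : forall k, exists s, ser1 (fun n => c (k + n)%nat) z s /\ Cmod s <= 2 * (M / r ^ k)).
  { intros k. apply cser_half. intros n. now apply coef_bound_term. }
  destruct (choice_fun _ Hs) as [s Hs'].
  assert (Hs1 := fun k => proj1 (Hs' k)). assert (Hs2 := fun k => proj2 (Hs' k)). cbv beta in Hs1, Hs2.
  assert (Hrec : forall k, s k = (c k + z * s (S k))%C).
  { intros k. apply cser_unique with (fun n => (c (k + n)%nat * z ^ n)%C); [apply Hs1|].
    apply cser_S. rewrite Nat.add_0_r. simpl (z ^ 0)%C.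
    replace (c k + z * s (S k) - c k * 1)%C
      with (z * s (S k))%C by ring.
    eapply cser_ext; [|apply cser_scal, (Hs1 (S k))]. intros n. cbv beta.
    replace (k + S n)%nat with (S k + n)%nat by lia. rewrite Cpow_S. ring. }
  assert (Hs0 : s 0%nat = RtoC 0).
  { apply cser_unique with (fun n => (c n * z ^ n)%C); [apply (Hs1 0%nat)|exact H0]. }
  exists (fun k => s (S k)). repeat split.
  - intros n. apply Rle_trans with (2 * (M / r ^ S n) * r ^ n).
    + apply Rmult_le_compat_r; [apply pow_le; lra|apply Hs2].
    + right. simpl. field. split; try apply pow_nonzero; lra.
  - intros k. rewrite (Hrec (S k)).
    replace (c (S k) + z * s (S (S k)) - c (S k))%C
      with (s (S (S k)) * z)%C by ring.
    rewrite Cmod_mult. apply Rmult_le_compat_r; [apply Cmod_ge_0|].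
    eapply Rle_trans; [apply Hs2|]. right. unfold Rdiv. ring.
  - assert (h := Hrec 0%nat). rewrite Hs0 in h.
    replace (c 0%nat) with (c 0%nat + z * s 1%nat - z * s 1%nat)%C by ring.
    rewrite <- h. ring.
  - intros k. rewrite (Hrec (S k)). ring.
  - intros v l Hv Hl.
    destruct (ser1_exists (2 * M / r) r (fun k => s (S k)) v HR) as [l' [Hl' _]].
    { intros n. apply Rle_trans with (2 * (M / r ^ S n) * r ^ n).
      + apply Rmult_le_compat_r; [apply pow_le; lra|apply Hs2].
      + right. simpl. field. split; try apply pow_nonzero; lra. }
    { exact Hv. }
    exists l'. split; [exact Hl'|].
    apply cser_unique with (fun n => (c n * v ^ n)%C); [exact Hl|].
    (* The product (v - z) l' is compared termwise, as a shifted series minus z times the series. *)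
    apply cser_ext with (fun n => ((match n with O => RtoC 0 | S n => (v * (s (S n) * v ^ n))%C end) - z * (s (S n) * v ^ n))%C).
    + intros [|n].
      * assert (h := Hrec 0%nat). rewrite Hs0 in h. simpl (v ^ 0)%C.
        replace (c 0%nat) with (c 0%nat + z * s 1%nat - z * s 1%nat)%C by ring.
        rewrite <- h. ring.
      * rewrite (Hrec (S n)), !Cpow_S. ring.
    + replace ((v - z) * l')%C with (v * l' - z * l')%C by ring.
      apply cser_minus; [|apply cser_scal, Hl'].
      apply cser_S. replace (v * l' - 0)%C with (v * l')%C by ring.
      apply cser_scal, Hl'.
Qed.

Fixpoint cprod (g : nat -> C) (n : nat) : C :=
  match n with O => RtoC 1 | S n' => (cprod g n' * g n')%C end.

(* Second conclusion: if the n-th coefficient is as small as the zeros, then F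
   vanishes to order n + 1 under simultaneous scaling of the zeros and v. *)
Lemma deflate_iter (n : nat) : forall (M r K0 : R), 0 < r -> 0 <= M -> 0 <= K0 ->
  exists K, 0 <= K /\ forall (c : nat -> C) (rho : R) (z : nat -> C),
    coef_bound M r c -> 0 <= rho <= r / 2 ->
    (forall i, (i < n)%nat -> Cmod (z i) <= rho /\ ser1 c (z i) (RtoC 0)) ->
    (forall i j, (i < j < n)%nat -> z i <> z j) ->
    (forall v l, Cmod v <= rho -> ser1 c v l ->
       exists U, l = (cprod (fun i => (v - z i)%C) n * U)%C /\
                 Cmod (U - c n) <= K * rho) /\
    (Cmod (c n) <= K0 * rho ->
     forall j, (j <= n)%nat -> Cmod (c j) <= K * rho ^ (S n - j)).
Proof.
  induction n as [|n IH]; intros M r K0 HR HM HK0.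
  - exists (2 * M / r ^ 1 + K0). assert (h : 0 <= 2 * M / r ^ 1).
    { unfold Rdiv. apply Rmult_le_pos; [lra|]. apply Rlt_le, Rinv_0_lt_compat. simpl. lra. }
    split; [lra|]. intros c rho z Hc Hrho _ _. split.
    + intros v l Hv Hl. exists l. split; [simpl; ring|].
      assert (h1 := ser1_leading M r c 0 v l HR Hc (fun j (Hj : (j < 0)%nat) => False_ind _ (Nat.nlt_0_r _ Hj))
         (Rle_trans _ _ _ Hv (proj2 Hrho)) Hl).
      simpl (v ^ 0)%C in h1. rewrite Cmult_1_r in h1.
      rewrite (pow_1 (Cmod v)) in h1. eapply Rle_trans; [exact h1|].
      apply Rle_trans with (2 * M / r ^ 1 * rho).
      * apply Rmult_le_compat_l; assumption.
      * apply Rmult_le_compat_r; lra.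
    + intros Hcn j Hj. replace j with 0%nat by lia. simpl (1 - 0)%nat. rewrite (pow_1 rho).
      eapply Rle_trans; [exact Hcn|]. apply Rmult_le_compat_r; lra.
  (* [K1 * rho] bounds the change of the leading coefficient, from c_(n+1) to c'_n, in one
     division. *)
  - set (K1 := 2 * M / r ^ S (S n)).
    assert (HRn : 0 < r ^ S (S n)) by now apply pow_lt.
    assert (HK1 : 0 <= K1).
    { unfold K1, Rdiv. apply Rmult_le_pos; [lra|]. now apply Rlt_le, Rinv_0_lt_compat. }
    assert (HM' : 0 <= 2 * M / r).
    { unfold Rdiv. apply Rmult_le_pos; [lra|]. now apply Rlt_le, Rinv_0_lt_compat. }
    destruct (IH (2 * M / r) r (K0 + K1) HR HM' ltac:(lra)) as [K [HK HIH]].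
    exists (2 * K + K1 + K0). split; [lra|].
    intros c rho z Hc Hrho Hz Hd.
    destruct (Hz n ltac:(lia)) as [Hzn Hzn0].
    destruct (deflate M r c (z n) HR Hc ltac:(lra) Hzn0) as [c' [Hc' [Hnear [Hc0 [HcS Hdef]]]]].
    assert (Hn1 : Cmod (c' n - c (S n)) <= K1 * rho).
    { eapply Rle_trans; [apply Hnear|]. apply Rmult_le_compat_l; assumption. }
    destruct (HIH c' rho z Hc' Hrho) as [HA HB].
    (* The other zeros survive in the quotient because they differ from [z n]. *)
    { intros i Hi. destruct (Hz i ltac:(lia)) as [h1 h2]. split; [exact h1|].
      destruct (Hdef (z i) (RtoC 0) ltac:(lra) h2) as [l' [hl' hl0]].
      replace (RtoC 0) with l'; [exact hl'|].
      destruct (Ceq_dec l' (RtoC 0)) as [E|E]; [exact E|].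
      exfalso. apply (Cmult_neq_0 (z i - z n)%C l'); auto.
      apply Cminus_eq_contra, Hd. lia. }
    { intros i j Hij. apply Hd. lia. }
    split.
    + intros v l Hv Hl. destruct (Hdef v l ltac:(lra) Hl) as [l' [Hl' El]].
      destruct (HA v l' Hv Hl') as [U [EU HU]]. exists U. split.
      * rewrite El, EU. simpl. ring.
      * eapply Rle_trans; [apply (Cmod_minus_triangle _ (c' n))|].
        assert (0 <= K0 * rho) by (apply Rmult_le_pos; lra).
        assert (0 <= K * rho) by (apply Rmult_le_pos; lra). lra.
    + intros Hcn.
      assert (Hc'n : Cmod (c' n) <= (K0 + K1) * rho).
      { assert (h := Cmod_minus_ge (c' n) (c (S n))). lra. }
      specialize (HB Hc'n). intros j Hj.
      assert (Hp : forall p, 0 <= rho ^ p) by (intros; apply pow_le; lra).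
      destruct (Nat.eq_dec j (S n)) as [->|Ej].
      { replace (S (S n) - S n)%nat with 1%nat by lia. rewrite pow_1.
        eapply Rle_trans; [exact Hcn|]. apply Rmult_le_compat_r; lra. }
      (* In c_j = c'_(j-1) - z_n c'_j the bound on c'_j has one power of rho less than the bound on
         c'_(j-1), and the factor z_n makes up for it. *)
      assert (Hz' : forall i, (i <= n)%nat -> Cmod (z n) * Cmod (c' i) <= K * rho ^ (S (S n - i))).
      { intros i Hi. rewrite <- tech_pow_Rmult. replace (K * (rho * rho ^ (S n - i))) with (rho * (K * rho ^ (S n - i))) by ring.
        apply Rmult_le_compat; try apply Cmod_ge_0; [exact Hzn|]. now apply HB. }
      destruct j as [|j].
      { rewrite Hc0, Cmod_opp, Cmod_mult. eapply Rle_trans; [apply Hz'; lia|].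
        simpl (S (S n) - 0)%nat. simpl (S n - 0)%nat. apply Rmult_le_compat_r; [apply Hp|lra]. }
      rewrite HcS. eapply Rle_trans; [apply Cmod_minus_le|]. rewrite Cmod_mult.
      assert (h1 := HB j ltac:(lia)). assert (h2 := Hz' (S j) ltac:(lia)).
      replace (S (S n - S j))%nat with (S n - j)%nat in h2 by lia.
      replace (S (S n) - S j)%nat with (S n - j)%nat by lia.
      specialize (Hp (S n - j)%nat).
      assert (0 <= (K1 + K0) * rho ^ (S n - j)) by (apply Rmult_le_pos; lra). lra.
Qed.

(** * Strict differentiability and the local inverse of the chart *)

Lemma norm2_ge0 (p : C2) : 0 <= norm2 p.
Proof. apply sqrt_pos. Qed.

(** [norm2] is convertible to the norm of the product module, whose triangle inequality is
    reused. *)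
Lemma norm2_triangle (p q s : C2) : norm2 (sub2 p s) <= norm2 (sub2 p q) + norm2 (sub2 q s).
Proof.
  assert (h := @norm_triangle C_AbsRing (prod_NormedModule C_AbsRing C_NormedModule C_NormedModule)
    (sub2 p q) (sub2 q s)).
  replace (sub2 p s) with
    (@plus (prod_NormedModule C_AbsRing C_NormedModule C_NormedModule) (sub2 p q) (sub2 q s)); [exact h|].
  unfold sub2, plus; simpl. unfold prod_plus; simpl. unfold plus; simpl. f_equal; ring.
Qed.

Lemma norm2_sub_sym (p q : C2) : norm2 (sub2 p q) = norm2 (sub2 q p).
Proof. unfold norm2, sub2; simpl. now rewrite (Cmod_minus_sym (fst p)), (Cmod_minus_sym (snd p)). Qed.

Lemma norm2_sub_0 (p : C2) : norm2 (sub2 p zero2) = norm2 p.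
Proof.
  unfold norm2, sub2, zero2; simpl.
  replace (fst p - 0)%C with (fst p) by ring.
  replace (snd p - 0)%C with (snd p) by ring. reflexivity.
Qed.

Lemma norm2_sub_diag (p : C2) : norm2 (sub2 p p) = 0.
Proof.
  unfold norm2, sub2; simpl.
  replace (fst p - fst p)%C with (RtoC 0) by ring.
  replace (snd p - snd p)%C with (RtoC 0) by ring.
  rewrite Cmod_0. replace (0 * (0 * 1) + 0 * (0 * 1)) with 0 by ring. apply sqrt_0.
Qed.

Lemma norm2_sub_ge (p q : C2) : norm2 p - norm2 q <= norm2 (sub2 p q).
Proof.
  assert (h := norm2_triangle p q zero2). rewrite !norm2_sub_0 in h. lra.
Qed.

Lemma norm2_sub_le (p q : C2) : norm2 (sub2 p q) <= norm2 p + norm2 q.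
Proof.
  assert (h := norm2_triangle p zero2 q).
  rewrite norm2_sub_0, (norm2_sub_sym zero2), norm2_sub_0 in h. exact h.
Qed.

Lemma norm2_fst (p : C2) : Cmod (fst p) <= norm2 p.
Proof.
  unfold norm2. rewrite <- (sqrt_pow2 (Cmod (fst p)) (Cmod_ge_0 _)) at 1.
  apply sqrt_le_1_alt. assert (h := pow2_ge_0 (Cmod (snd p))). lra.
Qed.

Lemma norm2_snd (p : C2) : Cmod (snd p) <= norm2 p.
Proof.
  unfold norm2. rewrite <- (sqrt_pow2 (Cmod (snd p)) (Cmod_ge_0 _)) at 1.
  apply sqrt_le_1_alt. assert (h := pow2_ge_0 (Cmod (fst p))). lra.
Qed.

Lemma norm2_le_sum (p : C2) : norm2 p <= Cmod (fst p) + Cmod (snd p).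
Proof.
  assert (h1 := Cmod_ge_0 (fst p)). assert (h2 := Cmod_ge_0 (snd p)).
  unfold norm2. rewrite <- (sqrt_pow2 (Cmod (fst p) + Cmod (snd p))) by lra.
  apply sqrt_le_1_alt. nra.
Qed.

Lemma norm2_pair_eq (u v v' : C) : norm2 (sub2 (u, v) (u, v')) = Cmod (v - v').
Proof.
  unfold norm2, sub2; simpl. replace (u - u)%C with (RtoC 0) by ring. rewrite Cmod_0.
  rewrite <- (sqrt_pow2 (Cmod (v - v')) (Cmod_ge_0 _)) at 3. f_equal. simpl. ring.
Qed.

(** Completeness of C: the increments form a geometrically dominated series, whose sum plus [z 0] is
    the limit. *)
Lemma cser_telescope (z : nat -> C) (K : R) :
  (forall n, Cmod (z (S n) - z n) <= K * (/ 2) ^ n) ->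
  exists l, forall eps, 0 < eps -> exists N, forall n, (N <= n)%nat -> Cmod (z n - l) < eps.
Proof.
  intros H. destruct (cser_half _ _ H) as [l [Hl _]].
  exists (l + z 0%nat)%C. intros eps He.
  destruct (proj1 (cser_eps _ _) Hl eps He) as [N HN]. exists (S N). intros n Hn.
  destruct n as [|n]; [lia|]. specialize (HN n ltac:(lia)).
  assert (E : forall n, sum_n (fun n => (z (S n) - z n)%C) n = (z (S n) - z 0%nat)%C :> C).
  { clear. induction n as [|n IH]; [now rewrite sum_O|]. rewrite sum_n_S_C, IH. ring. }
  rewrite E in HN.
  replace (z (S n) - (l + z 0%nat))%C with (z (S n) - z 0%nat - l)%C by ring.
  exact HN.
Qed.

Lemma contraction_fixpoint (T : C2 -> C2) (z0 : C2) (rho : R) :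
  0 < rho ->
  (forall z w, norm2 (sub2 z z0) <= rho -> norm2 (sub2 w z0) <= rho ->
     norm2 (sub2 (T z) (T w)) <= / 2 * norm2 (sub2 z w)) ->
  norm2 (sub2 (T z0) z0) <= rho / 2 ->
  exists z, norm2 (sub2 z z0) <= rho /\ T z = z.
Proof.
  intros Hrho HT H0. set (z := fun n => Nat.iter n T z0).
  (* The increments start at rho / 2 and are halved each time, so the iterates stay in the ball
     where the contraction is assumed. *)
  assert (Hz : forall n, norm2 (sub2 (z n) z0) <= rho * (1 - (/ 2) ^ n) /\
                         norm2 (sub2 (z (S n)) (z n)) <= rho / 2 * (/ 2) ^ n).
  { induction n as [|n [IH1 IH2]].
    - simpl. rewrite norm2_sub_diag. split; lra.
    - assert (Hp : 0 < (/ 2) ^ n) by (apply pow_lt; lra).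
      assert (h1 : norm2 (sub2 (z (S n)) z0) <= rho * (1 - (/ 2) ^ S n)).
      { eapply Rle_trans; [apply (norm2_triangle _ (z n))|]. simpl pow. nra. }
      split; [exact h1|].
      change (z (S (S n))) with (T (z (S n))). change (z (S n)) with (T (z n)) at 2.
      eapply Rle_trans; [apply HT|]; simpl pow in *; nra. }
  assert (Hball : forall n, norm2 (sub2 (z n) z0) <= rho).
  { intros n. eapply Rle_trans; [apply Hz|]. assert (0 < (/ 2) ^ n) by (apply pow_lt; lra). nra. }
  destruct (cser_telescope (fun n => fst (z n)) (rho / 2)) as [l1 Hl1].
  { intros n. eapply Rle_trans; [|apply Hz]. apply (norm2_fst (sub2 (z (S n)) (z n))). }
  destruct (cser_telescope (fun n => snd (z n)) (rho / 2)) as [l2 Hl2].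
  { intros n. eapply Rle_trans; [|apply Hz]. apply (norm2_snd (sub2 (z (S n)) (z n))). }
  set (l := (l1, l2) : C2).
  assert (Hl : forall eps, 0 < eps -> exists N, forall n, (N <= n)%nat -> norm2 (sub2 (z n) l) < eps).
  { intros eps He. destruct (Hl1 (eps / 2) ltac:(lra)) as [N1 HN1].
    destruct (Hl2 (eps / 2) ltac:(lra)) as [N2 HN2]. exists (N1 + N2)%nat. intros n Hn.
    eapply Rle_lt_trans; [apply norm2_le_sum|]. simpl.
    specialize (HN1 n ltac:(lia)). specialize (HN2 n ltac:(lia)). lra. }
  assert (Hlr : norm2 (sub2 l z0) <= rho).
  { apply Rnot_lt_le. intros Hlt. destruct (Hl (norm2 (sub2 l z0) - rho) ltac:(lra)) as [N HN].
    specialize (HN N (le_n _)). specialize (Hball N).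
    assert (h := norm2_triangle l (z N) z0). rewrite (norm2_sub_sym l (z N)) in h. lra. }
  exists l. split; [exact Hlr|].
  assert (Hd : norm2 (sub2 (T l) l) <= 0).
  { apply Rnot_lt_le. intros Hlt. destruct (Hl (norm2 (sub2 (T l) l) / 2) ltac:(lra)) as [N HN].
    assert (h1 := HN N (le_n _)). assert (h2 := HN (S N) ltac:(lia)).
    assert (h3 := HT l (z N) Hlr (Hball N)). change (T (z N)) with (z (S N)) in h3.
    assert (h := norm2_triangle (T l) (z (S N)) l). rewrite (norm2_sub_sym l) in h3. lra. }
  assert (h1 := norm2_fst (sub2 (T l) l)). assert (h2 := norm2_snd (sub2 (T l) l)).
  assert (e1 : fst (T l) = fst l).
  { apply Ceq_minus, Cmod_le_0. exact (Rle_trans _ _ _ h1 Hd). }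
  assert (e2 : snd (T l) = snd l).
  { apply Ceq_minus, Cmod_le_0. exact (Rle_trans _ _ _ h2 Hd). }
  destruct (T l), l. simpl in *. congruence.
Qed.

(** The planar fixed-point statement with the first coordinate frozen at 0. *)
Lemma contraction_fixpoint_C (T : C -> C) (z0 : C) (rho : R) :
  0 < rho ->
  (forall z w, Cmod (z - z0) <= rho -> Cmod (w - z0) <= rho ->
     Cmod (T z - T w) <= / 2 * Cmod (z - w)) ->
  Cmod (T z0 - z0) <= rho / 2 ->
  exists z, Cmod (z - z0) <= rho /\ T z = z.
Proof.
  intros Hrho HT H0.
  assert (Hs : forall z w, norm2 (sub2 (RtoC 0, z) (RtoC 0, w)) = Cmod (z - w))
    by (intros; apply norm2_pair_eq).
  destruct (contraction_fixpoint (fun p => (RtoC 0, T (snd p))) (RtoC 0, z0) rho Hrho) as [[z1 z2] [Hz Ez]].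
  - intros z w Hz Hw. rewrite Hs. assert (hz := norm2_snd (sub2 z (RtoC 0, z0))).
    assert (hw := norm2_snd (sub2 w (RtoC 0, z0))). simpl in hz, hw.
    eapply Rle_trans; [apply HT; lra|].
    assert (h := norm2_snd (sub2 z w)). simpl in h. lra.
  - simpl. rewrite Hs. exact H0.
  - exists z2. simpl in Ez. injection Ez as E1 E2. subst z1. rewrite Hs in Hz. rewrite E2. auto.
Qed.

(** The shape of [ser2] for arbitrary entries, so that single terms can be subtracted from a double
    power series. *)
Definition dser (a : nat -> nat -> C) (l : C) : Prop :=
  exists g : nat -> C, (forall i, cser (a i) (g i)) /\ cser g l.

Lemma dser_minus (a b : nat -> nat -> C) (l l' : C) :
  dser a l -> dser b l' -> dser (fun i j => (a i j - b i j)%C) (l - l')%C.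
Proof.
  intros [g [Hg Hl]] [g' [Hg' Hl']]. exists (fun i => (g i - g' i)%C). split.
  - intros i. now apply cser_minus.
  - now apply cser_minus.
Qed.

Lemma cser_single (n : nat) (v : C) : cser (fun i => if Nat.eqb i n then v else RtoC 0) v.
Proof.
  apply (cser_shift_zero n).
  { intros j Hj. destruct (Nat.eqb_spec j n); [lia|reflexivity]. }
  apply cser_S. rewrite Nat.add_0_r, Nat.eqb_refl. replace (v - v)%C with (RtoC 0) by ring.
  eapply cser_ext; [|apply cser_zero]. intros k. cbv beta.
  destruct (Nat.eqb_spec (n + S k) n); [lia|reflexivity].
Qed.

Lemma dser_single (n k : nat) (v : C) :
  dser (fun i j => if Nat.eqb i n then (if Nat.eqb j k then v else RtoC 0) else RtoC 0) v.
Proof.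
  exists (fun i => if Nat.eqb i n then v else RtoC 0). split; [|apply cser_single].
  intros i. destruct (Nat.eqb i n); [apply cser_single|apply cser_zero].
Qed.

Lemma dser_half_le (a : nat -> nat -> C) (K : R) (l : C) :
  (forall i j, Cmod (a i j) <= K * (/ 2) ^ (i + j)) -> dser a l -> Cmod l <= 4 * K.
Proof.
  intros H [g [Hg Hl]]. replace (4 * K) with (2 * (2 * K)) by ring.
  eapply cser_half_le; [|exact Hl]. intros i. replace (2 * K * (/ 2) ^ i) with (2 * (K * (/ 2) ^ i)) by ring.
  eapply cser_half_le; [|apply Hg]. intros j. cbv beta. specialize (H i j). rewrite pow_add in H. lra.
Qed.

Lemma Cpow2_le (x y : C) (X : R) (i j : nat) :
  Cmod x <= X -> Cmod y <= X -> Cmod (x ^ i * y ^ j) <= X ^ (i + j).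
Proof.
  intros Hx Hy. rewrite Cmod_mult, !Cmod_pow, pow_add.
  apply Rmult_le_compat; try apply pow_le, Cmod_ge_0; apply pow_incr; split; auto using Cmod_ge_0.
Qed.

Lemma Cpow2_diff_le (x y x' y' : C) (X D : R) :
  Cmod x <= X -> Cmod y <= X -> Cmod x' <= X -> Cmod y' <= X ->
  Cmod (x - x') <= D -> Cmod (y - y') <= D ->
  forall i j n, (i + j = S n)%nat ->
  Cmod (x ^ i * y ^ j - x' ^ i * y' ^ j)
    <= INR (S n) * X ^ n * D.
Proof.
  intros Hx Hy Hx' Hy' HD HD'. assert (HX : 0 <= X) by (eapply Rle_trans; [apply Cmod_ge_0|exact Hx]).
  assert (HD0 : 0 <= D) by (eapply Rle_trans; [apply Cmod_ge_0|exact HD]).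
  induction i as [|i IH]; intros j n Hn.
  - simpl in Hn. subst j. simpl (x ^ 0)%C. simpl (x' ^ 0)%C. rewrite !Cmult_1_l.
    eapply Rle_trans; [now apply Cpow_diff_le with (X := X)|].
    apply Rmult_le_compat_l; [|exact HD']. apply Rmult_le_pos; [apply pos_INR|now apply pow_le].
  - replace (x ^ (S i) * y ^ j - x' ^ (S i) * y' ^ j)%C
      with (x * (x ^ i * y ^ j - x' ^ i * y' ^ j) + (x - x') * (x' ^ i * y' ^ j))%C
      by (rewrite !Cpow_S; ring).
    eapply Rle_trans; [apply Cmod_triangle|]. rewrite (Cmod_mult x), (Cmod_mult (x - x')%C).
    assert (Hij : (i + j = n)%nat) by lia.
    assert (h1 : Cmod (x - x') * Cmod (x' ^ i * y' ^ j) <= D * X ^ n).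
    { apply Rmult_le_compat; try apply Cmod_ge_0; [exact HD|]. rewrite <- Hij. now apply Cpow2_le. }
    rewrite S_INR. destruct n as [|n].
    + assert (i = 0%nat) by lia. assert (j = 0%nat) by lia. subst.
      simpl (_ ^ 0)%C at 1 2 3 4. replace (1 * 1 - 1 * 1)%C with (RtoC 0) by ring.
      rewrite Cmod_0. simpl INR. lra.
    + assert (h2 := IH j n Hij).
      assert (h3 : Cmod x * Cmod (x ^ i * y ^ j - x' ^ i * y' ^ j)
                   <= X * (INR (S n) * X ^ n * D)).
      { apply Rmult_le_compat; try apply Cmod_ge_0; assumption. }
      replace ((INR (S n) + 1) * X ^ S n * D) with (X * (INR (S n) * X ^ n * D) + D * X ^ S n)
        by (simpl (X ^ S n); ring). lra.
Qed.

(** The derivative at 0 tested on two moving points. Unlike the one-point form, this makes the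
    remainder Lipschitz with a small constant, which gives both bi-Lipschitz bounds and
    contractions. It is all that is retained of the analyticity of the chart. *)
Definition strict_diff (F : C2 -> C) (a b : C) : Prop :=
  forall eps, 0 < eps -> exists delta, 0 < delta /\ forall P Q, norm2 P < delta -> norm2 Q < delta ->
    Cmod (F P - F Q - (a * (fst P - fst Q) + b * (snd P - snd Q)))
    <= eps * norm2 (sub2 P Q).

(** The terms of degree 0 and 1 cancel, and a monomial of degree n + 2 changes by at most (n+2)
    X^(n+1) D, so a small factor X is gained over D. *)
Lemma ser2_rep_strict_diff (r : R) (c : nat -> nat -> C) (F : C2 -> C) :
  ser2_rep r c F -> strict_diff F (c 1%nat 0%nat) (c 0%nat 1%nat).
Proof.
  intros [Hr [[M HM] HF]] eps He.
  assert (HM0 : 0 <= M).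
  { eapply Rle_trans; [|apply (HM 0%nat 0%nat)]. apply Rmult_le_pos; [apply Cmod_ge_0|apply pow_le; lra]. }
  (* The 64 is 4, from summing a double geometric series, times the 16 of [K] below; the + 1 keeps
     the quotient defined when M = 0. *)
  set (X := Rmin (r / 4) (eps * r ^ 2 / (64 * M + 1))).
  assert (HX : 0 < X).
  { apply Rmin_glb_lt; [lra|]. apply Rdiv_lt_0_compat; [|lra]. apply Rmult_lt_0_compat; [lra|]. now apply pow_lt. }
  assert (HXr : X <= r / 4) by apply Rmin_l.
  assert (HXe : 64 * M * X <= eps * r ^ 2).
  { assert (h : X <= eps * r ^ 2 / (64 * M + 1)) by apply Rmin_r.
    apply Rle_trans with ((64 * M + 1) * (eps * r ^ 2 / (64 * M + 1))); [|right; field; lra].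
    apply Rle_trans with ((64 * M + 1) * X); [lra|]. apply Rmult_le_compat_l; lra. }
  exists X. split; [exact HX|]. intros [x y] [x' y'] HP HQ. simpl fst; simpl snd.
  set (D := norm2 (sub2 (x, y) (x', y'))).
  assert (Hx := norm2_fst (x, y)). assert (Hy := norm2_snd (x, y)).
  assert (Hx' := norm2_fst (x', y')). assert (Hy' := norm2_snd (x', y')). simpl in Hx, Hy, Hx', Hy'.
  assert (HDx := norm2_fst (sub2 (x, y) (x', y'))). assert (HDy := norm2_snd (sub2 (x, y) (x', y'))).
  fold D in HDx, HDy. simpl in HDx, HDy.
  assert (HD0 : 0 <= D) by apply norm2_ge0.
  set (K := 16 * M * X / r ^ 2 * D).
  apply Rle_trans with (4 * K).
  2:{ unfold K. apply Rmult_le_reg_r with (r ^ 2); [now apply pow_lt|].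
      replace (4 * (16 * M * X / r ^ 2 * D) * r ^ 2) with (64 * M * X * D) by (field; lra).
      replace (eps * D * r ^ 2) with (eps * r ^ 2 * D) by ring. now apply Rmult_le_compat_r. }
  assert (H1 : dser (fun i j => (c i j * (x ^ i * y ^ j))%C) (F (x, y))) by (apply HF; lra).
  assert (H2 : dser (fun i j => (c i j * (x' ^ i * y' ^ j))%C) (F (x', y'))) by (apply HF; lra).
  assert (H3 := dser_single 1 0 (c 1%nat 0%nat * (x - x'))%C).
  assert (H4 := dser_single 0 1 (c 0%nat 1%nat * (y - y'))%C).
  assert (H5 := dser_minus _ _ _ _ (dser_minus _ _ _ _ (dser_minus _ _ _ _ H1 H2) H3) H4).
  replace (F (x, y) - F (x', y') - (c 1%nat 0%nat * (x - x') + c 0%nat 1%nat * (y - y')))%C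
    with (F (x, y) - F (x', y') - c 1%nat 0%nat * (x - x') - c 0%nat 1%nat * (y - y'))%C by ring.
  eapply dser_half_le; [|exact H5]. cbv beta. clear H1 H2 H3 H4 H5. intros i j.
  assert (HK : 0 <= K).
  { unfold K. apply Rmult_le_pos; [|exact HD0]. apply Rmult_le_pos; [apply Rmult_le_pos; lra|].
    apply Rlt_le, Rinv_0_lt_compat. now apply pow_lt. }
  assert (Hz : forall k, 0 <= K * (/ 2) ^ k).
  { intros k. apply Rmult_le_pos; [exact HK|]. apply pow_le; lra. }
  destruct (Nat.eq_dec (i + j) 0) as [E0|E0].
  { assert (i = 0%nat) by lia. assert (j = 0%nat) by lia. subst. simpl Nat.eqb. cbv iota. simpl Cpow.
    match goal with |- Cmod ?z <= _ => replace z with (RtoC 0) by ring end. rewrite Cmod_0. apply Hz. }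
  destruct (Nat.eq_dec (i + j) 1) as [E1|E1].
  { destruct i as [|[|i]]; try lia.
    - assert (j = 1%nat) by lia. subst. simpl Nat.eqb. cbv iota. simpl Cpow.
      match goal with |- Cmod ?z <= _ => replace z with (RtoC 0) by ring end. rewrite Cmod_0. apply Hz.
    - assert (j = 0%nat) by lia. subst. simpl Nat.eqb. cbv iota. simpl Cpow.
      match goal with |- Cmod ?z <= _ => replace z with (RtoC 0) by ring end. rewrite Cmod_0. apply Hz. }
  match goal with |- Cmod (?z - ?s - ?t) <= _ => assert (Es : s = RtoC 0); [|assert (Et : t = RtoC 0)] end.
  { destruct (Nat.eqb_spec i 1); [|reflexivity]. destruct (Nat.eqb_spec j 0); [lia|reflexivity]. }
  { destruct (Nat.eqb_spec i 0); [|reflexivity]. destruct (Nat.eqb_spec j 1); [lia|reflexivity]. }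
  rewrite Es, Et. clear Es Et.
  match goal with |- Cmod ?z <= _ => replace z with
     (c i j * (x ^ i * y ^ j - x' ^ i * y' ^ j))%C by ring end.
  destruct (i + j)%nat as [|[|n]] eqn:En; try lia. clear E0 E1.
  rewrite Cmod_mult.
  assert (Hc : Cmod (c i j) <= M / r ^ S (S n)).
  { apply Rmult_le_reg_r with (r ^ S (S n)); [now apply pow_lt|].
    replace (M / r ^ S (S n) * r ^ S (S n)) with M by (field; apply pow_nonzero; lra).
    rewrite <- En. apply HM. }
  assert (Hd := Cpow2_diff_le x y x' y' X D ltac:(lra) ltac:(lra) ltac:(lra) ltac:(lra) HDx HDy i j (S n) En).
  assert (Hd' : INR (S (S n)) * X ^ S n * D <= 2 ^ S (S n) * X ^ S n * D).
  { apply Rmult_le_compat_r; [exact HD0|]. apply Rmult_le_compat_r; [apply pow_le; lra|]. apply INR_le_pow2. }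
  apply Rle_trans with (M / r ^ S (S n) * (2 ^ S (S n) * X ^ S n * D)).
  { apply Rmult_le_compat; try apply Cmod_ge_0; lra. }
  replace (M / r ^ S (S n) * (2 ^ S (S n) * X ^ S n * D)) with (4 * M * X / r ^ 2 * D * (2 * X / r) ^ n).
  2:{ unfold Rdiv. rewrite !Rpow_mult_distr, pow_inv. simpl. field. repeat split; try apply pow_nonzero; lra. }
  replace (K * (/ 2) ^ S (S n)) with (4 * M * X / r ^ 2 * D * (/ 2) ^ n).
  2:{ unfold K. simpl. field. lra. }
  apply Rmult_le_compat_l.
  { apply Rle_trans with (K / 4); [lra|]. unfold K. right. field. lra. }
  apply pow_incr. split.
  - apply Rmult_le_pos; [lra|]. apply Rlt_le, Rinv_0_lt_compat; lra.
  - apply Rmult_le_reg_r with r; [lra|]. replace (2 * X / r * r) with (2 * X) by (field; lra). lra.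
Qed.

(** Cramer's rule, with the sum of the four moduli as a crude norm of the adjugate matrix. *)
Lemma linear_solve_bound (a b c d x y s t : C) :
  (a * d - b * c)%C <> RtoC 0 ->
  (a * x + b * y)%C = s -> (c * x + d * y)%C = t ->
  Cmod x + Cmod y <=
   (Cmod a + Cmod b + Cmod c + Cmod d) / Cmod (a * d - b * c) * (Cmod s + Cmod t).
Proof.
  intros HD Hs Ht. set (D := (a * d - b * c)%C) in *.
  assert (HDp := proj1 (Cmod_gt_0 D) HD).
  assert (Hx : (x * D)%C = (d * s - b * t)%C) by (rewrite <- Hs, <- Ht; unfold D; ring).
  assert (Hy : (y * D)%C = (a * t - c * s)%C) by (rewrite <- Hs, <- Ht; unfold D; ring).
  apply (f_equal Cmod) in Hx, Hy. rewrite Cmod_mult in Hx, Hy.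
  assert (h1 := Cmod_minus_le (d * s)%C (b * t)%C). assert (h2 := Cmod_minus_le (a * t)%C (c * s)%C).
  rewrite !Cmod_mult in h1, h2.
  apply Rmult_le_reg_r with (Cmod D); [exact HDp|].
  replace ((Cmod a + Cmod b + Cmod c + Cmod d) / Cmod D * (Cmod s + Cmod t) * Cmod D) with
    ((Cmod a + Cmod b + Cmod c + Cmod d) * (Cmod s + Cmod t)) by (field; lra).
  assert (ga := Cmod_ge_0 a). assert (gb := Cmod_ge_0 b). assert (gc := Cmod_ge_0 c). assert (gd := Cmod_ge_0 d).
  assert (gs := Cmod_ge_0 s). assert (gt := Cmod_ge_0 t).
  assert (0 <= Cmod a * Cmod s) by now apply Rmult_le_pos.
  assert (0 <= Cmod d * Cmod t) by now apply Rmult_le_pos.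
  assert (0 <= Cmod b * Cmod s) by now apply Rmult_le_pos.
  assert (0 <= Cmod c * Cmod t) by now apply Rmult_le_pos.
  nra.
Qed.

Section LocalInverse.
Variables (Phi : C2 -> C2) (a b c d : C).
Hypothesis Phi0 : Phi zero2 = zero2.
Hypothesis D1 : strict_diff (fun p => fst (Phi p)) a b.
Hypothesis D2 : strict_diff (fun p => snd (Phi p)) c d.
Hypothesis det : (a * d - b * c)%C <> RtoC 0.

Lemma chart_bilipschitz : exists delta K, 0 < delta /\ 0 < K /\ forall P Q, norm2 P < delta -> norm2 Q < delta ->
  norm2 (sub2 P Q) <= K * norm2 (sub2 (Phi P) (Phi Q)) /\
  norm2 (sub2 (Phi P) (Phi Q)) <= K * norm2 (sub2 P Q).
Proof.
  set (S := Cmod a + Cmod b + Cmod c + Cmod d).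
  set (A := S / Cmod (a * d - b * c)).
  assert (HDp := proj1 (Cmod_gt_0 _) det).
  assert (ga := Cmod_ge_0 a). assert (gb := Cmod_ge_0 b). assert (gc := Cmod_ge_0 c). assert (gd := Cmod_ge_0 d).
  assert (HS : 0 <= S) by (unfold S; lra).
  assert (HA : 0 <= A) by (apply Rmult_le_pos; [exact HS|now apply Rlt_le, Rinv_0_lt_compat]).
  (* After inversion of the linear part the error then costs at most half of |P - Q|, which can be
     absorbed. *)
  set (eps := / (4 * (A + 1))).
  assert (Heps : 0 < eps) by (apply Rinv_0_lt_compat; lra).
  assert (Heps1 : 2 * A * eps <= / 2).
  { unfold eps. apply Rmult_le_reg_r with (4 * (A + 1)); [lra|]. rewrite Rmult_assoc, Rinv_l; lra. }
  assert (Heps2 : eps <= 1).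
  { unfold eps. rewrite <- Rinv_1. apply Rinv_le_contravar; lra. }
  destruct (D1 eps Heps) as [d1 [Hd1 H1]]. destruct (D2 eps Heps) as [d2 [Hd2 H2]].
  exists (Rmin d1 d2), (4 * A + S + 2). split; [now apply Rmin_glb_lt|]. split; [lra|].
  intros P Q HP HQ.
  assert (g1 := Rmin_l d1 d2). assert (g2 := Rmin_r d1 d2).
  specialize (H1 P Q ltac:(lra) ltac:(lra)). specialize (H2 P Q ltac:(lra) ltac:(lra)). cbv beta in H1, H2.
  set (x := (fst P - fst Q)%C) in *. set (y := (snd P - snd Q)%C) in *.
  set (s := (a * x + b * y)%C) in *. set (t := (c * x + d * y)%C) in *.
  assert (Hlin := linear_solve_bound a b c d x y s t det eq_refl eq_refl). fold S A in Hlin.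
  set (N := norm2 (sub2 P Q)) in *. set (F := norm2 (sub2 (Phi P) (Phi Q))).
  assert (hN : N <= Cmod x + Cmod y) by apply (norm2_le_sum (sub2 P Q)).
  assert (hF1 : Cmod (fst (Phi P) - fst (Phi Q)) <= F) by apply (norm2_fst (sub2 (Phi P) (Phi Q))).
  assert (hF2 : Cmod (snd (Phi P) - snd (Phi Q)) <= F) by apply (norm2_snd (sub2 (Phi P) (Phi Q))).
  assert (hF : F <= Cmod (fst (Phi P) - fst (Phi Q)) + Cmod (snd (Phi P) - snd (Phi Q)))
    by apply (norm2_le_sum (sub2 (Phi P) (Phi Q))).
  assert (k1 := Cmod_minus_ge s (fst (Phi P) - fst (Phi Q))%C). rewrite (Cmod_minus_sym s) in k1.
  assert (k2 := Cmod_minus_ge t (snd (Phi P) - snd (Phi Q))%C). rewrite (Cmod_minus_sym t) in k2.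
  assert (k3 := Cmod_minus_ge (fst (Phi P) - fst (Phi Q))%C s).
  assert (k4 := Cmod_minus_ge (snd (Phi P) - snd (Phi Q))%C t).
  assert (HN0 : 0 <= N) by apply norm2_ge0. assert (HF0 : 0 <= F) by apply norm2_ge0.
  assert (hx : Cmod x <= N) by apply (norm2_fst (sub2 P Q)).
  assert (hy : Cmod y <= N) by apply (norm2_snd (sub2 P Q)).
  split.
  - assert (hst : Cmod s + Cmod t <= 2 * F + 2 * (eps * N)) by lra.
    assert (h : A * (Cmod s + Cmod t) <= A * (2 * F + 2 * (eps * N))) by now apply Rmult_le_compat_l.
    assert (h' : 2 * A * eps * N <= / 2 * N) by now apply Rmult_le_compat_r.
    assert (0 <= (S + 2) * F) by (apply Rmult_le_pos; lra). nra.
  - assert (hs : Cmod s <= Cmod a * N + Cmod b * N).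
    { unfold s. eapply Rle_trans; [apply Cmod_triangle|]. rewrite !Cmod_mult.
      apply Rplus_le_compat; apply Rmult_le_compat_l; assumption. }
    assert (ht : Cmod t <= Cmod c * N + Cmod d * N).
    { unfold t. eapply Rle_trans; [apply Cmod_triangle|]. rewrite !Cmod_mult.
      apply Rplus_le_compat; apply Rmult_le_compat_l; assumption. }
    assert (eps * N <= 1 * N) by now apply Rmult_le_compat_r.
    assert (0 <= A * N) by now apply Rmult_le_pos.
    assert (S * N = Cmod a * N + Cmod b * N + (Cmod c * N + Cmod d * N)) by (unfold S; ring).
    replace ((4 * A + S + 2) * N) with (4 * (A * N) + S * N + 2 * N) by ring. lra.
Qed.

(** Newton's iteration with the derivative frozen at the origin, P - L^(-1)(Phi P - B), contracts
    the ball of radius rho by strict differentiability; its fixed point is the preimage of B. *)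
Lemma chart_onto (eta : R) : 0 < eta ->
  exists delta, 0 < delta /\ forall B, norm2 B < delta -> exists P, norm2 P < eta /\ Phi P = B.
Proof.
  intros Heta.
  set (S := Cmod a + Cmod b + Cmod c + Cmod d).
  set (D := (a * d - b * c)%C) in *.
  set (A := S / Cmod D).
  assert (HDp := proj1 (Cmod_gt_0 _) det). 
  assert (ga := Cmod_ge_0 a). assert (gb := Cmod_ge_0 b). assert (gc := Cmod_ge_0 c). assert (gd := Cmod_ge_0 d).
  assert (HS : 0 <= S) by (unfold S; lra).
  assert (HA : 0 <= A) by (apply Rmult_le_pos; [exact HS|now apply Rlt_le, Rinv_0_lt_compat]).
  set (eps := / (4 * (A + 1))).
  assert (Heps : 0 < eps) by (apply Rinv_0_lt_compat; lra).
  assert (Heps1 : 2 * A * eps <= / 2).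
  { unfold eps. apply Rmult_le_reg_r with (4 * (A + 1)); [lra|]. rewrite Rmult_assoc, Rinv_l; lra. }
  destruct (D1 eps Heps) as [d1 [Hd1 H1]]. destruct (D2 eps Heps) as [d2 [Hd2 H2]].
  set (rho := Rmin eta (Rmin d1 d2) / 2).
  assert (Hm : 0 < Rmin eta (Rmin d1 d2)) by (repeat apply Rmin_glb_lt; assumption).
  assert (g0 := Rmin_l eta (Rmin d1 d2)). assert (g3 := Rmin_r eta (Rmin d1 d2)).
  assert (g1 := Rmin_l d1 d2). assert (g2 := Rmin_r d1 d2).
  assert (Hrho : 0 < rho) by (unfold rho; lra).
  exists (rho / (4 * (A + 1))). split; [apply Rdiv_lt_0_compat; lra|].
  intros B HB.
  set (Li := fun p : C2 => (((d * fst p - b * snd p) / D)%C,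
                            ((a * snd p - c * fst p) / D)%C) : C2).
  assert (HLi1 : forall p, (a * fst (Li p) + b * snd (Li p))%C = fst p).
  { intros p. unfold Li; simpl. unfold D. field. exact det. }
  assert (HLi2 : forall p, (c * fst (Li p) + d * snd (Li p))%C = snd p).
  { intros p. unfold Li; simpl. unfold D. field. exact det. }
  assert (HLin : forall p, norm2 (Li p) <= A * (Cmod (fst p) + Cmod (snd p))).
  { intros p. eapply Rle_trans; [apply norm2_le_sum|].
    exact (linear_solve_bound a b c d _ _ _ _ det (HLi1 p) (HLi2 p)). }
  destruct (contraction_fixpoint (fun P => sub2 P (Li (sub2 (Phi P) B))) zero2 rho Hrho) as [P [HP EP]].
  - intros P Q HP HQ. rewrite norm2_sub_0 in HP, HQ. unfold rho in HP, HQ.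
    specialize (H1 P Q ltac:(lra) ltac:(lra)). specialize (H2 P Q ltac:(lra) ltac:(lra)). cbv beta in H1, H2.
    set (E := ((a * (fst P - fst Q) + b * (snd P - snd Q) - (fst (Phi P) - fst (Phi Q)))%C,
               (c * (fst P - fst Q) + d * (snd P - snd Q) - (snd (Phi P) - snd (Phi Q)))%C) : C2).
    replace (sub2 (sub2 P (Li (sub2 (Phi P) B))) (sub2 Q (Li (sub2 (Phi Q) B)))) with (Li E).
    2:{ unfold Li, E, sub2, D; simpl. f_equal; field; exact det. }
    eapply Rle_trans; [apply HLin|]. unfold E; simpl fst; simpl snd.
    rewrite (Cmod_minus_sym (a * _ + _)%C), (Cmod_minus_sym (c * _ + _)%C).
    assert (HN0 := norm2_ge0 (sub2 P Q)).
    apply Rle_trans with (A * (eps * norm2 (sub2 P Q) + eps * norm2 (sub2 P Q))).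
    + apply Rmult_le_compat_l; lra.
    + apply Rle_trans with (2 * A * eps * norm2 (sub2 P Q)); [right; ring|]. now apply Rmult_le_compat_r.
  - cbv beta. rewrite norm2_sub_0. rewrite Phi0.
    replace (sub2 zero2 (Li (sub2 zero2 B))) with (Li B).
    2:{ unfold Li, sub2, zero2, D; simpl. f_equal; field; exact det. }
    eapply Rle_trans; [apply HLin|].
    assert (h1 := norm2_fst B). assert (h2 := norm2_snd B).
    apply Rle_trans with (A * (2 * (rho / (4 * (A + 1))))).
    + apply Rmult_le_compat_l; lra.
    + replace (A * (2 * (rho / (4 * (A + 1))))) with (rho / 2 * (A / (A + 1))) by (field; lra).
      rewrite <- (Rmult_1_r (rho / 2)) at 2. apply Rmult_le_compat_l; [lra|].
      apply Rmult_le_reg_r with (A + 1); [lra|]. replace (A / (A + 1) * (A + 1)) with A by (field; lra). lra.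
  - exists P. rewrite norm2_sub_0 in HP. split; [unfold rho in HP; lra|].
    assert (EL : Li (sub2 (Phi P) B) = zero2).
    { assert (e1 := f_equal fst EP). assert (e2 := f_equal snd EP). cbv beta in e1, e2.
      unfold sub2 at 1 in e1. unfold sub2 at 1 in e2. cbn [fst snd] in e1, e2.
      destruct (Li (sub2 (Phi P) B)) as [l1 l2]. cbn [fst snd] in e1, e2. unfold zero2. f_equal.
      - replace l1 with (fst P - (fst P - l1))%C by ring. rewrite e1. ring.
      - replace l2 with (snd P - (snd P - l2))%C by ring. rewrite e2. ring. }
    assert (e1 := HLi1 (sub2 (Phi P) B)). assert (e2 := HLi2 (sub2 (Phi P) B)).
    rewrite EL in e1, e2. simpl in e1, e2.
    destruct (Phi P) as [f1 f2], B as [b1 b2]. simpl in e1, e2. f_equal; apply Ceq_minus.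
    + rewrite <- e1. ring.
    + rewrite <- e2. ring.
Qed.
End LocalInverse.

(** Strict differentiability of the m-th power at 1, by induction through the product rule. For m >=
    1 it makes xi -> xi^m injective and bi-Lipschitz near 1; the bound 1/2 on eta keeps these xi
    away from 0. *)
Lemma Cpow_near_1 (m : nat) : forall eps, 0 < eps -> exists eta, 0 < eta <= / 2 /\ forall x y,
  Cmod (x - 1) <= eta -> Cmod (y - 1) <= eta ->
  Cmod (x ^ m - y ^ m - RtoC (INR m) * (x - y)) <= eps * Cmod (x - y).
Proof.
  induction m as [|m IH]; intros eps He.
  - exists (/ 2). split; [lra|]. intros x y _ _. simpl.
    replace (1 - 1 - 0 * (x - y))%C with (RtoC 0) by ring.
    rewrite Cmod_0. apply Rmult_le_pos; [lra|apply Cmod_ge_0].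
  - destruct (IH (eps / 4) ltac:(lra)) as [e1 [He1 H1]].
    destruct (IH 1 ltac:(lra)) as [e2 [He2 H2]].
    assert (Hm := pos_INR m).
    set (e3 := eps / (8 * (INR m + 1))).
    assert (He3 : 0 < e3) by (apply Rdiv_lt_0_compat; lra).
    assert (He3' : (INR m + 1) * e3 = eps / 8) by (unfold e3; field; lra).
    exists (Rmin e1 (Rmin e2 e3)).
    assert (g1 := Rmin_l e1 (Rmin e2 e3)). assert (g2 := Rmin_r e1 (Rmin e2 e3)).
    assert (g3 := Rmin_l e2 e3). assert (g4 := Rmin_r e2 e3).
    split; [split; [repeat apply Rmin_glb_lt; lra|lra]|]. intros x y Hx Hy.
    assert (A1 := H1 x y ltac:(lra) ltac:(lra)).
    assert (A2 := H2 x y ltac:(lra) ltac:(lra)).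
    assert (A3 := H2 y (RtoC 1) ltac:(lra)).
    rewrite Cpow_1_l in A3. replace (1 - 1)%C with (RtoC 0) in A3 by ring.
    rewrite Cmod_0 in A3. specialize (A3 ltac:(lra)).
    set (N := Cmod (x - y)) in *. assert (HN : 0 <= N) by apply Cmod_ge_0.
    assert (B1 : Cmod (x ^ m - y ^ m) <= (INR m + 1) * N).
    { assert (h := Cmod_minus_ge (x ^ m - y ^ m)%C (RtoC (INR m) * (x - y))%C).
      rewrite Cmod_mult, Cmod_R, Rabs_pos_eq in h by exact Hm. fold N in h. lra. }
    assert (B2 : Cmod (y ^ m - 1) <= (INR m + 1) * e3).
    { assert (h := Cmod_minus_ge (y ^ m - 1)%C (RtoC (INR m) * (y - 1))%C).
      rewrite Cmod_mult, Cmod_R, Rabs_pos_eq in h by exact Hm.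
      assert ((INR m + 1) * Cmod (y - 1) <= (INR m + 1) * e3) by (apply Rmult_le_compat_l; lra). lra. }
    replace (x ^ (S m) - y ^ (S m) - RtoC (INR (S m)) * (x - y))%C with
      (x ^ m - y ^ m - RtoC (INR m) * (x - y) + (x - 1) * (x ^ m - y ^ m) + (y ^ m - 1) * (x - y))%C.
    2:{ rewrite !Cpow_S, S_INR, RtoC_plus. ring. }
    eapply Rle_trans; [apply Cmod_triangle|].
    eapply Rle_trans; [apply Rplus_le_compat_r, Cmod_triangle|]. rewrite !Cmod_mult. fold N.
    assert (C1 : Cmod (x - 1) * Cmod (x ^ m - y ^ m) <= e3 * ((INR m + 1) * N)).
    { apply Rmult_le_compat; try apply Cmod_ge_0; lra. }
    assert (C2 : Cmod (y ^ m - 1) * N <= (INR m + 1) * e3 * N) by now apply Rmult_le_compat_r.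
    replace (e3 * ((INR m + 1) * N)) with ((INR m + 1) * e3 * N) in C1 by ring.
    rewrite He3' in C1, C2. 
    assert (0 <= eps * N) by (apply Rmult_le_pos; lra). lra.
Qed.

Lemma pow_lt_inv (x y : R) (n : nat) : 0 <= y -> x ^ n < y ^ n -> x < y.
Proof.
  intros Hy H. apply Rnot_le_lt. intros Hle. apply (Rlt_irrefl (x ^ n)).
  eapply Rlt_le_trans; [exact H|]. now apply pow_incr.
Qed.

Lemma pow_le_inv (x y : R) (n : nat) : (1 <= n)%nat -> 0 <= y -> x ^ n <= y ^ n -> x <= y.
Proof.
  intros Hn Hy H. apply Rnot_lt_le. intros Hlt. apply (Rlt_irrefl (x ^ n)).
  eapply Rle_lt_trans; [exact H|]. destruct n as [|n]; [lia|]. clear - Hy Hlt.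
  induction n as [|n IH]; [simpl; lra|]. simpl in *. apply Rmult_le_0_lt_compat; try lra.
  apply Rmult_le_pos; [exact Hy|now apply pow_le].
Qed.

Lemma Cpow_0_l (m : nat) : (1 <= m)%nat -> (0 ^ m)%C = RtoC 0.
Proof. intros H. destruct m; [lia|]. rewrite Cpow_S. ring. Qed.

(** * The parametrization of the zero locus *)

Definition scal2 (t : R) (p : C2) : C2 := ((RtoC t * fst p)%C, (RtoC t * snd p)%C).

Lemma norm2_scal2 (t : R) (p : C2) : 0 <= t -> norm2 (scal2 t p) = t * norm2 p.
Proof.
  intros Ht. unfold norm2, scal2; simpl. rewrite !Cmod_mult, !Cmod_R, Rabs_pos_eq by exact Ht.
  replace t with (sqrt (t ^ 2)) at 5 by now apply sqrt_pow2.
  rewrite <- sqrt_mult_alt by apply pow2_ge_0. f_equal. ring.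
Qed.

Section Curve.
Variables (Phi : C2 -> C2) (a b c d : C).
Hypothesis Phi0 : Phi zero2 = zero2.
Hypothesis D1 : strict_diff (fun p => fst (Phi p)) a b.
Hypothesis D2 : strict_diff (fun p => snd (Phi p)) c d.
Hypothesis det : (a * d - b * c)%C <> RtoC 0.
Variables (m : nat) (Psi : C -> C) (rho0 KP : R).
Hypothesis Hm : (1 <= m)%nat.
Hypothesis Hrho0 : 0 < rho0.
Hypothesis HKP : 0 <= KP.
Hypothesis Psi0 : Psi (RtoC 0) = RtoC 0.
Hypothesis HPsi : forall X x y, Cmod x <= X -> Cmod y <= X -> X <= rho0 ->
  Cmod (Psi x - Psi y) <= KP * X ^ m * Cmod (x - y).

Lemma Psi_le (x : C) : Cmod x <= rho0 -> Cmod (Psi x) <= KP * Cmod x ^ m * Cmod x.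
Proof.
  intros Hx. assert (h := HPsi (Cmod x) x (RtoC 0) ltac:(lra)).
  rewrite Cmod_0, Psi0 in h. specialize (h (Cmod_ge_0 _) Hx).
  replace (Psi x - 0)%C with (Psi x) in h by ring.
  replace (x - 0)%C with x in h by ring. exact h.
Qed.

(** [q x] is the preimage of (x^m, Psi x) under the chart. Besides the bi-Lipschitz bounds two finer
    facts are kept. The first coordinate is d/(ad - bc) x^m to leading order, where differences of
    [Psi] are counted only up to [K]; this serves to solve for the points of a slice. And q (t x)
    follows the ray through q x with small relative error, because Psi is of higher order than x^m;
    this serves to reach a given sphere. *)
Lemma curve_exists (f : C2 -> C) (eps rho : R) :
  0 < eps -> 0 < rho ->
  (forall p, norm2 p < eps -> (f p = RtoC 0 <->
     exists x, Cmod x < rho /\ fst (Phi p) = (x ^ m)%C /\ Psi x = snd (Phi p))) ->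
  exists (q : C -> C2) (delta K : R), 0 < delta <= rho0 /\ delta <= 1 /\ 0 < K /\
    q (RtoC 0) = zero2 /\
    (forall x, Cmod x < delta -> f (q x) = RtoC 0) /\
    (exists e0, 0 < e0 /\ forall p, norm2 p < e0 -> f p = RtoC 0 -> exists x, Cmod x < delta /\ q x = p) /\
    (forall x y, Cmod x < delta -> Cmod y < delta ->
       norm2 (sub2 (q x) (q y)) <= K * (Cmod (x ^ m - y ^ m) + Cmod (Psi x - Psi y)) /\
       Cmod (x ^ m - y ^ m) <= K * norm2 (sub2 (q x) (q y)) /\
       Cmod (Psi x - Psi y) <= K * norm2 (sub2 (q x) (q y))) /\
    (forall e, 0 < e -> exists del, 0 < del /\ forall x y, Cmod x < del -> Cmod y < del ->
       Cmod (fst (q x) - fst (q y) - d / (a * d - b * c) * (x ^ m - y ^ m))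
       <= e * Cmod (x ^ m - y ^ m) + K * Cmod (Psi x - Psi y)) /\
    (forall e, 0 < e -> exists del, 0 < del /\ forall x t, Cmod x < del -> 0 <= t <= 2 ->
       norm2 (sub2 (q (RtoC t * x)%C) (scal2 (t ^ m) (q x))) <= e * (Rabs (t ^ m - 1) * Cmod x ^ m)).
Proof.
  intros Heps Hrho Hf.
  destruct (chart_bilipschitz Phi a b c d D1 D2 det) as [d0 [K0 [Hd0 [HK0 Hbil]]]].
  set (D := (a * d - b * c)%C) in *.
  assert (HDp := proj1 (Cmod_gt_0 _) det).
  set (eta := Rmin d0 eps). assert (Heta : 0 < eta) by now apply Rmin_glb_lt.
  assert (He1 : eta <= d0) by apply Rmin_l. assert (He2 : eta <= eps) by apply Rmin_r.
  destruct (chart_onto Phi a b c d Phi0 D1 D2 det eta Heta) as [d1 [Hd1 Honto]].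
  (* The bound [d1 / (2 + KP)] puts (x^m, Psi x), of norm at most (1 + KP) |x|, into the range of
     the chart; [delta <= 1] gives |x|^m <= |x|. *)
  set (delta := Rmin (Rmin rho0 rho) (Rmin 1 (d1 / (2 + KP)))).
  assert (Hq1 : 0 < d1 / (2 + KP)) by (apply Rdiv_lt_0_compat; lra).
  assert (Hdel : 0 < delta) by (repeat apply Rmin_glb_lt; lra).
  assert (g1 : delta <= rho0) by rmin_le.
  assert (g2 : delta <= rho) by rmin_le.
  assert (g3 : delta <= 1) by rmin_le.
  assert (g4 : delta <= d1 / (2 + KP)) by rmin_le.
  assert (g5 : delta * (2 + KP) <= d1).
  { apply Rle_trans with (d1 / (2 + KP) * (2 + KP)); [apply Rmult_le_compat_r; lra|right; field; lra]. }
  assert (Hex : forall x, exists P, Cmod x < delta -> norm2 P < eta /\ Phi P = ((x ^ m)%C, Psi x)).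
  { intros x. destruct (Rlt_dec (Cmod x) delta) as [Hx|Hx].
    2:{ exists zero2. intros h; contradiction. }
    destruct (Honto ((x ^ m)%C, Psi x)) as [P HP]; [|now exists P].
    eapply Rle_lt_trans; [apply norm2_le_sum|]. simpl fst; simpl snd. rewrite Cmod_pow.
    assert (h0 := Cmod_ge_0 x).
    assert (h1 := Psi_le x ltac:(lra)).
    assert (h2 : Cmod x ^ m <= Cmod x).
    { destruct m as [|k]; [lia|]. simpl. rewrite <- (Rmult_1_r (Cmod x)) at 3.
      apply Rmult_le_compat_l; [exact h0|]. rewrite <- (pow1 k). apply pow_incr. lra. }
    assert (h3 : KP * Cmod x ^ m * Cmod x <= KP * Cmod x * 1).
    { apply Rmult_le_compat; [apply Rmult_le_pos; [lra|now apply pow_le]|exact h0|apply Rmult_le_compat_l; lra|lra]. }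
    assert (Cmod x * (1 + KP) < delta * (2 + KP)) by nra. lra. }
  destruct (choice_fun _ Hex) as [q Hq].
  assert (Hinj : forall P Q, norm2 P < d0 -> norm2 Q < d0 -> Phi P = Phi Q -> P = Q).
  { intros P Q HP HQ E. destruct (Hbil P Q HP HQ) as [h _]. rewrite E, norm2_sub_diag in h.
    assert (h1 := norm2_fst (sub2 P Q)). assert (h2 := norm2_snd (sub2 P Q)). simpl in h1, h2.
    destruct P as [p1 p2], Q as [q1 q2]. simpl in h1, h2. f_equal; apply Ceq_minus, Cmod_le_0; lra. }
  assert (Hz0 : norm2 zero2 = 0) by (rewrite <- (norm2_sub_diag zero2), norm2_sub_0; reflexivity).
  assert (Hq0 : q (RtoC 0) = zero2).
  { destruct (Hq (RtoC 0)) as [h1 h2]; [rewrite Cmod_0; exact Hdel|].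
    apply Hinj; [lra|rewrite Hz0; lra|]. rewrite h2, Phi0, Psi0, Cpow_0_l by exact Hm. reflexivity. }
  assert (Hql : forall x y, Cmod x < delta -> Cmod y < delta ->
       norm2 (sub2 (q x) (q y)) <= K0 * (Cmod (x ^ m - y ^ m) + Cmod (Psi x - Psi y)) /\
       Cmod (x ^ m - y ^ m) <= K0 * norm2 (sub2 (q x) (q y)) /\
       Cmod (Psi x - Psi y) <= K0 * norm2 (sub2 (q x) (q y))).
  { intros x y Hx Hy. destruct (Hq x Hx) as [h1 h2]. destruct (Hq y Hy) as [h3 h4].
    destruct (Hbil (q x) (q y) ltac:(lra) ltac:(lra)) as [k1 k2]. rewrite h2, h4 in k1, k2.
    assert (l1 := norm2_le_sum (sub2 ((x ^ m)%C, Psi x) ((y ^ m)%C, Psi y))).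
    assert (l2 := norm2_fst (sub2 ((x ^ m)%C, Psi x) ((y ^ m)%C, Psi y))).
    assert (l3 := norm2_snd (sub2 ((x ^ m)%C, Psi x) ((y ^ m)%C, Psi y))).
    simpl in l1, l2, l3. split; [|split; lra].
    eapply Rle_trans; [exact k1|]. apply Rmult_le_compat_l; [lra|exact l1]. }
  assert (Hqc : forall e, 0 < e -> exists del, 0 < del /\ forall x, Cmod x < del -> Cmod x < delta /\ norm2 (q x) < e).
  { intros e He. exists (Rmin delta (e / (K0 * (1 + KP)))).
    assert (Hkk : 0 < K0 * (1 + KP)) by (apply Rmult_lt_0_compat; lra).
    assert (0 < e / (K0 * (1 + KP))) by now apply Rdiv_lt_0_compat.
    split; [now apply Rmin_glb_lt|]. intros x Hx.
    assert (i1 := Rmin_l delta (e / (K0 * (1 + KP)))). assert (i2 := Rmin_r delta (e / (K0 * (1 + KP)))).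
    assert (Hxd : Cmod x < delta) by lra. split; [exact Hxd|].
    destruct (Hql x (RtoC 0) Hxd ltac:(rewrite Cmod_0; exact Hdel)) as [h _].
    rewrite Hq0, norm2_sub_0, Psi0, Cpow_0_l in h by exact Hm.
    replace (x ^ m - 0)%C with (x ^ m)%C in h by ring.
    replace (Psi x - 0)%C with (Psi x) in h by ring. rewrite Cmod_pow in h.
    assert (h0 := Cmod_ge_0 x).
    assert (h1 := Psi_le x ltac:(lra)).
    assert (h2 : Cmod x ^ m <= Cmod x).
    { destruct m as [|k]; [lia|]. simpl. rewrite <- (Rmult_1_r (Cmod x)) at 3.
      apply Rmult_le_compat_l; [exact h0|]. rewrite <- (pow1 k). apply pow_incr. lra. }
    assert (h3 : KP * Cmod x ^ m * Cmod x <= KP * Cmod x * 1).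
    { apply Rmult_le_compat; [apply Rmult_le_pos; [lra|now apply pow_le]|exact h0|apply Rmult_le_compat_l; lra|lra]. }
    apply Rle_lt_trans with (K0 * (1 + KP) * Cmod x).
    - eapply Rle_trans; [exact h|]. rewrite Rmult_assoc. apply Rmult_le_compat_l; lra.
    - apply Rlt_le_trans with (K0 * (1 + KP) * (e / (K0 * (1 + KP)))); [apply Rmult_lt_compat_l; lra|].
      right. field. lra. }
  set (A := (Cmod a + Cmod b + Cmod c + Cmod d) / Cmod D).
  assert (ga := Cmod_ge_0 a). assert (gb := Cmod_ge_0 b). assert (gc := Cmod_ge_0 c). assert (gd := Cmod_ge_0 d).
  assert (HA : 0 <= A) by (apply Rmult_le_pos; [lra|now apply Rlt_le, Rinv_0_lt_compat]).
  set (K := K0 + A + 1).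
  exists q, delta, K. repeat split; try assumption.
  - unfold K; lra.
  - intros x Hx. destruct (Hq x Hx) as [h1 h2]. apply Hf; [lra|]. exists x. rewrite h2. simpl.
    split; [lra|split; reflexivity].
  (* A zero p with parameter x has |x|^m = |fst (Phi p)| <= K0 |p|, so a bound delta^m / K0 on |p|
     brings x into the disc where [q] is controlled. *)
  - set (e0 := Rmin (Rmin d0 eps) (delta ^ m / K0)).
    assert (Hdm : 0 < delta ^ m / K0) by (apply Rdiv_lt_0_compat; [now apply pow_lt|exact HK0]).
    exists e0. split; [repeat apply Rmin_glb_lt; assumption|]. intros p Hp Hfp.
    assert (i1 : e0 <= d0) by rmin_le.
    assert (i2 : e0 <= eps) by rmin_le.
    assert (i3 : e0 <= delta ^ m / K0) by apply Rmin_r.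
    destruct (proj1 (Hf p ltac:(lra)) Hfp) as [x [Hx [E1 E2]]].
    assert (Hxd : Cmod x < delta).
    { apply pow_lt_inv with m; [lra|]. rewrite <- Cmod_pow, <- E1.
      destruct (Hbil p zero2 ltac:(lra) ltac:(rewrite Hz0; lra)) as [_ h].
      rewrite Phi0, !norm2_sub_0 in h. assert (h' := norm2_fst (Phi p)).
      assert (K0 * norm2 p < K0 * (delta ^ m / K0)) by (apply Rmult_lt_compat_l; lra).
      replace (K0 * (delta ^ m / K0)) with (delta ^ m) in H by (field; lra). lra. }
    exists x. split; [exact Hxd|]. destruct (Hq x Hxd) as [h1 h2]. apply Hinj; [lra|lra|].
    rewrite h2, (surjective_pairing (Phi p)), E1, E2. reflexivity.
  - destruct (Hql x y H H0) as [h _]. eapply Rle_trans; [exact h|]. apply Rmult_le_compat_r; [|unfold K; lra].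
    apply Rplus_le_le_0_compat; apply Cmod_ge_0.
  - destruct (Hql x y H H0) as [_ [h _]]. eapply Rle_trans; [exact h|]. apply Rmult_le_compat_r; [|unfold K; lra].
    apply norm2_ge0.
  - destruct (Hql x y H H0) as [_ [_ h]]. eapply Rle_trans; [exact h|]. apply Rmult_le_compat_r; [|unfold K; lra].
    apply norm2_ge0.
  - intros e He.
    set (e' := Rmin e 1 / (2 * (A + 1) * (K0 + 1))).
    assert (Hm1 : 0 < Rmin e 1) by (apply Rmin_glb_lt; lra).
    assert (j1 := Rmin_l e 1). assert (j2 := Rmin_r e 1).
    assert (Hden : 0 < 2 * (A + 1) * (K0 + 1)) by (apply Rmult_lt_0_compat; lra).
    assert (He' : 0 < e') by now apply Rdiv_lt_0_compat.
    assert (He'1 : 2 * A * (e' * K0) <= Rmin e 1).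
    { apply Rle_trans with (2 * (A + 1) * (K0 + 1) * e'); [|right; unfold e'; field; lra].
      assert (0 <= e' * K0) by (apply Rmult_le_pos; lra). assert (0 <= A * e') by (apply Rmult_le_pos; lra). nra. }
    destruct (D1 e' He') as [r1 [Hr1 S1]]. destruct (D2 e' He') as [r2 [Hr2 S2]].
    destruct (Hqc (Rmin r1 r2)) as [del [Hdl Hdl2]]; [now apply Rmin_glb_lt|].
    assert (j3 := Rmin_l r1 r2). assert (j4 := Rmin_r r1 r2).
    exists del. split; [exact Hdl|]. intros x y Hx Hy.
    destruct (Hdl2 x Hx) as [Hx1 Hx2]. destruct (Hdl2 y Hy) as [Hy1 Hy2].
    specialize (S1 (q x) (q y) ltac:(lra) ltac:(lra)). specialize (S2 (q x) (q y) ltac:(lra) ltac:(lra)).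
    cbv beta in S1, S2. destruct (Hq x Hx1) as [_ Ex]. destruct (Hq y Hy1) as [_ Ey].
    rewrite Ex, Ey in S1, S2. simpl fst in S1 at 1 2. simpl snd in S2 at 1 2.
    destruct (Hql x y Hx1 Hy1) as [k1 _].
    set (U := (fst (q x) - fst (q y))%C) in *. set (V := (snd (q x) - snd (q y))%C) in *.
    set (P := (x ^ m - y ^ m)%C) in *. set (Q := (Psi x - Psi y)%C) in *.
    set (N := norm2 (sub2 (q x) (q y))) in *.
    set (E1 := (P - (a * U + b * V))%C) in *.
    set (E2 := (Q - (c * U + d * V))%C) in *.
    (* Cramer's rule with the remainders E1 and E2. The term b Q comes from the linear part itself,
       so it is bounded by a constant times |Q| and not by a small one. *)
    replace (U - d / D * P)%C with
      ((b * E2 - d * E1 - b * Q) / D)%C.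
    2:{ unfold E1, E2, D. field. exact det. }
    rewrite Cmod_div by exact det.
    apply Rle_trans with (A * (Cmod E1 + Cmod E2 + Cmod Q)).
    { unfold A, Rdiv. rewrite Rmult_assoc, (Rmult_comm (/ Cmod D)), <- Rmult_assoc.
      apply Rmult_le_compat_r; [now apply Rlt_le, Rinv_0_lt_compat|].
      eapply Rle_trans; [apply Cmod_minus_le|].
      assert (h := Cmod_minus_le (b * E2)%C (d * E1)%C). rewrite !Cmod_mult in *.
      assert (e1 := Cmod_ge_0 E1). assert (e2 := Cmod_ge_0 E2). assert (e3 := Cmod_ge_0 Q).
      assert (0 <= Cmod a * (Cmod E1 + Cmod E2 + Cmod Q)) by (apply Rmult_le_pos; lra).
      assert (0 <= Cmod c * (Cmod E1 + Cmod E2 + Cmod Q)) by (apply Rmult_le_pos; lra).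
      assert (0 <= Cmod b * Cmod E1) by (apply Rmult_le_pos; lra).
      assert (0 <= Cmod d * Cmod E2) by (apply Rmult_le_pos; lra).
      assert (0 <= Cmod d * Cmod Q) by (apply Rmult_le_pos; lra). nra. }
    assert (e3 := Cmod_ge_0 Q). assert (e4 := Cmod_ge_0 P).
    assert (k2 : e' * N <= e' * (K0 * (Cmod P + Cmod Q))) by (apply Rmult_le_compat_l; lra).
    assert (k3 : A * (Cmod E1 + Cmod E2 + Cmod Q) <= A * (2 * (e' * (K0 * (Cmod P + Cmod Q))) + Cmod Q)) by (apply Rmult_le_compat_l; lra).
    assert (k4 : 2 * A * (e' * K0) * (Cmod P + Cmod Q) <= Rmin e 1 * (Cmod P + Cmod Q)) by (apply Rmult_le_compat_r; lra).
    assert (k5 : Rmin e 1 * Cmod P <= e * Cmod P) by (apply Rmult_le_compat_r; lra).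
    assert (k6 : Rmin e 1 * Cmod Q <= 1 * Cmod Q) by (apply Rmult_le_compat_r; lra).
    assert (0 <= K0 * Cmod Q) by (apply Rmult_le_pos; lra).
    unfold K. nra.
  - intros e He.
    set (B := 2 ^ m * KP).
    assert (H2m : 1 <= 2 ^ m) by (apply pow_R1_Rle; lra).
    assert (HB : 0 <= B) by (apply Rmult_le_pos; lra).
    set (G := K0 * (1 + B) + K0 * (1 + KP)).
    assert (HG : 0 < G).
    { unfold G. assert (0 < K0 * (1 + B)) by (apply Rmult_lt_0_compat; lra).
      assert (0 < K0 * (1 + KP)) by (apply Rmult_lt_0_compat; lra). lra. }
    set (e' := e / (4 * (A + 1) * G)).
    assert (Hden : 0 < 4 * (A + 1) * G) by (apply Rmult_lt_0_compat; lra).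
    assert (He' : 0 < e') by now apply Rdiv_lt_0_compat.
    destruct (D1 e' He') as [r1 [Hr1 S1]]. destruct (D2 e' He') as [r2 [Hr2 S2]].
    destruct (Hqc (Rmin r1 r2)) as [del [Hdl Hdl2]]; [now apply Rmin_glb_lt|].
    assert (j3 := Rmin_l r1 r2). assert (j4 := Rmin_r r1 r2).
    (* [e'] makes the remainders of the chart cost half of e, and [del2] does the same for the terms
       in [Psi], which carry a factor |x|. *)
    set (del2 := e / (2 * (A + 1) * (B + KP + 1))).
    assert (Hden2 : 0 < 2 * (A + 1) * (B + KP + 1)) by (apply Rmult_lt_0_compat; lra).
    assert (Hdel2 : 0 < del2) by now apply Rdiv_lt_0_compat.
    exists (Rmin (del / 2) (Rmin (delta / 2) del2)).
    split; [repeat apply Rmin_glb_lt; lra|]. intros x t Hx Ht.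
    assert (i1 := Rmin_l (del / 2) (Rmin (delta / 2) del2)). assert (i2 := Rmin_r (del / 2) (Rmin (delta / 2) del2)).
    assert (i3 := Rmin_l (delta / 2) del2). assert (i4 := Rmin_r (delta / 2) del2).
    assert (hx0 := Cmod_ge_0 x).
    set (y := (RtoC t * x)%C).
    assert (Hymod : Cmod y = t * Cmod x) by (unfold y; rewrite Cmod_mult, Cmod_R, Rabs_pos_eq; lra).
    assert (Hyx : Cmod y <= 2 * Cmod x) by (rewrite Hymod; apply Rmult_le_compat_r; lra).
    destruct (Hdl2 x ltac:(lra)) as [Hx1 Hx2]. destruct (Hdl2 y ltac:(lra)) as [Hy1 Hy2].
    destruct (Hq x Hx1) as [_ Ex]. destruct (Hq y Hy1) as [_ Ey].
    assert (Hzr : norm2 zero2 < Rmin r1 r2) by (rewrite Hz0; now apply Rmin_glb_lt).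
    assert (S1' := S1 (q x) zero2 ltac:(lra) ltac:(lra)). assert (S2' := S2 (q x) zero2 ltac:(lra) ltac:(lra)).
    specialize (S1 (q y) (q x) ltac:(lra) ltac:(lra)). specialize (S2 (q y) (q x) ltac:(lra) ltac:(lra)).
    cbv beta in S1, S2, S1', S2'. rewrite Phi0, norm2_sub_0 in S1', S2'.
    rewrite Ey in S1, S2. rewrite Ex in S1, S2, S1', S2'. simpl fst in S1, S1'. simpl snd in S2, S2'.
    set (tm := t ^ m) in *.
    assert (Htm : 0 <= tm) by (apply pow_le; lra).
    assert (Epow : (y ^ m)%C = (RtoC tm * x ^ m)%C).
    { unfold y. rewrite Cpow_mult_l. unfold tm. now rewrite RtoC_pow. }
    set (w := sub2 (q y) (scal2 tm (q x))).
    set (T := Rabs (tm - 1)). set (Xm := Cmod x ^ m).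
    assert (HT0 : 0 <= T) by apply Rabs_pos. assert (HXm : 0 <= Xm) by now apply pow_le.
    assert (HtT : Rabs (t - 1) <= T).
    { unfold T, tm. destruct m as [|k]; [lia|]. destruct (Rle_dec 1 t) as [h|h].
      - assert (1 <= t ^ k) by now apply pow_R1_Rle. simpl. rewrite !Rabs_pos_eq; nra.
      - assert (t ^ k <= 1) by (rewrite <- (pow1 k); apply pow_incr; lra).
        assert (0 <= t ^ k) by (apply pow_le; lra). simpl. rewrite !Rabs_left1; nra. }
    assert (HPyx : Cmod (Psi y - Psi x) <= B * Xm * (T * Cmod x)).
    { eapply Rle_trans; [apply (HPsi (2 * Cmod x)); lra|].
      replace (y - x)%C with (RtoC (t - 1)%R * x)%C by (unfold y; rewrite RtoC_minus; ring).
      rewrite Cmod_mult, Cmod_R, Rpow_mult_distr. fold Xm.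
      replace (KP * (2 ^ m * Xm)) with (B * Xm) by (unfold B; ring).
      apply Rmult_le_compat_l; [now apply Rmult_le_pos|]. now apply Rmult_le_compat_r. }
    assert (HPx : Cmod (Psi x) <= KP * Xm * Cmod x) by (apply Psi_le; lra).
    assert (Hpp : Cmod (y ^ m - x ^ m) = T * Xm).
    { rewrite Epow. replace (RtoC tm * x ^ m - x ^ m)%C with (RtoC (tm - 1)%R * x ^ m)%C by (rewrite RtoC_minus; ring).
      rewrite Cmod_mult, Cmod_R, Cmod_pow. reflexivity. }
    assert (Hqyx : norm2 (sub2 (q y) (q x)) <= K0 * (1 + B) * (T * Xm)).
    { destruct (Hql y x Hy1 Hx1) as [h _]. rewrite Hpp in h. eapply Rle_trans; [exact h|].
      rewrite Rmult_assoc. apply Rmult_le_compat_l; [lra|].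
      assert (B * Xm * (T * Cmod x) <= B * Xm * (T * 1)).
      { apply Rmult_le_compat_l; [now apply Rmult_le_pos|]. apply Rmult_le_compat_l; lra. }
      nra. }
    assert (Hqx : norm2 (q x) <= K0 * (1 + KP) * Xm).
    { destruct (Hql x (RtoC 0) Hx1 ltac:(rewrite Cmod_0; exact Hdel)) as [h _].
      rewrite Hq0, norm2_sub_0, Psi0, Cpow_0_l in h by exact Hm.
      replace (x ^ m - 0)%C with (x ^ m)%C in h by ring.
      replace (Psi x - 0)%C with (Psi x) in h by ring. rewrite Cmod_pow in h. fold Xm in h.
      eapply Rle_trans; [exact h|]. rewrite Rmult_assoc. apply Rmult_le_compat_l; [lra|].
      assert (KP * Xm * Cmod x <= KP * Xm * 1).
      { apply Rmult_le_compat_l; [now apply Rmult_le_pos|lra]. }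
      lra. }
    assert (Hlin := linear_solve_bound a b c d (fst w) (snd w) _ _ det eq_refl eq_refl). fold D A in Hlin.
    set (s1 := (a * fst w + b * snd w)%C) in *.
    set (s2 := (c * fst w + d * snd w)%C) in *.
    assert (Hw := norm2_le_sum w).
    set (F1 := (y ^ m - x ^ m - (a * (fst (q y) - fst (q x)) + b * (snd (q y) - snd (q x))))%C) in *.
    set (F2 := (Psi y - Psi x - (c * (fst (q y) - fst (q x)) + d * (snd (q y) - snd (q x))))%C) in *.
    match type of S1' with Cmod ?z <= _ => set (F3 := z) in * end.
    match type of S2' with Cmod ?z <= _ => set (F4 := z) in * end.
    (* x^m is exactly homogeneous, so in the first chart coordinate only remainders of strict
       differentiability are left. *)
    assert (Es1 : s1 = (- F1 + RtoC (tm - 1)%R * F3)%C).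
    { unfold s1, w, F1, F3, sub2, scal2, zero2; simpl. rewrite Epow, RtoC_minus. ring. }
    assert (Es2 : s2 = (Psi y - Psi x + - F2 + RtoC (tm - 1)%R * (F4 - Psi x))%C).
    { unfold s2, w, F2, F4, sub2, scal2, zero2; simpl. rewrite RtoC_minus. ring. }
    assert (Hs1 : Cmod s1 <= e' * (K0 * (1 + B) * (T * Xm)) + T * (e' * (K0 * (1 + KP) * Xm))).
    { rewrite Es1. eapply Rle_trans; [apply Cmod_triangle|]. rewrite Cmod_opp, Cmod_mult, Cmod_R. fold T.
      apply Rplus_le_compat.
      - eapply Rle_trans; [exact S1|]. apply Rmult_le_compat_l; lra.
      - apply Rmult_le_compat_l; [exact HT0|]. eapply Rle_trans; [exact S1'|]. apply Rmult_le_compat_l; lra. }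
    assert (Hs2 : Cmod s2 <= B * Xm * (T * Cmod x) + e' * (K0 * (1 + B) * (T * Xm)) + T * (e' * (K0 * (1 + KP) * Xm) + KP * Xm * Cmod x)).
    { rewrite Es2. eapply Rle_trans; [apply Cmod_triangle|]. rewrite Cmod_mult, Cmod_R. fold T.
      apply Rplus_le_compat.
      - eapply Rle_trans; [apply Cmod_triangle|]. rewrite Cmod_opp. apply Rplus_le_compat; [exact HPyx|].
        eapply Rle_trans; [exact S2|]. apply Rmult_le_compat_l; lra.
      - apply Rmult_le_compat_l; [exact HT0|]. eapply Rle_trans; [apply Cmod_minus_le|].
        apply Rplus_le_compat; [|exact HPx]. eapply Rle_trans; [exact S2'|]. apply Rmult_le_compat_l; lra. }
    fold w. eapply Rle_trans; [exact Hw|]. eapply Rle_trans; [exact Hlin|].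
    assert (HTX : 0 <= T * Xm) by now apply Rmult_le_pos.
    assert (Hsum : Cmod s1 + Cmod s2 <= (2 * e' * G + (B + KP) * Cmod x) * (T * Xm)).
    { unfold G. lra. }
    apply Rle_trans with ((A + 1) * ((2 * e' * G + (B + KP + 1) * del2) * (T * Xm))).
    + apply Rmult_le_compat; [exact HA| |lra|].
      { apply Rplus_le_le_0_compat; apply Cmod_ge_0. }
      eapply Rle_trans; [exact Hsum|]. apply Rmult_le_compat_r; [exact HTX|].
      apply Rplus_le_compat_l. apply Rmult_le_compat; lra.
    + replace (2 * e' * G) with (e / 2 / (A + 1)) by (unfold e'; field; lra).
      replace ((B + KP + 1) * del2) with (e / 2 / (A + 1)) by (unfold del2; field; lra).
      right. field. lra.
Qed.
End Curve.

(** * Polar form and roots of unity *)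

Definition cis (t : R) : C := (cos t, sin t).

Lemma cis_plus (s t : R) : cis (s + t) = (cis s * cis t)%C.
Proof. unfold cis, Cmult; simpl. rewrite cos_plus, sin_plus. f_equal; ring. Qed.

Lemma cis_0 : cis 0 = RtoC 1.
Proof. unfold cis. now rewrite cos_0, sin_0. Qed.

Lemma cis_pow (t : R) (n : nat) : (cis t ^ n)%C = cis (INR n * t).
Proof.
  induction n as [|n IH].
  - simpl. now rewrite Rmult_0_l, cis_0.
  - rewrite Cpow_S, IH, <- cis_plus. f_equal. rewrite S_INR. ring.
Qed.

Lemma Cmod_cis (t : R) : Cmod (cis t) = 1.
Proof.
  unfold Cmod, cis; simpl. transitivity (sqrt 1); [f_equal|apply sqrt_1].
  assert (h := sin2_cos2 t). unfold Rsqr in h. simpl. lra.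
Qed.

Lemma cis_eq_1 (t : R) : 0 <= t < 2 * PI -> cis t = RtoC 1 -> t = 0.
Proof.
  intros Ht E. assert (Ec : cos t = 1) by exact (f_equal fst E).
  destruct (Req_dec t 0) as [h|h]; [exact h|exfalso].
  assert (E2 := cos_2a_sin (t / 2)). replace (2 * (t / 2)) with t in E2 by field.
  assert (Ht0 : 0 < t) by (apply Rnot_le_lt; intros h'; apply h; lra).
  assert (hs : 0 < sin (t / 2)) by (apply sin_gt_0; lra). assert (0 < sin (t / 2) * sin (t / 2)) by now apply Rmult_lt_0_compat. lra.
Qed.

Lemma polar_form (z : C) : exists t, z = (RtoC (Cmod z) * cis t)%C.
Proof.
  destruct (Ceq_dec z (RtoC 0)) as [->|Hz].
  { exists 0. rewrite Cmod_0. ring. }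
  assert (Hr := proj1 (Cmod_gt_0 z) Hz).
  destruct z as [x y]. set (r := Cmod (x, y)) in *.
  assert (Hr2 : r ^ 2 = x ^ 2 + y ^ 2).
  { unfold r, Cmod; simpl fst; simpl snd. rewrite <- Rsqr_pow2, Rsqr_sqrt; [reflexivity|].
    assert (h1 := pow2_ge_0 x). assert (h2 := pow2_ge_0 y). lra. }
  assert (Hc : -1 <= x / r <= 1).
  { assert (h : Rabs x <= r) by apply (Rle_trans _ _ _ (Rmax_l _ _) (Rmax_Cmod (x, y))).
    apply Rabs_le_between in h. split; apply Rmult_le_reg_r with r; try lra;
    unfold Rdiv; rewrite Rmult_assoc, Rinv_l; lra. }
  assert (Hsin : sin (acos (x / r)) = Rabs y / r).
  { rewrite sin_acos by exact Hc.
    replace (1 - (x / r)²) with ((y / r) ^ 2).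
    - rewrite <- Rsqr_pow2, sqrt_Rsqr_abs. unfold Rdiv. rewrite Rabs_mult, Rabs_inv.
      now rewrite (Rabs_pos_eq r) by lra.
    - unfold Rsqr. apply Rmult_eq_reg_r with (r ^ 2); [|apply pow_nonzero; lra].
      replace ((y / r) ^ 2 * r ^ 2) with (y ^ 2) by (field; lra).
      replace ((1 - x / r * (x / r)) * r ^ 2) with (r ^ 2 - x ^ 2) by (field; lra). lra. }
  destruct (Rle_dec 0 y) as [hy|hy].
  - exists (acos (x / r)). unfold cis, Cmult, RtoC; simpl.
    rewrite cos_acos, Hsin, Rabs_pos_eq by assumption. f_equal; field; lra.
  - exists (- acos (x / r)). unfold cis, Cmult, RtoC; simpl.
    rewrite cos_neg, sin_neg, cos_acos, Hsin, Rabs_left by lra. f_equal; field; lra.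
Qed.

Lemma Croot_exists (m : nat) (z : C) : (1 <= m)%nat -> exists w, (w ^ m)%C = z.
Proof.
  intros Hm. destruct (Ceq_dec z (RtoC 0)) as [->|Hz].
  { exists (RtoC 0). now apply Cpow_0_l. }
  assert (Hr := proj1 (Cmod_gt_0 z) Hz). destruct (polar_form z) as [t Ht].
  assert (Hm0 : INR m <> 0) by (apply not_0_INR; lia).
  exists (RtoC (Rpower (Cmod z) (/ INR m)) * cis (t / INR m))%C.
  rewrite Cpow_mult_l, cis_pow, <- RtoC_pow, <- Rpower_pow by apply exp_pos.
  rewrite Rpower_mult, Rinv_l, Rpower_1 by assumption.
  replace (INR m * (t / INR m)) with t by (field; assumption). now rewrite <- Ht.
Qed.

Definition zeta (m : nat) : C := cis (2 * PI / INR m).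

Lemma Cmod_zeta_pow (m i : nat) : Cmod (zeta m ^ i) = 1.
Proof. unfold zeta. rewrite Cmod_pow, Cmod_cis. apply pow1. Qed.

Lemma zeta_pow_eq_1 (m i : nat) : (1 <= m)%nat -> ((zeta m ^ i)%C = RtoC 1 <-> Nat.divide m i).
Proof.
  intros Hm. assert (Hm0 : 0 < INR m) by (apply lt_0_INR; lia).
  assert (E1 : (zeta m ^ m)%C = RtoC 1).
  { unfold zeta. rewrite cis_pow. replace (INR m * (2 * PI / INR m)) with (2 * PI) by (field; lra).
    unfold cis. now rewrite cos_2PI, sin_2PI. }
  split.
  - intros E. rewrite (Nat.div_mod_eq i m) in E.
    rewrite Cpow_add_r, Cpow_mult_r, E1, Cpow_1_l, Cmult_1_l in E.
    assert (Hmod : (i mod m < m)%nat) by (apply Nat.mod_upper_bound; lia).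
    unfold zeta in E. rewrite cis_pow in E. apply cis_eq_1 in E.
    + apply Nat.Lcm0.mod_divide.
      assert (h : INR (i mod m) = 0).
      { apply Rmult_eq_reg_r with (2 * PI / INR m); [rewrite E; ring|].
        assert (0 < 2 * PI / INR m); [|lra]. apply Rdiv_lt_0_compat; [assert (h := PI_RGT_0); lra|exact Hm0]. }
      apply INR_eq. exact h.
    + assert (hp := PI_RGT_0). assert (h0 := pos_INR (i mod m)).
      assert (h1 : INR (i mod m) < INR m) by now apply lt_INR.
      replace (INR (i mod m) * (2 * PI / INR m)) with (2 * PI * (INR (i mod m) / INR m)) by (field; lra).
      assert (h2 : 0 <= INR (i mod m) / INR m) by (apply Rmult_le_pos; [lra|now apply Rlt_le, Rinv_0_lt_compat]).
      assert (h3 : INR (i mod m) / INR m < 1).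
      { apply Rmult_lt_reg_r with (INR m); [lra|]. unfold Rdiv. rewrite Rmult_assoc, Rinv_l; lra. }
      split; [apply Rmult_le_pos; lra|]. nra.
  - intros [k ->]. rewrite Nat.mul_comm, Cpow_mult_r, E1. apply Cpow_1_l.
Qed.

Lemma zeta_pow_m (m i : nat) : (1 <= m)%nat -> ((zeta m ^ i) ^ m)%C = RtoC 1.
Proof.
  intros Hm. rewrite <- Cpow_mult_r. apply zeta_pow_eq_1; [exact Hm|]. now exists i.
Qed.

(** * Finite products, and restriction of a double power series to slices *)

Fixpoint rprod (g : nat -> R) (n : nat) : R :=
  match n with O => 1 | S n' => rprod g n' * g n' end.

Lemma Cmod_cprod (g : nat -> C) (n : nat) : Cmod (cprod g n) = rprod (fun i => Cmod (g i)) n.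
Proof.
  induction n as [|n IH]; simpl; [apply Cmod_1|]. now rewrite Cmod_mult, IH.
Qed.

Lemma rprod_ge0 (g : nat -> R) (n : nat) : (forall i, (i < n)%nat -> 0 <= g i) -> 0 <= rprod g n.
Proof.
  induction n as [|n IH]; intros H; simpl; [lra|].
  apply Rmult_le_pos; [apply IH; intros i Hi; apply H; lia|apply H; lia].
Qed.

Lemma rprod_const (x : R) (n : nat) : rprod (fun _ => x) n = x ^ n.
Proof. induction n as [|n IH]; simpl; [reflexivity|]. rewrite IH. ring. Qed.

(** Regrouping by powers of v is Fubini for an absolutely convergent double series. The coefficients
    of a slice are themselves power series in u, and their bound [2 * M] does not depend on u, which
    keeps the constants of the division uniform over the slices. *)
Lemma slice_expansion (r : R) (c : nat -> nat -> C) (f : C2 -> C) :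
  ser2_rep r c f -> exists (M : R) (s : C -> nat -> C),
    (forall j, coef_bound (M / r ^ j) r (fun i => c i j)) /\
    (forall u, Cmod u <= r / 2 -> coef_bound (2 * M) r (s u) /\
       (forall j, ser1 (fun i => c i j) u (s u j)) /\
       (forall v, Cmod v <= r / 2 -> ser1 (s u) v (f (u, v)))).
Proof.
  intros [Hr [[M HM] Hf]]. exists M.
  assert (Hcb : forall j, coef_bound (M / r ^ j) r (fun i => c i j)).
  { intros j i. specialize (HM i j). rewrite pow_add in HM.
    apply Rmult_le_reg_r with (r ^ j); [now apply pow_lt|].
    replace (M / r ^ j * r ^ j) with M by (field; apply pow_nonzero; lra). lra. }
  assert (Hex : forall u j, exists l, Cmod u <= r / 2 ->
     ser1 (fun i => c i j) u l /\ Cmod l <= 2 * (M / r ^ j)).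
  { intros u j. destruct (Rle_dec (Cmod u) (r / 2)) as [h|h].
    - destruct (ser1_exists (M / r ^ j) r (fun i => c i j) u Hr (Hcb j) h) as [l Hl]. now exists l.
    - exists (RtoC 0). contradiction. }
  destruct (choice_fun _ (fun u => choice_fun _ (Hex u))) as [s Hs].
  exists s. split; [exact Hcb|]. intros u Hu. split; [|split].
  - intros j. destruct (Hs u j Hu) as [_ h].
    apply Rle_trans with (2 * (M / r ^ j) * r ^ j).
    + apply Rmult_le_compat_r; [apply pow_le; lra|exact h].
    + right. field. apply pow_nonzero; lra.
  - intros j. now apply Hs.
  - intros v Hv.
    destruct (Hf u v ltac:(lra) ltac:(lra)) as [g [Hg Hl]].
    assert (Hterm : forall i j, Cmod (c i j * (u ^ i * v ^ j)) <= M * (/ 2) ^ i * (/ 2) ^ j).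
    { intros i j. rewrite Cmod_mult.
      assert (h1 : Cmod (c i j) <= M / r ^ (i + j)).
      { apply Rmult_le_reg_r with (r ^ (i + j)); [now apply pow_lt|].
        replace (M / r ^ (i + j) * r ^ (i + j)) with M by (field; apply pow_nonzero; lra). apply HM. }
      assert (h2 := Cpow2_le u v (r / 2) i j Hu Hv).
      apply Rle_trans with (M / r ^ (i + j) * (r / 2) ^ (i + j)).
      - apply Rmult_le_compat; try apply Cmod_ge_0; assumption.
      - right. unfold Rdiv. rewrite Rpow_mult_distr, !pow_add. field. split; apply pow_nonzero; lra. }
    assert (Hrow : forall i, ex_series (fun j => Cmod (c i j * (u ^ i * v ^ j)))).
    { intros i. apply (ex_series_le (V := R_CompleteNormedModule)) with (fun j => M * (/ 2) ^ i * (/ 2) ^ j).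
      - intros j. unfold norm; simpl. unfold abs; simpl. rewrite Rabs_pos_eq by apply Cmod_ge_0. apply Hterm.
      - eexists. apply is_series_half. }
    destruct (cser_fubini (fun i j => (c i j * (u ^ i * v ^ j))%C)
      (fun i => Series (fun j => Cmod (c i j * (u ^ i * v ^ j)))) g (f (u, v))) as [Q [HQ1 HQ2]].
    + intros i. apply Series_correct, Hrow.
    + apply (ex_series_le (V := R_CompleteNormedModule)) with (fun i => 2 * M * (/ 2) ^ i).
      * intros i. unfold norm; simpl. unfold abs; simpl.
        assert (E : Series (fun j => M * (/ 2) ^ i * (/ 2) ^ j) = 2 * (M * (/ 2) ^ i)) by apply is_series_unique, is_series_half.
        rewrite Rabs_pos_eq.
        -- replace (2 * M * (/ 2) ^ i) with (2 * (M * (/ 2) ^ i)) by ring. rewrite <- E. apply Series_le.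
           ++ intros j. split; [apply Cmod_ge_0|apply Hterm].
           ++ eexists. apply is_series_half.
        -- assert (h := is_series_term_le _ _ 0%nat (fun j => Cmod_ge_0 _) (Series_correct _ (Hrow i))).
           cbv beta in h. eapply Rle_trans; [apply Cmod_ge_0|exact h].
      * eexists. apply is_series_half.
    + exact Hg.
    + exact Hl.
    + eapply cser_ext; [|exact HQ2]. intros j. cbv beta.
      apply cser_unique with (fun i => (c i j * (u ^ i * v ^ j))%C); [apply HQ1|].
      replace (s u j * v ^ j)%C with (v ^ j * s u j)%C by ring.
      eapply cser_ext; [|apply cser_scal, (proj1 (Hs u j Hu))]. intros i. cbv beta. ring.
Qed.

(** The expansion regrouped by columns is that of the exchanged function; it is available for moduli
    up to r / 2, hence the smaller radius. *)
Lemma ser2_rep_swap (r : R) (c : nat -> nat -> C) (f : C2 -> C) :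
  ser2_rep r c f -> exists r', ser2_rep r' (fun i j => c j i) (fun p => f (snd p, fst p)).
Proof.
  intros Hrep. destruct (slice_expansion r c f Hrep) as [M0 [s [_ Hs]]].
  destruct Hrep as [Hr [[M HM] _]]. exists (r / 2). split; [lra|]. split.
  - exists M. intros i j. eapply Rle_trans; [|apply (HM j i)]. rewrite (Nat.add_comm j i).
    apply Rmult_le_compat_l; [apply Cmod_ge_0|]. apply pow_incr. lra.
  - intros x y Hx Hy. destruct (Hs y ltac:(lra)) as [_ [h1 h2]].
    exists (fun i => (s y i * x ^ i)%C). split; [|apply h2; lra].
    intros i. replace (s y i * x ^ i)%C with (x ^ i * s y i)%C by ring.
    eapply cser_ext; [|apply cser_scal, (h1 i)]. intros j. cbv beta. ring.
Qed.

Lemma dist_set_spec (p : C2) (S : C2 -> Prop) (d : R) :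
  dist_set p S = Finite d ->
  (forall q, S q -> d <= norm2 (sub2 p q)) /\
  (forall eps, 0 < eps -> exists q, S q /\ norm2 (sub2 p q) < d + eps).
Proof.
  intros E. destruct (Glb_Rbar_correct (fun d => exists q, S q /\ d = norm2 (sub2 p q))) as [Hlb Hgr].
  unfold dist_set in E. rewrite E in Hlb, Hgr. split.
  - intros q Hq. apply (Hlb (norm2 (sub2 p q))). now exists q.
  - intros eps He. apply NNPP. intros Hn.
    assert (h : Rbar_le (Finite (d + eps)) (Finite d)).
    { apply Hgr. intros x [q [Hq ->]]. simpl. apply Rnot_lt_le. intros Hlt. apply Hn. now exists q. }
    simpl in h. lra.
Qed.

(** * Distances to the branches *)

(* [D i] is the distance, inside the slice through [p], from [p] to the i-th branch. *)
Definition branch_distances (m : nat) (B : nat -> nat) (f : C2 -> C) (K : R) (p : C2) (r dd : R) : Prop :=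
  exists D : nat -> R,
    (forall i, (i < m)%nat -> 0 <= D i /\ dd <= K * D i /\
       D i <= K * (dd + (if Nat.eqb i 0 then 0 else r ^ B i)) /\
       ((0 < i)%nat -> r ^ B i <= K * (D i + dd))) /\
    rprod D m <= K * Cmod (f p) /\ Cmod (f p) <= K * rprod D m.

Lemma branch_distances_mono (m : nat) (B : nat -> nat) (f : C2 -> C) (K K' : R) (p : C2) (r dd : R) :
  K <= K' -> 0 <= r -> 0 <= dd -> branch_distances m B f K p r dd -> branch_distances m B f K' p r dd.
Proof.
  intros HK Hr Hd [D [H1 [H2 H3]]]. exists D. split; [|split].
  - intros i Hi. destruct (H1 i Hi) as [h0 [h1 [h2 h3]]].
    assert (hs : 0 <= if Nat.eqb i 0 then 0 else r ^ B i) by (destruct (Nat.eqb i 0); [lra|now apply pow_le]).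
    split; [exact h0|]. split; [|split].
    + eapply Rle_trans; [exact h1|]. now apply Rmult_le_compat_r.
    + eapply Rle_trans; [exact h2|]. apply Rmult_le_compat_r; lra.
    + intros hi. eapply Rle_trans; [now apply h3|]. apply Rmult_le_compat_r; lra.
  - eapply Rle_trans; [exact H2|]. apply Rmult_le_compat_r; [apply Cmod_ge_0|exact HK].
  - eapply Rle_trans; [exact H3|]. apply Rmult_le_compat_r; [|exact HK].
    apply rprod_ge0. intros i Hi. now apply H1.
Qed.

Lemma Cmod_near_1 (x : C) (eta : R) : eta <= / 2 -> Cmod (x - 1) <= eta -> / 2 <= Cmod x <= 2.
Proof.
  intros He H. assert (h1 := Cmod_minus_ge x (RtoC 1)).
  assert (h2 := Cmod_minus_ge (RtoC 1) x). rewrite (Cmod_minus_sym (RtoC 1)) in h2. rewrite Cmod_1 in *. lra.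
Qed.

Lemma bounded_on_prefix (b : nat -> nat) (n : nat) : exists N, forall i, (i < n)%nat -> (b i <= N)%nat.
Proof.
  induction n as [|n [N IH]]; [exists 0%nat; lia|]. exists (N + b n)%nat. intros i Hi.
  destruct (Nat.eq_dec i n) as [->|E]; [lia|]. specialize (IH i ltac:(lia)). lia.
Qed.

(* Throughout, [q x] is the point of the curve with [Phi (q x) = (x ^ m, Psi x)];
   its first coordinate is [kap * x ^ m] to leading order, and [B i] is the order
   of [Psi x - Psi (zeta ^ i x)]. *)
Section Geometry.
Variables (m : nat) (Psi : C -> C) (rho0 KP : R).
Hypothesis Hm : (1 <= m)%nat.
Hypothesis HKP : 0 <= KP.
Hypothesis Psi0 : Psi (RtoC 0) = RtoC 0.
Hypothesis HPsi : forall X x y, Cmod x <= X -> Cmod y <= X -> X <= rho0 ->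
  Cmod (Psi x - Psi y) <= KP * X ^ m * Cmod (x - y).
Variables (f : C2 -> C) (q : C -> C2) (delta K : R) (kap : C).
Hypothesis Hdelta : 0 < delta <= rho0.
Hypothesis Hdelta1 : delta <= 1.
Hypothesis HK : 0 < K.
Hypothesis Hkap : kap <> RtoC 0.
Hypothesis Hq0 : q (RtoC 0) = zero2.
Hypothesis Hfq : forall x, Cmod x < delta -> f (q x) = RtoC 0.
Hypothesis Hqf : exists e0, 0 < e0 /\ forall p, norm2 p < e0 -> f p = RtoC 0 -> exists x, Cmod x < delta /\ q x = p.
Hypothesis Hbil : forall x y, Cmod x < delta -> Cmod y < delta ->
   norm2 (sub2 (q x) (q y)) <= K * (Cmod (x ^ m - y ^ m) + Cmod (Psi x - Psi y)) /\
   Cmod (x ^ m - y ^ m) <= K * norm2 (sub2 (q x) (q y)) /\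
   Cmod (Psi x - Psi y) <= K * norm2 (sub2 (q x) (q y)).
Hypothesis Hstrict : forall e, 0 < e -> exists del, 0 < del /\ forall x y, Cmod x < del -> Cmod y < del ->
   Cmod (fst (q x) - fst (q y) - kap * (x ^ m - y ^ m))
   <= e * Cmod (x ^ m - y ^ m) + K * Cmod (Psi x - Psi y).
Hypothesis Hray : forall e, 0 < e -> exists del, 0 < del /\ forall x t, Cmod x < del -> 0 <= t <= 2 ->
   norm2 (sub2 (q (RtoC t * x)%C) (scal2 (t ^ m) (q x))) <= e * (Rabs (t ^ m - 1) * Cmod x ^ m).
Variables (B : nat -> nat) (KB : R).
Hypothesis HKB : 0 < KB.
Hypothesis HBm : forall i, (0 < i < m)%nat -> (m <= B i)%nat.
Hypothesis Hsep : forall i x, (0 < i < m)%nat -> Cmod x < delta ->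
  Cmod x ^ B i <= KB * Cmod (Psi x - Psi (zeta m ^ i * x)%C) /\
  Cmod (Psi x - Psi (zeta m ^ i * x)%C) <= KB * Cmod x ^ B i.
Variables (rf : R) (cf : nat -> nat -> C).
Hypothesis Hrep : ser2_rep rf cf f.
Hypothesis Hlow : forall i j, (i + j < m)%nat -> cf i j = RtoC 0.
Hypothesis Htop : exists i j, (i + j = m)%nat /\ cf i j <> RtoC 0.

(** The constant of comparison between |q x| and |x|^m; the + 1 makes it at least 1, so that its
    powers increase. *)
Let K1 := K * (1 + KP) + 1.

Lemma K1_ge_1 : 1 <= K1.
Proof. unfold K1. assert (0 <= K * (1 + KP)) by (apply Rmult_le_pos; lra). lra. Qed.

Lemma kap_pos : 0 < Cmod kap.
Proof. now apply Cmod_gt_0. Qed.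

Lemma INRm_ge_1 : 1 <= INR m.
Proof. change 1 with (INR 1). now apply le_INR. Qed.

Lemma curve_norm (x : C) : Cmod x < delta ->
  norm2 (q x) <= K1 * Cmod x ^ m /\ Cmod x ^ m <= K1 * norm2 (q x).
Proof.
  intros Hx. destruct (Hbil x (RtoC 0) Hx ltac:(rewrite Cmod_0; lra)) as [h1 [h2 _]].
  rewrite Hq0, norm2_sub_0, Psi0, Cpow_0_l in h1 by exact Hm.
  rewrite Hq0, norm2_sub_0, Cpow_0_l in h2 by exact Hm.
  replace (x ^ m - 0)%C with (x ^ m)%C in h1, h2 by ring.
  replace (Psi x - 0)%C with (Psi x) in h1 by ring. rewrite Cmod_pow in h1, h2.
  assert (h0 := Cmod_ge_0 x). assert (hm : 0 <= Cmod x ^ m) by now apply pow_le.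
  assert (hP := HPsi (Cmod x) x (RtoC 0) ltac:(lra)). rewrite Cmod_0, Psi0 in hP.
  specialize (hP h0 ltac:(lra)).
  replace (Psi x - 0)%C with (Psi x) in hP by ring.
  replace (x - 0)%C with x in hP by ring.
  assert (hP' : KP * Cmod x ^ m * Cmod x <= KP * Cmod x ^ m * 1).
  { apply Rmult_le_compat_l; [now apply Rmult_le_pos|lra]. }
  assert (hn := norm2_ge0 (q x)). unfold K1. split.
  - apply Rle_trans with (K * (Cmod x ^ m + KP * Cmod x ^ m)).
    + eapply Rle_trans; [exact h1|]. apply Rmult_le_compat_l; lra.
    + lra.
  - assert (0 <= K * KP * norm2 (q x)) by (apply Rmult_le_pos; [apply Rmult_le_pos; lra|exact hn]). lra.
Qed.

Lemma curve_fst_near (e : R) : 0 < e -> exists del, 0 < del <= delta /\ forall x, Cmod x < del ->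
  Cmod (fst (q x) - kap * x ^ m) <= e * Cmod x ^ m.
Proof.
  intros He. destruct (Hstrict (e / 2) ltac:(lra)) as [d1 [Hd1 H1]].
  set (d2 := e / (2 * (K * KP + 1))).
  assert (hKK : 0 <= K * KP) by (apply Rmult_le_pos; lra).
  assert (Hd2 : 0 < d2) by (apply Rdiv_lt_0_compat; lra).
  exists (Rmin delta (Rmin d1 d2)).
  assert (g1 := Rmin_l delta (Rmin d1 d2)). assert (g2 := Rmin_r delta (Rmin d1 d2)).
  assert (g3 := Rmin_l d1 d2). assert (g4 := Rmin_r d1 d2).
  split; [split; [repeat apply Rmin_glb_lt; lra|exact g1]|]. intros x Hx.
  specialize (H1 x (RtoC 0) ltac:(lra) ltac:(rewrite Cmod_0; lra)).
  rewrite Hq0, Psi0, Cpow_0_l in H1 by exact Hm. simpl fst in H1 at 2.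
  replace (fst (q x) - 0)%C with (fst (q x)) in H1 by ring.
  replace (x ^ m - 0)%C with (x ^ m)%C in H1 by ring.
  replace (Psi x - 0)%C with (Psi x) in H1 by ring. rewrite Cmod_pow in H1.
  assert (h0 := Cmod_ge_0 x). assert (hm : 0 <= Cmod x ^ m) by now apply pow_le.
  assert (hP := HPsi (Cmod x) x (RtoC 0) ltac:(lra)). rewrite Cmod_0, Psi0 in hP.
  specialize (hP h0 ltac:(lra)).
  replace (Psi x - 0)%C with (Psi x) in hP by ring.
  replace (x - 0)%C with x in hP by ring.
  eapply Rle_trans; [exact H1|].
  assert (hh : K * KP * Cmod x <= e / 2).
  { apply Rle_trans with ((K * KP + 1) * d2); [|right; unfold d2; field; lra].
    apply Rmult_le_compat; lra. }
  assert (K * Cmod (Psi x) <= K * (KP * Cmod x ^ m * Cmod x)) by (apply Rmult_le_compat_l; lra).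
  assert (K * KP * Cmod x * Cmod x ^ m <= e / 2 * Cmod x ^ m) by now apply Rmult_le_compat_r.
  lra.
Qed.

(** The extra factor |z| against |z|^m is what makes [Psi] a perturbation in the slice equation. *)
Lemma Psi_diff_scaled (z x y : C) : 2 * Cmod z <= rho0 ->
  Cmod x <= 2 -> Cmod y <= 2 ->
  Cmod (Psi (z * x)%C - Psi (z * y)%C) <= KP * 2 ^ m * Cmod z * (Cmod z ^ m * Cmod (x - y)).
Proof.
  intros Hz Hx Hy. assert (hz := Cmod_ge_0 z).
  eapply Rle_trans; [apply (HPsi (2 * Cmod z)); [| |exact Hz]|].
  - rewrite Cmod_mult. rewrite (Rmult_comm 2). now apply Rmult_le_compat_l.
  - rewrite Cmod_mult. rewrite (Rmult_comm 2). now apply Rmult_le_compat_l.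
  - replace (z * x - z * y)%C with (z * (x - y))%C by ring.
    rewrite Cmod_mult, Rpow_mult_distr. right. ring.
Qed.

(** With the unknown written as z xi, xi near 1, the equation can be divided by m kap z^m, the
    derivative of kap (z xi)^m at xi = 1. The Newton step then contracts a disc whose radius does
    not depend on z. *)
Lemma slice_point (eta : R) : 0 < eta <= / 2 -> exists eta' del, 0 < eta' /\ 0 < del <= delta / 2 /\
  forall z b, z <> RtoC 0 -> Cmod z < del -> Cmod (b - z ^ m) <= eta' * Cmod z ^ m ->
  exists xi, Cmod (xi - 1) <= eta /\ fst (q (z * xi)%C) = (kap * b)%C.
Proof.
  intros Heta. assert (Hk := kap_pos). assert (HmR := INRm_ge_1).
  destruct (Cpow_near_1 m (/ 4) ltac:(lra)) as [e1 [He1 Hn]].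
  set (eta1 := Rmin eta e1). assert (Heta1 : 0 < eta1) by (apply Rmin_glb_lt; lra).
  assert (i1 : eta1 <= eta) by apply Rmin_l. assert (i2 : eta1 <= e1) by apply Rmin_r.
  destruct (Hstrict (Cmod kap / 16) ltac:(lra)) as [d1 [Hd1 H1]].
  destruct (curve_fst_near (Cmod kap * eta1 / 8)) as [d2 [Hd2 H2]].
  { apply Rdiv_lt_0_compat; [now apply Rmult_lt_0_compat|lra]. }
  set (G := K * (KP * 2 ^ m)).
  assert (H2m : 1 <= 2 ^ m) by (apply pow_R1_Rle; lra).
  assert (HG : 0 <= G) by (apply Rmult_le_pos; [lra|apply Rmult_le_pos; lra]).
  set (d3 := Cmod kap / (8 * (G + 1))).
  assert (Hd3 : 0 < d3) by (apply Rdiv_lt_0_compat; lra).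
  set (del := Rmin (delta / 2) (Rmin (d1 / 2) (Rmin d2 d3))).
  assert (g1 : del <= delta / 2) by apply Rmin_l.
  assert (g2 : del <= d1 / 2) by rmin_le.
  assert (g3 : del <= d2) by rmin_le.
  assert (g4 : del <= d3) by rmin_le.
  exists (eta1 / 8), del. split; [lra|]. split.
  { split; [|exact g1]. repeat apply Rmin_glb_lt; lra. }
  intros z b Hz Hzd Hb. assert (Hz0 := proj1 (Cmod_gt_0 z) Hz).
  set (Z := Cmod z ^ m). assert (HZ : 0 < Z) by now apply pow_lt.
  assert (Hzm : (z ^ m)%C <> RtoC 0) by now apply Cpow_nz.
  assert (HmC : RtoC (INR m) <> RtoC 0).
  { intros E. apply RtoC_inj in E. lra. }
  assert (Hden : (RtoC (INR m) * (kap * z ^ m))%C <> RtoC 0) by (repeat apply Cmult_neq_0; assumption).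
  assert (Hdmod : Cmod (RtoC (INR m) * (kap * z ^ m)) = INR m * (Cmod kap * Z)).
  { rewrite !Cmod_mult, Cmod_R, Cmod_pow, Rabs_pos_eq by lra. reflexivity. }
  assert (HkZ : 0 < Cmod kap * Z) by now apply Rmult_lt_0_compat.
  assert (HkZm : Cmod kap * Z <= INR m * (Cmod kap * Z)).
  { rewrite <- (Rmult_1_l (Cmod kap * Z)) at 1. apply Rmult_le_compat_r; lra. }
  destruct (contraction_fixpoint_C
    (fun xi => (xi - (fst (q (z * xi)%C) - kap * b) / (RtoC (INR m) * (kap * z ^ m)))%C)
    (RtoC 1) eta1 Heta1) as [xi [Hxi Exi]].
  - intros x y Hx Hy.
    destruct (Cmod_near_1 x eta1 ltac:(lra) Hx) as [_ Hx2]. destruct (Cmod_near_1 y eta1 ltac:(lra) Hy) as [_ Hy2].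
    assert (Hzx : Cmod (z * x) < d1) by (rewrite Cmod_mult; nra).
    assert (Hzy : Cmod (z * y) < d1) by (rewrite Cmod_mult; nra).
    assert (A1 := H1 _ _ Hzx Hzy). rewrite !Cpow_mult_l in A1.
    assert (A2 := Psi_diff_scaled z x y ltac:(lra) Hx2 Hy2).
    assert (A3 := Hn x y ltac:(lra) ltac:(lra)).
    fold Z in A2. set (N := Cmod (x - y)) in *. assert (HN : 0 <= N) by apply Cmod_ge_0.
    set (P := (x ^ m - y ^ m)%C) in *.
    replace (z ^ m * x ^ m - z ^ m * y ^ m)%C with (z ^ m * P)%C in A1 by (unfold P; ring).
    set (E := (fst (q (z * x)%C) - fst (q (z * y)%C) - kap * (z ^ m * P))%C) in *.
    assert (HP : Cmod P <= 2 * INR m * N).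
    { assert (h := Cmod_minus_ge P (RtoC (INR m) * (x - y))%C).
      rewrite Cmod_mult, Cmod_R, Rabs_pos_eq in h by lra. fold N in h.
      assert (/ 4 * N <= INR m * N) by (apply Rmult_le_compat_r; lra). lra. }
    (* Each of the two quotients contributes a factor 1/4: the first by strict differentiability of
       xi^m, the second because the first coordinate of q deviates little from kap x^m. *)
    match goal with |- Cmod ?w <= _ => replace w with
      ((RtoC (INR m) * (x - y) - P) / RtoC (INR m) - E / (RtoC (INR m) * (kap * z ^ m)))%C end.
    2:{ unfold E. field. repeat split; assumption. }
    eapply Rle_trans; [apply Cmod_minus_le|]. rewrite !Cmod_div, Hdmod by assumption.
    rewrite Cmod_R, Rabs_pos_eq by lra. rewrite (Cmod_minus_sym _ P).
    assert (B1 : Cmod (P - RtoC (INR m) * (x - y)) / INR m <= / 4 * N).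
    { apply Rmult_le_reg_r with (INR m); [lra|]. unfold Rdiv. rewrite Rmult_assoc, Rinv_l by lra.
      rewrite Rmult_1_r. assert (/ 4 * N <= / 4 * N * INR m); [|lra].
      rewrite <- (Rmult_1_r (/ 4 * N)) at 1. apply Rmult_le_compat_l; lra. }
    assert (B2 : Cmod E / (INR m * (Cmod kap * Z)) <= / 4 * N).
    { apply Rmult_le_reg_r with (INR m * (Cmod kap * Z)); [lra|]. unfold Rdiv. rewrite Rmult_assoc, Rinv_l by lra.
      rewrite Rmult_1_r. eapply Rle_trans; [exact A1|]. rewrite Cmod_mult, Cmod_pow. fold Z.
      assert (C1 : Cmod kap / 16 * (Z * Cmod P) <= / 8 * N * (INR m * (Cmod kap * Z))).
      { apply Rle_trans with (Cmod kap / 16 * (Z * (2 * INR m * N))); [|right; field].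
        apply Rmult_le_compat_l; [lra|]. apply Rmult_le_compat_l; lra. }
      assert (C2 : K * (KP * 2 ^ m * Cmod z * (Z * N)) <= / 8 * N * (Cmod kap * Z)).
      { apply Rle_trans with (G * Cmod z * (Z * N)); [right; unfold G; ring|].
        apply Rle_trans with (Cmod kap / 8 * (Z * N)); [|right; field].
        apply Rmult_le_compat_r; [apply Rmult_le_pos; lra|].
        apply Rle_trans with ((G + 1) * d3); [apply Rmult_le_compat; lra|]. right. unfold d3. field. lra. }
      assert (C3 : / 8 * N * (Cmod kap * Z) <= / 8 * N * (INR m * (Cmod kap * Z))) by (apply Rmult_le_compat_l; lra).
      assert (K * Cmod (Psi (z * x)%C - Psi (z * y)%C) <= K * (KP * 2 ^ m * Cmod z * (Z * N))) by (apply Rmult_le_compat_l; lra).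
      lra. }
    lra.
  - cbv beta. rewrite Cmult_1_r.
    match goal with |- Cmod ?w <= _ => replace w with
      (- ((fst (q z) - kap * z ^ m + kap * (z ^ m - b)) / (RtoC (INR m) * (kap * z ^ m))))%C end.
    2:{ field. repeat split; assumption. }
    rewrite Cmod_opp, Cmod_div, Hdmod by assumption.
    apply Rmult_le_reg_r with (INR m * (Cmod kap * Z)); [lra|]. unfold Rdiv at 1. rewrite Rmult_assoc, Rinv_l by lra.
    rewrite Rmult_1_r. eapply Rle_trans; [apply Cmod_triangle|]. rewrite Cmod_mult.
    assert (A1 := H2 z ltac:(lra)). fold Z in A1. fold Z in Hb. rewrite Cmod_minus_sym in Hb.
    assert (A2 : Cmod kap * Cmod (z ^ m - b) <= Cmod kap * (eta1 / 8 * Z)) by (apply Rmult_le_compat_l; lra).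
    assert (A3 : eta1 / 2 * (Cmod kap * Z) <= eta1 / 2 * (INR m * (Cmod kap * Z))) by (apply Rmult_le_compat_l; lra).
    assert (0 < eta1 * (Cmod kap * Z)) by now apply Rmult_lt_0_compat.
    lra.
  - exists xi. split; [lra|]. cbv beta in Exi.
    assert (E : ((fst (q (z * xi)%C) - kap * b) / (RtoC (INR m) * (kap * z ^ m)))%C = RtoC 0).
    { match type of Exi with (_ - ?w)%C = _ => replace w with (xi - (xi - w))%C by ring end.
      rewrite Exi. ring. }
    apply Ceq_minus.
    replace (fst (q (z * xi)%C) - kap * b)%C with
      ((fst (q (z * xi)%C) - kap * b) / (RtoC (INR m) * (kap * z ^ m)) * (RtoC (INR m) * (kap * z ^ m)))%C.
    + rewrite E. ring.
    + field. repeat split; assumption.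
Qed.

Lemma curve_inj (x y : C) : Cmod x < delta -> Cmod y < delta -> q x = q y ->
  (x ^ m)%C = (y ^ m)%C /\ Psi x = Psi y.
Proof.
  intros Hx Hy E. destruct (Hbil x y Hx Hy) as [_ [h1 h2]]. rewrite E, norm2_sub_diag in h1, h2.
  split; apply Ceq_minus, Cmod_le_0; lra.
Qed.

(** The conjugates zeta^i z share their m-th power, so each of them starts a solution in the same
    slice. If two solutions had the same image under q, then xi_i = xi_j by injectivity of the power
    near 1, and [Psi] would agree at x and at a conjugate of x, against [Hsep]. *)
Lemma branch_points : exists eta' del, 0 < eta' /\ 0 < del <= delta / 2 /\
  forall z b, z <> RtoC 0 -> Cmod z < del -> Cmod (b - z ^ m) <= eta' * Cmod z ^ m ->
  exists xi : nat -> C,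
    (forall i, / 2 <= Cmod (xi i) <= 2 /\
       / 2 * Cmod (xi i - 1) <= Cmod (xi i ^ m - 1) <= 2 * INR m * Cmod (xi i - 1) /\
       fst (q (zeta m ^ i * z * xi i)%C) = (kap * b)%C) /\
    (forall i j, (i < j < m)%nat -> snd (q (zeta m ^ i * z * xi i)%C) <>
                                    snd (q (zeta m ^ j * z * xi j)%C)).
Proof.
  assert (HmR := INRm_ge_1).
  destruct (Cpow_near_1 m (/ 2) ltac:(lra)) as [e1 [He1 Hn]].
  destruct (slice_point e1 He1) as [eta' [del [He' [Hdel Hsp]]]].
  exists eta', del. split; [exact He'|]. split; [exact Hdel|].
  intros z b Hz Hzd Hb.
  assert (Hzi : forall i, Cmod (zeta m ^ i * z) = Cmod z).
  { intros i. rewrite Cmod_mult, Cmod_zeta_pow. ring. }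
  assert (Hzp : forall i, ((zeta m ^ i * z) ^ m)%C = (z ^ m)%C).
  { intros i. rewrite Cpow_mult_l, zeta_pow_m by exact Hm. ring. }
  assert (Hz0 := proj1 (Cmod_gt_0 z) Hz).
  assert (Hzi0 : forall i, (zeta m ^ i * z)%C <> RtoC 0).
  { intros i. apply Cmod_gt_0. rewrite Hzi. exact Hz0. }
  assert (Hex : forall i, exists xi, Cmod (xi - 1) <= e1 /\
      fst (q (zeta m ^ i * z * xi)%C) = (kap * b)%C).
  { intros i. apply Hsp; [apply Hzi0|now rewrite Hzi|]. now rewrite Hzi, Hzp. }
  destruct (choice_fun _ Hex) as [xi Hxi].
  assert (Hxm : forall i, / 2 <= Cmod (xi i) <= 2).
  { intros i. apply Cmod_near_1 with e1; [lra|]. apply Hxi. }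
  exists xi. split.
  - intros i. destruct (Hxi i) as [h1 h2]. split; [apply Hxm|]. split; [|exact h2].
    assert (h := Hn (xi i) (RtoC 1) h1).
    replace (1 - 1)%C with (RtoC 0) in h by ring. rewrite Cmod_0, Cpow_1_l in h.
    specialize (h ltac:(lra)).
    set (N := Cmod (xi i - 1)) in *. assert (HN : 0 <= N) by apply Cmod_ge_0.
    set (P := (xi i ^ m - 1)%C) in *.
    assert (k1 := Cmod_minus_ge P (RtoC (INR m) * (xi i - 1))%C).
    assert (k2 := Cmod_minus_ge (RtoC (INR m) * (xi i - 1))%C P).
    rewrite (Cmod_minus_sym _ P) in k2.
    rewrite !Cmod_mult, Cmod_R, Rabs_pos_eq in k1, k2 by lra. fold N in k1, k2.
    assert (1 * N <= INR m * N) by (apply Rmult_le_compat_r; lra). lra.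
  - intros i j Hij E.
    set (x := (zeta m ^ i * z * xi i)%C) in *.
    set (y := (zeta m ^ j * z * xi j)%C) in *.
    assert (Hx : Cmod x < delta).
    { unfold x. rewrite Cmod_mult, Hzi. specialize (Hxm i). nra. }
    assert (Hy : Cmod y < delta).
    { unfold y. rewrite Cmod_mult, Hzi. specialize (Hxm j). nra. }
    assert (Exy : q x = q y).
    { rewrite (surjective_pairing (q x)), (surjective_pairing (q y)), E.
      unfold x, y. now rewrite (proj2 (Hxi i)), (proj2 (Hxi j)). }
    destruct (curve_inj x y Hx Hy Exy) as [E1 E2].
    assert (Exi : (xi i ^ m)%C = (xi j ^ m)%C).
    { unfold x, y in E1. rewrite !Cpow_mult_l, !zeta_pow_m, !Cmult_1_l in E1 by exact Hm.
      assert (hz : (z ^ m)%C <> RtoC 0) by now apply Cpow_nz.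
      replace (xi i ^ m)%C with (z ^ m * xi i ^ m / z ^ m)%C by (field; exact hz).
      rewrite E1. field. exact hz. }
    assert (Exi2 : xi i = xi j).
    { assert (h := Hn (xi i) (xi j) (proj1 (Hxi i)) (proj1 (Hxi j))). rewrite Exi in h.
      replace (xi j ^ m - xi j ^ m - RtoC (INR m) * (xi i - xi j))%C
        with (- (RtoC (INR m) * (xi i - xi j)))%C in h by ring.
      rewrite Cmod_opp, Cmod_mult, Cmod_R, Rabs_pos_eq in h by lra.
      apply Ceq_minus, Cmod_le_0. assert (k := Cmod_ge_0 (xi i - xi j)%C).
      assert (1 * Cmod (xi i - xi j) <= INR m * Cmod (xi i - xi j)) by (apply Rmult_le_compat_r; lra). lra. }
    assert (Ey : y = (zeta m ^ (j - i)%nat * x)%C).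
    { unfold x, y. rewrite Exi2. replace (zeta m ^ j)%C with (zeta m ^ (j - i)%nat * zeta m ^ i)%C.
      - ring.
      - rewrite <- Cpow_add_r. f_equal. lia. }
    destruct (Hsep (j - i) x ltac:(lia) Hx) as [h _]. rewrite <- Ey, E2 in h.
    replace (Psi y - Psi y)%C with (RtoC 0) in h by ring. rewrite Cmod_0, Rmult_0_r in h.
    assert (hx : 0 < Cmod x).
    { unfold x. rewrite Cmod_mult, Hzi. specialize (Hxm i). apply Rmult_lt_0_compat; lra. }
    assert (0 < Cmod x ^ B (j - i)) by now apply pow_lt. lra.
Qed.

Lemma branch_norm (z xi : C) (i : nat) : Cmod z < delta / 2 -> Cmod xi <= 2 ->
  Cmod (zeta m ^ i * z * xi) < delta /\
  norm2 (q (zeta m ^ i * z * xi)%C) <= K1 * 2 ^ m * Cmod z ^ m.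
Proof.
  intros Hz Hxi. assert (hz := Cmod_ge_0 z). assert (hx := Cmod_ge_0 xi). assert (hK := K1_ge_1).
  assert (E : Cmod (zeta m ^ i * z * xi) = Cmod z * Cmod xi).
  { rewrite !Cmod_mult, Cmod_zeta_pow. ring. }
  assert (Hd : Cmod (zeta m ^ i * z * xi) < delta) by (rewrite E; nra).
  split; [exact Hd|]. eapply Rle_trans; [apply curve_norm, Hd|]. rewrite E, Rmult_assoc, <- Rpow_mult_distr.
  apply Rmult_le_compat_l; [lra|]. apply pow_incr. split; [now apply Rmult_le_pos|].
  rewrite Rmult_comm. apply Rmult_le_compat_r; assumption.
Qed.

Lemma kap_root (u : C) : exists w, (kap * w ^ m)%C = u.
Proof.
  destruct (Croot_exists m (u / kap)%C Hm) as [w Hw]. exists w. rewrite Hw. field. exact Hkap.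
Qed.

Lemma kap_root_small (del : R) : 0 < del -> exists del', 0 < del' /\
  forall u w, Cmod u < del' -> (kap * w ^ m)%C = u -> Cmod w < del.
Proof.
  intros Hd. assert (Hk := kap_pos). exists (Cmod kap * del ^ m). split.
  - apply Rmult_lt_0_compat; [exact Hk|now apply pow_lt].
  - intros u w Hu Ew. apply pow_lt_inv with m; [lra|].
    rewrite <- Ew, Cmod_mult, Cmod_pow in Hu. now apply Rmult_lt_reg_l with (Cmod kap).
Qed.

(* Otherwise the second part of [deflate_iter], applied to the m zeros of f on a
   slice, would kill every coefficient of degree m. *)
Lemma pure_coef_nonzero : cf 0%nat m <> RtoC 0.
Proof.
  intros E0. destruct Htop as [i0 [j0 [Hij Hc]]].
  assert (Hcp := proj1 (Cmod_gt_0 _) Hc). assert (Hk := kap_pos). assert (HK1 := K1_ge_1).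
  assert (Hrf : 0 < rf) by apply Hrep.
  destruct (slice_expansion rf cf f Hrep) as [M [s [Hcb Hs]]].
  assert (HM : 0 <= M).
  { specialize (Hcb 0%nat 0%nat). simpl in Hcb. assert (h := Cmod_ge_0 (cf 0%nat 0%nat)). lra. }
  destruct branch_points as [eta' [d1 [He' [Hd1 Hbp]]]].
  destruct (kap_root_small d1 ltac:(lra)) as [d2 [Hd2 Hw2]].
  set (K2 := K1 * 2 ^ m / Cmod kap).
  assert (H2m : 1 <= 2 ^ m) by (apply pow_R1_Rle; lra).
  assert (HK2 : 0 < K2) by (apply Rdiv_lt_0_compat; [apply Rmult_lt_0_compat; lra|exact Hk]).
  (* If the coefficient of v^m vanishes, the m-th coefficient of the slice u = t is at most
     [K0 * (K2 * t)]; this is the smallness that [deflate_iter] asks for with zeros of size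
     [K2 * t]. *)
  set (K0 := 2 * (M / rf ^ m) / rf ^ 1 / K2).
  assert (Hp1 : 0 < rf ^ 1) by (simpl; lra). assert (Hpm : 0 < rf ^ m) by now apply pow_lt.
  assert (HMm : 0 <= M / rf ^ m) by (apply Rmult_le_pos; [exact HM|now apply Rlt_le, Rinv_0_lt_compat]).
  assert (HK0 : 0 <= K0).
  { unfold K0. apply Rmult_le_pos; [apply Rmult_le_pos; [lra|]|]; now apply Rlt_le, Rinv_0_lt_compat. }
  destruct (deflate_iter m (2 * M) rf K0 Hrf ltac:(lra) HK0) as [K3 [HK3 Hdef]].
  set (K4 := K3 * K2 ^ S i0 + 2 * (M / rf ^ j0) / rf ^ S i0).
  assert (HK4 : 0 <= K4).
  { unfold K4. apply Rplus_le_le_0_compat.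
    - apply Rmult_le_pos; [exact HK3|apply pow_le; lra].
    - apply Rmult_le_pos; [|apply Rlt_le, Rinv_0_lt_compat; now apply pow_lt].
      apply Rmult_le_pos; [lra|]. apply Rmult_le_pos; [exact HM|apply Rlt_le, Rinv_0_lt_compat; now apply pow_lt]. }
  set (t := Rmin (Rmin (rf / 2) d2) (Rmin (rf / 2 / K2) (Cmod (cf i0 j0) / (K4 + 1))) / 2).
  assert (Hq1 : 0 < rf / 2 / K2) by (apply Rdiv_lt_0_compat; lra).
  assert (Hq2 : 0 < Cmod (cf i0 j0) / (K4 + 1)) by (apply Rdiv_lt_0_compat; lra).
  assert (Hmin : 0 < Rmin (Rmin (rf / 2) d2) (Rmin (rf / 2 / K2) (Cmod (cf i0 j0) / (K4 + 1)))) by (repeat apply Rmin_glb_lt; lra).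
  set (t2 := Rmin (Rmin (rf / 2) d2) (Rmin (rf / 2 / K2) (Cmod (cf i0 j0) / (K4 + 1)))) in *.
  assert (g1 : t2 <= rf / 2) by rmin_le. assert (g2 : t2 <= d2) by rmin_le.
  assert (g3 : t2 <= rf / 2 / K2) by rmin_le. assert (g4 : t2 <= Cmod (cf i0 j0) / (K4 + 1)) by rmin_le.
  assert (Htt2 : t < t2) by (unfold t; lra).
  assert (Ht : 0 < t) by (unfold t; lra). clearbody t.
  assert (Eu : Cmod (RtoC t) = t) by (rewrite Cmod_R, Rabs_pos_eq; lra).
  destruct (kap_root (RtoC t)) as [w Ew].
  assert (Hw : Cmod w < d1) by (apply (Hw2 (RtoC t)); [rewrite Eu; lra|exact Ew]).
  assert (Hw0 : w <> RtoC 0).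
  { intros ->. rewrite Cpow_0_l, Cmult_0_r in Ew by exact Hm. apply RtoC_inj in Ew. lra. }
  assert (Hwm : Cmod w ^ m = t / Cmod kap).
  { apply Rmult_eq_reg_l with (Cmod kap); [|lra]. rewrite <- Cmod_pow, <- Cmod_mult, Ew, Eu. field. lra. }
  destruct (Hbp w (w ^ m)%C Hw0 Hw) as [xi [Hxi Hdist]].
  { replace (w ^ m - w ^ m)%C with (RtoC 0) by ring. rewrite Cmod_0.
    apply Rmult_le_pos; [lra|apply pow_le, Cmod_ge_0]. }
  destruct (Hs (RtoC t)) as [Hsb [Hsj Hsf]]; [rewrite Eu; lra|].
  assert (Hrho : 0 <= K2 * t <= rf / 2).
  { split; [apply Rmult_le_pos; lra|]. apply Rle_trans with (K2 * (rf / 2 / K2)); [apply Rmult_le_compat_l; lra|right; field; lra]. }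
  assert (Hvi : forall i, Cmod (snd (q (zeta m ^ i * w * xi i)%C)) <= K2 * t).
  { intros i. eapply Rle_trans; [apply norm2_snd|].
    destruct (branch_norm w (xi i) i ltac:(lra) (proj2 (proj1 (Hxi i)))) as [_ h].
    eapply Rle_trans; [exact h|]. rewrite Hwm. right. unfold K2. field. lra. }
  destruct (Hdef (s (RtoC t)) (K2 * t) (fun i => snd (q (zeta m ^ i * w * xi i)%C)) Hsb Hrho) as [_ Hsm].
  { intros i Hi. split; [apply Hvi|].
    assert (h := Hsf _ (Rle_trans _ _ _ (Hvi i) (proj2 Hrho))).
    rewrite <- Ew, <- (proj2 (proj2 (Hxi i))), <- surjective_pairing, Hfq, (proj2 (proj2 (Hxi i))), Ew in h; [exact h|].
    apply branch_norm; [lra|apply Hxi]. }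
  { exact Hdist. }
  assert (Hcm : Cmod (s (RtoC t) m) <= K0 * (K2 * t)).
  { assert (h := ser1_leading (M / rf ^ m) rf (fun i => cf i m) 0 (RtoC t) _ Hrf (Hcb m)
      (fun j (Hj : (j < 0)%nat) => False_ind _ (Nat.nlt_0_r _ Hj)) ltac:(rewrite Eu; lra) (Hsj m)).
    cbv beta in h. rewrite E0, Eu, Cmult_0_l in h.
    replace (s (RtoC t) m - 0)%C with (s (RtoC t) m) in h by ring.
    eapply Rle_trans; [exact h|]. right. unfold K0. rewrite (pow_1 t). field. lra. }
  (* By the division, the coefficient of v^j0 in the slice is O(t^(i0+1)), although its leading term
     is cf i0 j0 times t^i0. *)
  assert (Hj0 := Hsm Hcm j0 ltac:(lia)).
  replace (S m - j0)%nat with (S i0) in Hj0 by lia.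
  assert (h := ser1_leading (M / rf ^ j0) rf (fun i => cf i j0) i0 (RtoC t) _ Hrf (Hcb j0)
      (fun j Hj => Hlow j j0 ltac:(lia)) ltac:(rewrite Eu; lra) (Hsj j0)).
  cbv beta in h. rewrite Eu in h.
  assert (k := Cmod_minus_ge (cf i0 j0 * RtoC t ^ i0)%C (s (RtoC t) j0)).
  rewrite (Cmod_minus_sym (cf i0 j0 * RtoC t ^ i0)%C), Cmod_mult, Cmod_pow, Eu in k.
  assert (Hbig : Cmod (cf i0 j0) * t ^ i0 <= K4 * t * t ^ i0).
  { apply Rle_trans with (K3 * (K2 * t) ^ S i0 + 2 * (M / rf ^ j0) / rf ^ S i0 * t ^ S i0); [lra|].
    right. unfold K4. rewrite Rpow_mult_distr. rewrite <- (tech_pow_Rmult t i0). ring. }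
  assert (Hbig2 : Cmod (cf i0 j0) <= K4 * t).
  { apply Rmult_le_reg_r with (t ^ i0); [now apply pow_lt|exact Hbig]. }
  assert (K4 * t <= (K4 + 1) * t) by (apply Rmult_le_compat_r; lra).
  assert ((K4 + 1) * t < (K4 + 1) * (Cmod (cf i0 j0) / (K4 + 1))) by (apply Rmult_lt_compat_l; lra).
  replace ((K4 + 1) * (Cmod (cf i0 j0) / (K4 + 1))) with (Cmod (cf i0 j0)) in H0 by (field; lra). lra.
Qed.

(** The slice is u = kap b with b merely close to z^m: in the near case z is the parameter of a
    point on the sphere, which need not lie in the slice. The unit left after division differs from
    the coefficient of v^m, of modulus c0, by at most c0 / 2, whence the constant 2 c0 + 2 / c0. *)
Lemma slice_factorization : exists eta' del K3, 0 < eta' /\ 0 < del <= delta / 2 /\ 0 < K3 /\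
  forall z b v, z <> RtoC 0 -> Cmod z < del -> Cmod v < del -> Cmod (b - z ^ m) <= eta' * Cmod z ^ m ->
  exists xi : nat -> C,
    (forall i, / 2 <= Cmod (xi i) <= 2 /\
       / 2 * Cmod (xi i - 1) <= Cmod (xi i ^ m - 1) <= 2 * INR m * Cmod (xi i - 1) /\
       fst (q (zeta m ^ i * z * xi i)%C) = (kap * b)%C) /\
    rprod (fun i => Cmod (v - snd (q (zeta m ^ i * z * xi i)%C))) m <= K3 * Cmod (f ((kap * b)%C, v)) /\
    Cmod (f ((kap * b)%C, v)) <= K3 * rprod (fun i => Cmod (v - snd (q (zeta m ^ i * z * xi i)%C))) m.
Proof.
  assert (Hcp := proj1 (Cmod_gt_0 _) pure_coef_nonzero). set (c0 := Cmod (cf 0%nat m)) in *.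
  assert (Hk := kap_pos). assert (HK1 := K1_ge_1).
  assert (Hrf : 0 < rf) by apply Hrep.
  destruct (slice_expansion rf cf f Hrep) as [M [s [Hcb Hs]]].
  assert (HM : 0 <= M).
  { specialize (Hcb 0%nat 0%nat). simpl in Hcb. assert (h := Cmod_ge_0 (cf 0%nat 0%nat)). lra. }
  destruct branch_points as [eta' [d1 [He' [Hd1 Hbp]]]].
  destruct (deflate_iter m (2 * M) rf 0 Hrf ltac:(lra) ltac:(lra)) as [K2 [HK2 Hdef]].
  assert (Hp1 : 0 < rf ^ 1) by (simpl; lra). assert (Hpm : 0 < rf ^ m) by now apply pow_lt.
  assert (HMm : 0 <= M / rf ^ m) by (apply Rmult_le_pos; [exact HM|now apply Rlt_le, Rinv_0_lt_compat]).
  set (K4 := 2 * (M / rf ^ m) / rf ^ 1).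
  assert (HK4 : 0 <= K4) by (apply Rmult_le_pos; [lra|now apply Rlt_le, Rinv_0_lt_compat]).
  set (rho := Rmin (rf / 2) (c0 / (4 * (K2 + 1)))).
  assert (Hq1 : 0 < c0 / (4 * (K2 + 1))) by (apply Rdiv_lt_0_compat; lra).
  assert (Hrho : 0 < rho) by (apply Rmin_glb_lt; lra).
  assert (Hrho1 : rho <= rf / 2) by apply Rmin_l.
  assert (Hrho2 : K2 * rho <= c0 / 4).
  { apply Rle_trans with ((K2 + 1) * (c0 / (4 * (K2 + 1)))); [|right; field; lra].
    apply Rmult_le_compat; [exact HK2|lra|lra|apply Rmin_r]. }
  (* As a bound on |z|^m, [W] brings the m points of the slice and u itself within [rho] and the
     other radii used below. *)
  set (W := Rmin rho (Rmin (rf / 2) (c0 / (4 * (K4 + 1)))) / (K1 * 2 ^ m)).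
  assert (Hq2 : 0 < c0 / (4 * (K4 + 1))) by (apply Rdiv_lt_0_compat; lra).
  assert (H2m : 1 <= 2 ^ m) by (apply pow_R1_Rle; lra).
  assert (HKm : 0 < K1 * 2 ^ m) by (apply Rmult_lt_0_compat; lra).
  assert (HW : 0 < W) by (apply Rdiv_lt_0_compat; [repeat apply Rmin_glb_lt; lra|exact HKm]).
  assert (HWK : K1 * 2 ^ m * W = Rmin rho (Rmin (rf / 2) (c0 / (4 * (K4 + 1))))) by (unfold W; field; lra).
  set (del := Rmin (Rmin d1 rho) (Rmin 1 W)).
  assert (g1 : del <= d1) by rmin_le.
  assert (g2 : del <= rho) by rmin_le.
  assert (g3 : del <= 1) by rmin_le.
  assert (g4 : del <= W) by rmin_le.
  exists eta', del, (2 * c0 + 2 / c0).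
  assert (Hc2 : 0 < 2 / c0) by (apply Rdiv_lt_0_compat; lra).
  split; [exact He'|]. split; [split; [repeat apply Rmin_glb_lt; lra|lra]|]. split; [lra|].
  intros z b v Hz Hzd Hv Hb.
  destruct (Hbp z b Hz ltac:(lra) Hb) as [xi [Hxi Hdist]]. exists xi. split; [exact Hxi|].
  assert (hz := Cmod_ge_0 z).
  assert (Hzm : Cmod z ^ m <= W).
  { destruct m as [|k]; [lia|]. simpl. apply Rle_trans with (Cmod z * 1); [|lra].
    apply Rmult_le_compat_l; [exact hz|]. rewrite <- (pow1 k). apply pow_incr. lra. }
  assert (Hqi : forall i, norm2 (q (zeta m ^ i * z * xi i)%C) <= Rmin rho (Rmin (rf / 2) (c0 / (4 * (K4 + 1))))).
  { intros i. destruct (branch_norm z (xi i) i ltac:(lra) (proj2 (proj1 (Hxi i)))) as [_ h].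
    eapply Rle_trans; [exact h|]. rewrite <- HWK. apply Rmult_le_compat_l; lra. }
  assert (i1 := Rmin_l rho (Rmin (rf / 2) (c0 / (4 * (K4 + 1))))).
  assert (i2 := Rle_trans _ _ _ (Rmin_r rho (Rmin (rf / 2) (c0 / (4 * (K4 + 1))))) (Rmin_l _ _)).
  assert (i3 := Rle_trans _ _ _ (Rmin_r rho (Rmin (rf / 2) (c0 / (4 * (K4 + 1))))) (Rmin_r _ _)).
  set (u := (kap * b)%C) in *.
  assert (Hu : Cmod u <= Rmin rho (Rmin (rf / 2) (c0 / (4 * (K4 + 1))))).
  { rewrite <- (proj2 (proj2 (Hxi 0%nat))). eapply Rle_trans; [apply norm2_fst|apply Hqi]. }
  destruct (Hs u ltac:(lra)) as [Hsb [Hsj Hsf]].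
  destruct (Hdef (s u) rho (fun i => snd (q (zeta m ^ i * z * xi i)%C)) Hsb ltac:(lra)) as [Hfac _].
  { intros i Hi.
    assert (hv : Cmod (snd (q (zeta m ^ i * z * xi i)%C)) <= rho).
    { eapply Rle_trans; [apply norm2_snd|]. eapply Rle_trans; [apply Hqi|exact i1]. }
    split; [exact hv|].
    assert (h := Hsf _ (Rle_trans _ _ _ hv Hrho1)).
    rewrite <- (proj2 (proj2 (Hxi i))), <- surjective_pairing, Hfq, (proj2 (proj2 (Hxi i))) in h; [exact h|].
    apply branch_norm; [lra|apply Hxi]. }
  { exact Hdist. }
  destruct (Hfac v (f (u, v)) ltac:(lra) (Hsf v ltac:(lra))) as [U [EU HU]].
  assert (Hcm : Cmod (s u m - cf 0%nat m) <= c0 / 4).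
  { assert (h := ser1_leading (M / rf ^ m) rf (fun i => cf i m) 0 u _ Hrf (Hcb m)
      (fun j (Hj : (j < 0)%nat) => False_ind _ (Nat.nlt_0_r _ Hj)) ltac:(lra) (Hsj m)).
    cbv beta in h. simpl Cpow in h. rewrite Cmult_1_r in h. eapply Rle_trans; [exact h|]. fold K4.
    rewrite (pow_1 (Cmod u)). apply Rle_trans with ((K4 + 1) * (c0 / (4 * (K4 + 1)))); [|right; field; lra].
    apply Rmult_le_compat; [exact HK4|apply Cmod_ge_0|lra|lra]. }
  assert (HU2 : c0 / 2 <= Cmod U <= 2 * c0).
  { assert (h := Cmod_minus_triangle U (s u m) (cf 0%nat m)).
    assert (h1 := Cmod_minus_ge U (cf 0%nat m)). assert (h2 := Cmod_minus_ge (cf 0%nat m) U).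
    rewrite (Cmod_minus_sym (cf 0%nat m)) in h2. fold c0 in h1, h2. lra. }
  rewrite <- (Cmod_cprod (fun i => (v - snd (q (zeta m ^ i * z * xi i)%C))%C)).
  apply (f_equal Cmod) in EU. rewrite Cmod_mult in EU. rewrite EU.
  set (P := Cmod (cprod (fun i => (v - snd (q (zeta m ^ i * z * xi i)%C))%C) m)).
  assert (HP : 0 <= P) by apply Cmod_ge_0.
  split.
  - apply Rle_trans with (2 / c0 * (P * (c0 / 2))); [right; field; lra|].
    apply Rmult_le_compat; [lra|apply Rmult_le_pos; lra|lra|]. apply Rmult_le_compat_l; lra.
  - rewrite (Rmult_comm P). apply Rmult_le_compat_r; lra.
Qed.

Lemma dist_sphere_le (p : C2) (dd : R) :
  dist_set p (Xr f (norm2 p)) = Finite dd -> dd <= 2 * norm2 p.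
Proof.
  intros E. destruct (dist_set_spec _ _ _ E) as [h1 h2].
  destruct (h2 1 ltac:(lra)) as [s [Hs _]]. specialize (h1 s Hs).
  assert (h := norm2_sub_le p s). rewrite (proj2 Hs) in h. lra.
Qed.

(* A point q x of the curve near p is moved along the ray t |-> q (t x) until
   it reaches the sphere through p. *)
Lemma dist_sphere_curve : exists del, 0 < del <= delta / 2 /\ forall x p dd, Cmod x < del ->
  dist_set p (Xr f (norm2 p)) = Finite dd -> dd <= 7 * norm2 (sub2 p (q x)).
Proof.
  assert (HK1 := K1_ge_1).
  (* With this e the point q (t x) leaves the ray through q x by at most a quarter of |t^m - 1| |q
     x|. *)
  set (e := / (4 * K1)). assert (He : 0 < e) by (apply Rinv_0_lt_compat; lra).
  destruct (Hray e He) as [d1 [Hd1 H1]].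
  exists (Rmin (delta / 3) d1).
  assert (g1 := Rmin_l (delta / 3) d1). assert (g2 := Rmin_r (delta / 3) d1).
  split; [split; [apply Rmin_glb_lt|]; lra|]. intros x p dd Hx Edd.
  assert (Hdp := dist_sphere_le p dd Edd).
  destruct (dist_set_spec _ _ _ Edd) as [Hlb _].
  set (P := norm2 p) in *. set (N := norm2 (q x)). set (d0 := norm2 (sub2 p (q x))).
  assert (HP : 0 <= P) by apply norm2_ge0. assert (HN : 0 <= N) by apply norm2_ge0.
  assert (Hd0 : 0 <= d0) by apply norm2_ge0.
  assert (k1 : P - N <= d0) by apply norm2_sub_ge.
  assert (k2 : N - P <= d0) by (unfold d0; rewrite norm2_sub_sym; apply norm2_sub_ge).
  (* Outside 7/10 N <= P <= 3/2 N the difference |P - N| <= d0 is already large against dd <= 2 P.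
     Inside, |q (t x)| runs from at most 5/8 N at t = 1/2 to at least 7/4 N at t = 2, and so meets
     the value P. *)
  destruct (Rle_dec (7 / 10 * N) P) as [c1|c1]; [|lra].
  destruct (Rle_dec P (3 / 2 * N)) as [c2|c2]; [|lra].
  destruct (Rle_dec N 0) as [cN|cN]; [lra|]. apply Rnot_le_lt in cN.
  assert (hx0 := Cmod_ge_0 x).
  destruct (curve_norm x ltac:(lra)) as [_ Hxm]. fold N in Hxm.
  set (y := fun t => q (RtoC t * x)%C).
  assert (Hy : forall t, 0 <= t <= 2 -> norm2 (sub2 (y t) (scal2 (t ^ m) (q x))) <= / 4 * (Rabs (t ^ m - 1) * N)).
  { intros t Ht. eapply Rle_trans; [apply H1; lra|].
    assert (hT := Rabs_pos (t ^ m - 1)).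
    apply Rle_trans with (e * (Rabs (t ^ m - 1) * (K1 * N))).
    - apply Rmult_le_compat_l; [lra|]. now apply Rmult_le_compat_l.
    - right. unfold e. field. lra. }
  assert (Hn : forall t, 0 <= t <= 2 -> Rabs (norm2 (y t) - t ^ m * N) <= / 4 * (Rabs (t ^ m - 1) * N)).
  { intros t Ht. assert (h := Hy t Ht).
    assert (h1 := norm2_sub_ge (y t) (scal2 (t ^ m) (q x))).
    assert (h2 := norm2_sub_ge (scal2 (t ^ m) (q x)) (y t)).
    rewrite (norm2_sub_sym (scal2 (t ^ m) (q x))) in h2.
    rewrite norm2_scal2 in h1, h2 by (apply pow_le; lra). fold N in h1, h2.
    apply Rabs_le. lra. }
  assert (Hex : exists t, 0 <= t <= 2 /\ norm2 (y t) = P).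
  { destruct (IVT_interv (fun t => norm2 (y t) - P) (/ 2) 2) as [t [Ht Et]].
    - intros t Ht.
      assert (Hc : forall s, 0 <= s <= 5 / 2 -> Cmod (RtoC s * x) < delta).
      { intros s Hs. rewrite Cmod_mult, Cmod_R, Rabs_pos_eq by lra. nra. }
      intros eps Heps.
      (* A Lipschitz constant of t -> q (t x) near the interval, where |t x| <= 3 |x| and |x| <=
         1. *)
      set (G := K * (INR m * 3 ^ (m - 1) * 1 + KP * 3 ^ m * 1)).
      assert (H3 : 0 < 3 ^ (m - 1)) by (apply pow_lt; lra).
      assert (H3m : 0 < 3 ^ m) by (apply pow_lt; lra).
      assert (HmR := INRm_ge_1).
      assert (HG : 0 < G).
      { apply Rmult_lt_0_compat; [exact HK|]. assert (0 < INR m * 3 ^ (m - 1)) by (apply Rmult_lt_0_compat; lra).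
        assert (0 <= KP * 3 ^ m) by (apply Rmult_le_pos; lra). lra. }
      exists (Rmin (/ 4) (eps / G)).
      assert (Hq : 0 < eps / G) by now apply Rdiv_lt_0_compat.
      split; [apply Rmin_glb_lt; lra|]. intros s [_ Hs]. simpl in Hs. unfold R_dist, Rdist in Hs. 
      assert (i1 := Rmin_l (/ 4) (eps / G)). assert (i2 := Rmin_r (/ 4) (eps / G)).
      assert (Hs1 : Rabs (s - t) < / 4) by lra. apply Rabs_def2 in Hs1.
      simpl. unfold R_dist, Rdist.
      replace (norm2 (y s) - P - (norm2 (y t) - P)) with (norm2 (y s) - norm2 (y t)) by ring.
      apply Rle_lt_trans with (norm2 (sub2 (y s) (y t))).
      { assert (h1 := norm2_sub_ge (y s) (y t)). assert (h2 := norm2_sub_ge (y t) (y s)).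
        rewrite (norm2_sub_sym (y t)) in h2. apply Rabs_le. lra. }
      destruct (Hbil (RtoC s * x)%C (RtoC t * x)%C (Hc s ltac:(lra)) (Hc t ltac:(lra))) as [h _].
      fold (y s) (y t) in h. eapply Rle_lt_trans; [exact h|].
      assert (Ed : Cmod (RtoC s * x - RtoC t * x) <= Rabs (s - t)).
      { replace (RtoC s * x - RtoC t * x)%C with (RtoC (s - t)%R * x)%C by (rewrite RtoC_minus; ring).
        rewrite Cmod_mult, Cmod_R. rewrite <- (Rmult_1_r (Rabs (s - t))) at 2. apply Rmult_le_compat_l; [apply Rabs_pos|lra]. }
      assert (hs3 : Cmod (RtoC s * x) <= 3 * Cmod x) by (rewrite Cmod_mult, Cmod_R, Rabs_pos_eq by lra; apply Rmult_le_compat_r; lra).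
      assert (ht3 : Cmod (RtoC t * x) <= 3 * Cmod x) by (rewrite Cmod_mult, Cmod_R, Rabs_pos_eq by lra; apply Rmult_le_compat_r; lra).
      assert (A1 : Cmod ((RtoC s * x) ^ m - (RtoC t * x) ^ m) <= INR m * 3 ^ (m - 1) * 1 * Rabs (s - t)).
      { replace ((RtoC s * x) ^ m)%C with ((RtoC s * x) ^ (S (m - 1)))%C by (f_equal; lia).
        replace ((RtoC t * x) ^ m)%C with ((RtoC t * x) ^ (S (m - 1)))%C by (f_equal; lia).
        eapply Rle_trans; [apply Cpow_diff_le with (X := 3 * 1); lra|].
        replace (S (m - 1)) with m by lia. rewrite !Rmult_1_r.
        apply Rmult_le_compat_l; [apply Rmult_le_pos; lra|exact Ed]. }
      assert (A2 : Cmod (Psi (RtoC s * x)%C - Psi (RtoC t * x)%C) <= KP * 3 ^ m * 1 * Rabs (s - t)).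
      { eapply Rle_trans; [apply (HPsi (3 * Cmod x)); [assumption|assumption|lra]|].
        apply Rmult_le_compat; [|apply Cmod_ge_0| |exact Ed].
        - apply Rmult_le_pos; [lra|apply pow_le; lra].
        - rewrite Rmult_1_r. apply Rmult_le_compat_l; [lra|]. apply pow_incr. lra. }
      apply Rle_lt_trans with (G * Rabs (s - t)).
      { unfold G. rewrite Rmult_assoc. apply Rmult_le_compat_l; [lra|]. lra. }
      apply Rlt_le_trans with (G * (eps / G)); [apply Rmult_lt_compat_l; lra|]. right. field. lra.
    - lra.
    - assert (h := Hn (/ 2) ltac:(lra)).
      assert (hp : 0 < (/ 2) ^ m <= / 2).
      { split; [apply pow_lt; lra|]. destruct m as [|k]; [lia|]. simpl.
        assert ((/ 2) ^ k <= 1) by (rewrite <- (pow1 k); apply pow_incr; lra). lra. }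
      rewrite (Rabs_left1 ((/ 2) ^ m - 1)) in h by lra. apply Rabs_le_between in h.
      assert ((/ 2) ^ m * N <= / 2 * N) by (apply Rmult_le_compat_r; lra). lra.
    - assert (h := Hn 2 ltac:(lra)).
      assert (hp : 2 <= 2 ^ m).
      { destruct m as [|k]; [lia|]. simpl. assert (1 <= 2 ^ k) by (apply pow_R1_Rle; lra). lra. }
      rewrite (Rabs_pos_eq (2 ^ m - 1)) in h by lra. apply Rabs_le_between in h.
      assert (2 * N <= 2 ^ m * N) by (apply Rmult_le_compat_r; lra). lra.
    - exists t. split; [lra|]. lra. }
  destruct Hex as [t [Ht Et]].
  assert (Hyd : Cmod (RtoC t * x) < delta).
  { rewrite Cmod_mult, Cmod_R, Rabs_pos_eq by lra. nra. }
  assert (h := Hlb (y t) (conj (Hfq _ Hyd) Et)).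
  assert (h1 := norm2_triangle p (q x) (y t)). fold d0 in h1.
  assert (h2 := norm2_triangle (q x) (scal2 (t ^ m) (q x)) (y t)).
  rewrite (norm2_sub_sym (scal2 (t ^ m) (q x))) in h2.
  assert (h3 := Hy t Ht). assert (h4 := Hn t Ht). rewrite Et in h4.
  set (T := Rabs (t ^ m - 1)) in *.
  assert (h5 : norm2 (sub2 (q x) (scal2 (t ^ m) (q x))) <= T * N).
  { replace (sub2 (q x) (scal2 (t ^ m) (q x))) with (sub2 zero2 (sub2 (scal2 (t ^ m) (q x)) (q x))).
    2:{ unfold sub2, scal2, zero2; simpl. f_equal; ring. }
    rewrite norm2_sub_sym, norm2_sub_0.
    unfold T. destruct (Rle_dec 1 (t ^ m)) as [c|c].
    - rewrite Rabs_pos_eq by lra.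
      replace (sub2 (scal2 (t ^ m) (q x)) (q x)) with (scal2 (t ^ m - 1) (q x)).
      + rewrite norm2_scal2 by lra. unfold N. lra.
      + unfold sub2, scal2; simpl. rewrite RtoC_minus. f_equal; ring.
    - rewrite Rabs_left1 by lra. rewrite norm2_sub_sym.
      replace (sub2 (q x) (scal2 (t ^ m) (q x))) with (scal2 (- (t ^ m - 1)) (q x)).
      + rewrite norm2_scal2 by lra. unfold N. lra.
      + unfold sub2, scal2; simpl. rewrite RtoC_opp, RtoC_minus. f_equal; ring. }
  (* The displacement along the ray is recovered from the change of norm, since P = |q (t x)|
     deviates from t^m N by at most a quarter of T N. *)
  assert (h6 : 3 / 4 * (T * N) <= Rabs (P - N)).
  { assert (h7 : T * N = Rabs (t ^ m * N - N)).
    { unfold T. rewrite <- (Rabs_pos_eq N) at 1 by exact HN. rewrite <- Rabs_mult. f_equal. ring. }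
    assert (h8 := Rabs_triang (t ^ m * N - P) (P - N)).
    replace (t ^ m * N - P + (P - N)) with (t ^ m * N - N) in h8 by ring.
    rewrite Rabs_minus_sym in h4. lra. }
  assert (h7 : Rabs (P - N) <= d0) by (apply Rabs_le; lra).
  lra.
Qed.


(** Here an almost nearest point q x0 of the sphere is close to p relative to |p|, so |x0|^m is
    comparable to |p| and u / kap is close to x0^m. With y = zeta^i x0 and x = y xi_i, the quantity
    W = |x0|^m |xi_i - 1| measures the move from the conjugate into the slice. It is O(dd + psi),
    where psi = |Psi x0 - Psi y|, and therefore D_i is comparable to psi up to an error O(dd). *)
Lemma branch_distances_near : exists d1 dg K', 0 < d1 /\ 0 < dg /\ forall p dd r,
  0 < norm2 p < dg -> dist_set p (Xr f (norm2 p)) = Finite dd -> 0 < dd -> dd <= d1 * norm2 p ->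
  0 < r -> r ^ m = norm2 p -> branch_distances m B f K' p r dd.
Proof.
  assert (HK1 := K1_ge_1). assert (Hk := kap_pos). assert (HmR := INRm_ge_1).
  destruct (bounded_on_prefix B m) as [Bm HBmax].
  destruct Hqf as [e0 [He0 Hq']].
  destruct (Hstrict (Cmod kap / 2) ltac:(lra)) as [dS [HdS HS]].
  destruct slice_factorization as [eta' [dF [K3 [He' [HdF [HK3 Hfac]]]]]].
  destruct dist_sphere_curve as [dSp [HdSp Hsph]].
  destruct (curve_fst_near (Cmod kap * eta' / 2)) as [dN [HdN HN]].
  { apply Rdiv_lt_0_compat; [now apply Rmult_lt_0_compat|lra]. }
  set (G := KP * 2 ^ m).
  assert (H2m : 1 <= 2 ^ m) by (apply pow_R1_Rle; lra).
  assert (HG : 0 <= G) by (apply Rmult_le_pos; lra).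
  assert (HKG : 0 <= K * G) by (apply Rmult_le_pos; lra).
  set (K4 := 8 * (2 + K) / Cmod kap).
  assert (HK4 : 0 < K4) by (apply Rdiv_lt_0_compat; lra).
  assert (HGK : 0 <= G * K4) by (apply Rmult_le_pos; lra).
  (* [a1] and [a2] bound |x0|: the first absorbs the share of [Psi] when the equation is solved for
     W, the second keeps this share below half of dd + psi. *)
  set (a1 := Cmod kap / (8 * (K * G + 1))). assert (Ha1 : 0 < a1) by (apply Rdiv_lt_0_compat; lra).
  set (a2 := / (2 * (G * K4 + 1))). assert (Ha2 : 0 < a2) by (apply Rinv_0_lt_compat; lra).
  set (dx := Rmin (Rmin dF (dS / 2)) (Rmin (Rmin (dSp / 2) dN) (Rmin a1 a2))).
  assert (Hdx : 0 < dx) by (repeat apply Rmin_glb_lt; lra).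
  assert (x1 : dx <= dF) by rmin_le.
  assert (x2 : dx <= dS / 2) by rmin_le.
  assert (x3 : dx <= dSp / 2) by rmin_le.
  assert (x4 : dx <= dN) by rmin_le.
  assert (x5 : dx <= a1) by rmin_le.
  assert (x6 : dx <= a2) by rmin_le.
  set (dg := Rmin (Rmin e0 dF) (dx ^ m / K1)).
  assert (Hdxm : 0 < dx ^ m / K1) by (apply Rdiv_lt_0_compat; [now apply pow_lt|lra]).
  set (KM := K1 ^ Bm).
  assert (HKM : 1 <= KM) by (apply pow_R1_Rle; lra).
  set (K5 := 2 + K * (2 * INR m * K4 + 1 + G * K4)).
  assert (HK5' : 0 <= K * (2 * INR m * K4 + 1 + G * K4)).
  { apply Rmult_le_pos; [lra|]. assert (0 <= 2 * INR m * K4) by (apply Rmult_le_pos; lra). lra. }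
  assert (HK5 : 2 <= K5) by (unfold K5; lra).
  (* With this threshold 2 dd uses at most half of the deviation from kap x0^m that
     [slice_factorization] tolerates; [curve_fst_near] takes the other half. *)
  set (d1 := Cmod kap * eta' / (4 * K1)).
  exists d1, dg, (7 + K5 * (1 + KB * KM) + KM * KB * (4 * K + 1) + K3).
  split; [apply Rdiv_lt_0_compat; [now apply Rmult_lt_0_compat|lra]|].
  split; [repeat apply Rmin_glb_lt; lra|].
  intros [u v] dd r Hp Edd Hdd Hdd1 Hr Erm. set (p := (u, v) : C2) in *. set (P := norm2 p) in *.
  assert (p1 : dg <= e0) by rmin_le.
  assert (p2 : dg <= dF) by rmin_le.
  assert (p3 : dg <= dx ^ m / K1) by apply Rmin_r.
  destruct (dist_set_spec _ _ _ Edd) as [_ Happ].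
  destruct (Happ dd Hdd) as [q0 [[Hq0f Hq0n] Hq0d]]. fold P in Hq0n.
  destruct (Hq' q0 ltac:(lra) Hq0f) as [x0 [Hx0 Eq0]]. rewrite <- Eq0 in Hq0n, Hq0d.
  set (s0 := norm2 (sub2 p (q x0))) in *.
  destruct (curve_norm x0 Hx0) as [N1 N2]. rewrite Hq0n in N1, N2.
  assert (hx0 := Cmod_ge_0 x0).
  assert (Hx0dx : Cmod x0 < dx).
  { apply pow_lt_inv with m; [lra|]. eapply Rle_lt_trans; [exact N2|].
    apply Rlt_le_trans with (K1 * (dx ^ m / K1)); [apply Rmult_lt_compat_l; lra|right; field; lra]. }
  set (Xm := Cmod x0 ^ m) in *.
  assert (HXm : 0 < Xm).
  { apply Rmult_lt_reg_l with K1; [lra|]. lra. }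
  assert (Hx0nz : x0 <> RtoC 0).
  { intros E. unfold Xm in HXm. rewrite E, Cmod_0, pow_i in HXm by lia. lra. }
  assert (Hx0p := proj1 (Cmod_gt_0 x0) Hx0nz).
  assert (Hr1 : r <= K1 * Cmod x0 /\ Cmod x0 <= K1 * r).
  { assert (HKm : K1 <= K1 ^ m). { rewrite <- (pow_1 K1) at 1. now apply Rle_pow. }
    split; (apply pow_le_inv with m; [exact Hm|apply Rmult_le_pos; lra|]); rewrite Rpow_mult_distr.
    - rewrite Erm. eapply Rle_trans; [exact N1|]. fold Xm. apply Rmult_le_compat_r; lra.
    - rewrite Erm. fold Xm. eapply Rle_trans; [exact N2|]. apply Rmult_le_compat_r; lra. }
  assert (Hpw : forall k, (k <= Bm)%nat -> K1 ^ k <= KM) by (intros k Hk'; now apply Rle_pow).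
  assert (Hrb : forall i, (i < m)%nat -> r ^ B i <= KM * Cmod x0 ^ B i /\ Cmod x0 ^ B i <= KM * r ^ B i).
  { intros i Hi. specialize (Hpw (B i) (HBmax i Hi)).
    split.
    - apply Rle_trans with ((K1 * Cmod x0) ^ B i); [apply pow_incr; lra|]. rewrite Rpow_mult_distr.
      apply Rmult_le_compat_r; [now apply pow_le|exact Hpw].
    - apply Rle_trans with ((K1 * r) ^ B i); [apply pow_incr; lra|]. rewrite Rpow_mult_distr.
      apply Rmult_le_compat_r; [apply pow_le; lra|exact Hpw]. }
  assert (Hs0 : s0 <= 2 * dd) by lra.
  assert (Hu0 : Cmod (u - fst (q x0)) <= 2 * dd).
  { eapply Rle_trans; [|exact Hs0]. apply (norm2_fst (sub2 p (q x0))). }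
  set (b := (u / kap)%C).
  assert (Eb : (kap * b)%C = u) by (unfold b; field; exact Hkap).
  destruct (Hfac x0 b v Hx0nz ltac:(lra)) as [xi [Hxi [F1 F2]]].
  { assert (h := norm2_snd p). simpl in h. fold P in h. lra. }
  { apply Rmult_le_reg_l with (Cmod kap); [exact Hk|]. rewrite <- Cmod_mult.
    replace (kap * (b - x0 ^ m))%C with (u - fst (q x0) + (fst (q x0) - kap * x0 ^ m))%C.
    2:{ replace (kap * (b - x0 ^ m))%C with (kap * b - kap * x0 ^ m)%C by ring. rewrite Eb. ring. }
    eapply Rle_trans; [apply Cmod_triangle|].
    assert (h := HN x0 ltac:(lra)). fold Xm in h |- *.
    assert (2 * dd <= Cmod kap * eta' / 2 * Xm).
    { apply Rle_trans with (2 * (d1 * (K1 * Xm))).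
      - apply Rmult_le_compat_l; [lra|]. eapply Rle_trans; [exact Hdd1|]. apply Rmult_le_compat_l; [|exact N1].
        apply Rlt_le, Rdiv_lt_0_compat; [now apply Rmult_lt_0_compat|lra].
      - right. unfold d1. field. lra. }
    lra. }
  rewrite Eb in F1, F2. fold p in F1, F2.
  exists (fun i => Cmod (v - snd (q (zeta m ^ i * x0 * xi i)%C))).
  assert (Hc1 : 0 <= K5 * (1 + KB * KM)).
  { apply Rmult_le_pos; [lra|]. assert (0 <= KB * KM) by (apply Rmult_le_pos; lra). lra. }
  assert (Hc2 : 0 <= KM * KB * (4 * K + 1)) by (apply Rmult_le_pos; [apply Rmult_le_pos|]; lra).
  split; [|split].
  2:{ eapply Rle_trans; [exact F1|]. apply Rmult_le_compat_r; [apply Cmod_ge_0|lra]. }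
  2:{ eapply Rle_trans; [exact F2|]. apply Rmult_le_compat_r; [|lra].
      rewrite <- (Cmod_cprod (fun i => (v - snd (q (zeta m ^ i * x0 * xi i)%C))%C)). apply Cmod_ge_0. }
  intros i Hi. destruct (Hxi i) as [[Hxi1 Hxi2] [[Hxi3 Hxi4] Hxi5]].
  set (y := (zeta m ^ i * x0)%C) in *. set (x := (y * xi i)%C) in *.
  rewrite Eb in Hxi5.
  assert (Ey : Cmod y = Cmod x0) by (unfold y; rewrite Cmod_mult, Cmod_zeta_pow; ring).
  assert (Eym : (y ^ m)%C = (x0 ^ m)%C) by (unfold y; rewrite Cpow_mult_l, zeta_pow_m by exact Hm; ring).
  assert (Ex : Cmod x = Cmod x0 * Cmod (xi i)) by (unfold x; rewrite Cmod_mult, Ey; reflexivity).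
  assert (Hx2 : Cmod x <= 2 * Cmod x0) by (rewrite Ex, Rmult_comm; apply Rmult_le_compat_r; lra).
  set (D := Cmod (v - snd (q x))).
  assert (HD0 : 0 <= D) by apply Cmod_ge_0.
  assert (ED : norm2 (sub2 p (q x)) = D).
  { unfold p, D. rewrite (surjective_pairing (q x)), Hxi5. apply norm2_pair_eq. }
  assert (Hsd : dd <= 7 * D) by (rewrite <- ED; apply Hsph; [lra|exact Edd]).
  set (psi := Cmod (Psi x0 - Psi y)).
  assert (Hpsi0 : 0 <= psi) by apply Cmod_ge_0.
  set (s := Cmod (xi i - 1)) in *. assert (Hs : 0 <= s) by apply Cmod_ge_0.
  set (W := Xm * s). assert (HW : 0 <= W) by (apply Rmult_le_pos; lra).
  assert (Epow : Cmod (x ^ m - x0 ^ m) = Xm * Cmod (xi i ^ m - 1)).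
  { unfold x. rewrite Cpow_mult_l, Eym.
    replace (x0 ^ m * xi i ^ m - x0 ^ m)%C with (x0 ^ m * (xi i ^ m - 1))%C by ring.
    now rewrite Cmod_mult, Cmod_pow. }
  assert (E3 : / 2 * W <= Cmod (x ^ m - x0 ^ m) <= 2 * INR m * W).
  { rewrite Epow. unfold W. split.
    - apply Rle_trans with (Xm * (/ 2 * s)); [right; ring|]. apply Rmult_le_compat_l; lra.
    - apply Rle_trans with (Xm * (2 * INR m * s)); [|right; ring]. apply Rmult_le_compat_l; lra. }
  assert (Ps : Cmod (Psi x - Psi y) <= G * Cmod x0 * W).
  { assert (h := Psi_diff_scaled y (xi i) (RtoC 1)). rewrite Cmult_1_r, Ey, Cmod_1 in h. fold x s Xm in h.
    apply h; lra. }
  assert (Ps0 : Cmod (Psi x - Psi x0) <= G * Cmod x0 * W + psi).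
  { eapply Rle_trans; [apply (Cmod_minus_triangle _ (Psi y))|]. unfold psi. rewrite (Cmod_minus_sym (Psi x0)). lra. }
  assert (HWb : W <= K4 * (dd + psi)).
  (* q x lies in the slice of p and q x0 within 2 dd of p, so their first coordinates differ by at
     most 2 dd; to leading order this difference is kap (x^m - x0^m), of modulus at least |kap| W /
     2. *)
  { assert (h := HS x x0 ltac:(lra) ltac:(lra)). rewrite Hxi5 in h.
    assert (h2 := Cmod_minus_ge (kap * (x ^ m - x0 ^ m))%C (u - fst (q x0))%C).
    rewrite (Cmod_minus_sym (kap * _)%C), Cmod_mult in h2.
    set (Q := Cmod (x ^ m - x0 ^ m)) in *.
    assert (h3 : Cmod kap / 2 * (/ 2 * W) <= Cmod kap / 2 * Q) by (apply Rmult_le_compat_l; lra).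
    assert (h4 : K * Cmod (Psi x - Psi x0) <= K * (G * Cmod x0 * W + psi)) by (apply Rmult_le_compat_l; lra).
    assert (h5 : K * G * Cmod x0 <= Cmod kap / 8).
    { apply Rle_trans with ((K * G + 1) * a1); [apply Rmult_le_compat; lra|right; unfold a1; field; lra]. }
    assert (h6 : K * G * Cmod x0 * W <= Cmod kap / 8 * W) by now apply Rmult_le_compat_r.
    assert (h7 : Cmod kap / 8 * W <= 2 * dd + K * psi) by lra.
    apply Rmult_le_reg_l with (Cmod kap / 8); [lra|]. eapply Rle_trans; [exact h7|].
    replace (Cmod kap / 8 * (K4 * (dd + psi))) with ((2 + K) * (dd + psi)) by (unfold K4; field; lra).
    assert (0 <= K * dd) by (apply Rmult_le_pos; lra). lra. }
  assert (HGW : G * Cmod x0 * W <= G * K4 * (dd + psi)).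
  { apply Rle_trans with (G * 1 * (K4 * (dd + psi))); [|right; ring].
    apply Rmult_le_compat; [apply Rmult_le_pos; lra|exact HW|apply Rmult_le_compat_l; lra|exact HWb]. }
  assert (HGW2 : G * Cmod x0 * W <= / 2 * (dd + psi)).
  { apply Rle_trans with (G * a2 * (K4 * (dd + psi))).
    - apply Rmult_le_compat; [apply Rmult_le_pos; lra|exact HW|apply Rmult_le_compat_l; lra|exact HWb].
    - replace (G * a2 * (K4 * (dd + psi))) with (G * K4 * a2 * (dd + psi)) by ring.
      apply Rmult_le_compat_r; [lra|]. apply Rle_trans with ((G * K4 + 1) * a2); [apply Rmult_le_compat_r; lra|].
      right. unfold a2. field. lra. }
  destruct (Hbil x0 x Hx0 ltac:(lra)) as [B1 [_ B3]].
  rewrite (Cmod_minus_sym (x0 ^ m)%C), (Cmod_minus_sym (Psi x0)) in B1.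
  assert (HDu : D <= K5 * (dd + psi)).
  { rewrite <- ED. eapply Rle_trans; [apply (norm2_triangle _ (q x0))|]. fold s0.
    assert (h : K * (Cmod (x ^ m - x0 ^ m) + Cmod (Psi x - Psi x0))
                <= K * ((2 * INR m * K4 + 1 + G * K4) * (dd + psi))).
    { apply Rmult_le_compat_l; [lra|].
      assert (2 * INR m * W <= 2 * INR m * (K4 * (dd + psi))) by (apply Rmult_le_compat_l; lra). lra. }
    unfold K5. lra. }
  assert (HDl : psi <= (4 * K + 1) * (D + dd)).
  { assert (h1 := Cmod_minus_triangle (Psi x0) (Psi x) (Psi y)). fold psi in h1.
    assert (h2 : norm2 (sub2 (q x0) (q x)) <= 2 * dd + D).
    { rewrite <- ED. eapply Rle_trans; [apply (norm2_triangle _ p)|]. rewrite norm2_sub_sym. fold s0. lra. }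
    assert (h3 : K * norm2 (sub2 (q x0) (q x)) <= K * (2 * dd + D)) by (apply Rmult_le_compat_l; lra).
    assert (0 <= K * D) by (apply Rmult_le_pos; lra). lra. }
  split; [exact HD0|]. split; [|split].
  - eapply Rle_trans; [exact Hsd|]. apply Rmult_le_compat_r; lra.
  (* For i = 0 the conjugate is x0 itself, so psi = 0 and D_0 = O(dd). *)
  - destruct (Nat.eqb_spec i 0) as [Ei|Ei].
    + assert (Epsi : psi = 0).
      { unfold psi, y. rewrite Ei. simpl Cpow. rewrite Cmult_1_l.
        replace (Psi x0 - Psi x0)%C with (RtoC 0) by ring. apply Cmod_0. }
      rewrite Epsi in HDu. eapply Rle_trans; [exact HDu|]. apply Rmult_le_compat_r; [lra|].
      assert (0 <= K5 * (KB * KM)) by (apply Rmult_le_pos; [lra|apply Rmult_le_pos; lra]). lra.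
    + assert (Hpsi1 : psi <= KB * KM * r ^ B i).
      { eapply Rle_trans; [apply (Hsep i x0); [lia|exact Hx0]|]. rewrite Rmult_assoc.
        apply Rmult_le_compat_l; [lra|]. now apply Hrb. }
      assert (hrB : 0 <= r ^ B i) by (apply pow_le; lra).
      assert (hKBM : 0 <= KB * KM) by (apply Rmult_le_pos; lra).
      apply Rle_trans with (K5 * (1 + KB * KM) * (dd + r ^ B i)).
      * eapply Rle_trans; [exact HDu|]. rewrite Rmult_assoc. apply Rmult_le_compat_l; [lra|].
        assert (0 <= KB * KM * dd) by (apply Rmult_le_pos; lra). lra.
      * apply Rmult_le_compat_r; lra.
  - intros Hi0. apply Rle_trans with (KM * KB * (4 * K + 1) * (D + dd)); [|apply Rmult_le_compat_r; lra].
    apply Rle_trans with (KM * (KB * psi)).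
    + eapply Rle_trans; [apply Hrb, Hi|]. apply Rmult_le_compat_l; [lra|]. apply (Hsep i x0); [lia|exact Hx0].
    + rewrite <- Rmult_assoc, Rmult_assoc with (r2 := 4 * K + 1). apply Rmult_le_compat_l; [apply Rmult_le_pos; lra|exact HDl].
Qed.

(** When dd is comparable to |p|, the bounds on D_i reduce to D_i being comparable to |p|, because r
    <= 1 and B_i >= m give r^(B_i) <= r^m = |p|. The work lies in comparing f with the product. *)
Lemma branch_distances_far (d1 : R) : 0 < d1 -> exists dg K', 0 < dg /\ forall p dd r,
  0 < norm2 p < dg -> dist_set p (Xr f (norm2 p)) = Finite dd -> 0 < dd -> d1 * norm2 p <= dd ->
  0 < r -> r ^ m = norm2 p -> branch_distances m B f K' p r dd.
Proof.
  intros Hd1. assert (HK1 := K1_ge_1). assert (Hk := kap_pos). assert (HmR := INRm_ge_1).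
  destruct slice_factorization as [eta' [dF [K3 [He' [HdF [HK3 Hfac]]]]]].
  destruct dist_sphere_curve as [dSp [HdSp Hsph]].
  destruct (kap_root_small (Rmin dF (dSp / 2))) as [dR [HdR Hroot]]; [apply Rmin_glb_lt; lra|].
  assert (x1 := Rmin_l dF (dSp / 2)). assert (x2 := Rmin_r dF (dSp / 2)).
  assert (Hcp := proj1 (Cmod_gt_0 _) pure_coef_nonzero). set (c0 := Cmod (cf 0%nat m)) in *.
  assert (Hrf : 0 < rf) by apply Hrep.
  destruct (slice_expansion rf cf f Hrep) as [M [s [Hcb Hs]]].
  set (L := 2 * (2 * M) / rf ^ S m).
  assert (HM : 0 <= M).
  { specialize (Hcb 0%nat 0%nat). simpl in Hcb. assert (h := Cmod_ge_0 (cf 0%nat 0%nat)). lra. }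
  assert (HL : 0 <= L) by (apply Rmult_le_pos; [lra|apply Rlt_le, Rinv_0_lt_compat; now apply pow_lt]).
  set (a1 := c0 / (2 * (L + 1))). assert (Ha1 : 0 < a1) by (apply Rdiv_lt_0_compat; lra).
  set (dg := Rmin (Rmin dR dF) (Rmin (Rmin 1 a1) (rf / 2))).
  set (G := 1 + K1 * 2 ^ m / Cmod kap).
  assert (H2m : 1 <= 2 ^ m) by (apply pow_R1_Rle; lra).
  assert (HG : 1 <= G).
  { unfold G. assert (0 < K1 * 2 ^ m / Cmod kap) by (apply Rdiv_lt_0_compat; [apply Rmult_lt_0_compat; lra|exact Hk]). lra. }
  assert (Hid : 0 < / d1) by now apply Rinv_0_lt_compat.
  assert (Hc2 : 0 < 2 / c0) by (apply Rdiv_lt_0_compat; lra).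
  assert (HGd : 0 <= G * / d1) by (apply Rmult_le_pos; lra).
  exists dg, (7 + G * / d1 + / d1 + K3 + 2 * c0 + 2 / c0). split; [repeat apply Rmin_glb_lt; lra|].
  intros [u v] dd r Hp Edd Hdd Hdd1 Hr Erm. set (p := (u, v) : C2) in *. set (P := norm2 p) in *.
  assert (p1 : dg <= dR) by rmin_le.
  assert (p2 : dg <= dF) by rmin_le.
  assert (p3 : dg <= 1) by rmin_le.
  assert (p4 : dg <= a1) by rmin_le.
  assert (p5 : dg <= rf / 2) by rmin_le.
  assert (HP : P <= / d1 * dd).
  { apply Rmult_le_reg_l with d1; [exact Hd1|]. rewrite <- Rmult_assoc, Rinv_r; lra. }
  assert (Hr1 : r <= 1).
  { apply pow_le_inv with m; [exact Hm|lra|]. rewrite pow1, Erm. lra. }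
  assert (HrB : forall i, (0 < i < m)%nat -> r ^ B i <= / d1 * dd).
  { intros i Hi. eapply Rle_trans; [|exact HP]. rewrite <- Erm.
    replace (B i) with (m + (B i - m))%nat by (specialize (HBm i Hi); lia). rewrite pow_add.
    rewrite <- (Rmult_1_r (r ^ m)) at 2. apply Rmult_le_compat_l; [apply pow_le; lra|].
    rewrite <- (pow1 (B i - m)). apply pow_incr. lra. }
  assert (Hgen : forall (D : nat -> R) (Kf : R), 0 <= Kf -> Kf <= K3 + 2 * c0 + 2 / c0 ->
     (forall i, (i < m)%nat -> 0 <= D i /\ dd <= 7 * D i /\ D i <= G * P) ->
     rprod D m <= Kf * Cmod (f p) -> Cmod (f p) <= Kf * rprod D m ->
     branch_distances m B f (7 + G * / d1 + / d1 + K3 + 2 * c0 + 2 / c0) p r dd).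
  { intros D Kf HKf1 HKf2 HD HF1 HF2.
    apply branch_distances_mono with (7 + G * / d1 + / d1 + Kf); [lra|lra|lra|].
    exists D. split; [|split].
    - intros i Hi. destruct (HD i Hi) as [h1 [h2 h3]]. split; [exact h1|]. split; [|split].
      + eapply Rle_trans; [exact h2|]. apply Rmult_le_compat_r; lra.
      + apply Rle_trans with (G * / d1 * dd).
        * eapply Rle_trans; [exact h3|]. rewrite Rmult_assoc. apply Rmult_le_compat_l; lra.
        * apply Rmult_le_compat; try lra.
          destruct (Nat.eqb i 0); [lra|]. assert (0 <= r ^ B i) by (apply pow_le; lra). lra.
      + intros Hi0. eapply Rle_trans; [apply HrB; lia|]. apply Rmult_le_compat; lra.
    - eapply Rle_trans; [exact HF1|]. apply Rmult_le_compat_r; [apply Cmod_ge_0|lra].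
    - eapply Rle_trans; [exact HF2|]. apply Rmult_le_compat_r; [|lra].
      apply rprod_ge0. intros i Hi. now apply HD. }
  assert (hu := norm2_fst p). assert (hv := norm2_snd p). simpl in hu, hv. fold P in hu, hv.
  destruct (Ceq_dec u (RtoC 0)) as [Eu|Eu].
  (* The slice u = 0 offers no z <> 0 to start from. On it f is cf 0 m times v^m to leading order,
     and all m distances are taken to be P = |v|. *)
  - assert (EP : P = Cmod v).
    { unfold P, p. rewrite Eu. rewrite <- norm2_sub_0. unfold zero2. rewrite norm2_pair_eq. f_equal. ring. }
    destruct (Hs (RtoC 0) ltac:(rewrite Cmod_0; lra)) as [Hsb [Hsj Hsf]].
    assert (Hs0 : forall j, s (RtoC 0) j = cf 0%nat j).
    { intros j. assert (h := ser1_leading _ rf _ 0 (RtoC 0) _ Hrf (Hcb j)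
        (fun j (Hj : (j < 0)%nat) => False_ind _ (Nat.nlt_0_r _ Hj)) ltac:(rewrite Cmod_0; lra) (Hsj j)).
      cbv beta in h. simpl Cpow in h. rewrite Cmult_1_r, Cmod_0, (pow_1 0), Rmult_0_r in h.
      apply Ceq_minus, Cmod_le_0, h. }
    assert (h := ser1_leading (2 * M) rf (s (RtoC 0)) m v _ Hrf Hsb
      (fun j Hj => eq_trans (Hs0 j) (Hlow 0%nat j Hj)) ltac:(lra) (Hsf v ltac:(lra))).
    rewrite Hs0, <- Eu in h. fold p in h. rewrite <- EP in h. fold L in h. rewrite <- tech_pow_Rmult in h.
    assert (k1 := Cmod_minus_ge (cf 0%nat m * v ^ m) (f p)).
    assert (k2 := Cmod_minus_ge (f p) (cf 0%nat m * v ^ m)).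
    rewrite (Cmod_minus_sym (_ * _)) in k1. rewrite Cmod_mult, Cmod_pow, <- EP in k1, k2. fold c0 in k1, k2.
    assert (hPm : 0 <= P ^ m) by (apply pow_le; lra).
    assert (hLP : L * P <= c0 / 2).
    { apply Rle_trans with ((L + 1) * a1); [apply Rmult_le_compat; lra|right; unfold a1; field; lra]. }
    assert (h2 : L * P * P ^ m <= c0 / 2 * P ^ m) by now apply Rmult_le_compat_r.
    apply (Hgen (fun _ => P) (2 * c0 + 2 / c0)); try rewrite rprod_const; [lra|lra| | |].
    + intros i Hi. split; [lra|]. split; [assert (h3 := dist_sphere_le p dd Edd); fold P in h3; lra|].
      rewrite <- (Rmult_1_l P) at 1. apply Rmult_le_compat_r; lra.
    + apply Rle_trans with (2 / c0 * (c0 / 2 * P ^ m)); [right; field; lra|].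
      apply Rmult_le_compat; [lra|apply Rmult_le_pos; lra|lra|lra].
    + assert (0 <= c0 * P ^ m) by (apply Rmult_le_pos; lra).
      apply Rle_trans with (2 * c0 * P ^ m); [lra|]. apply Rmult_le_compat_r; lra.
  - destruct (kap_root u) as [w Ew].
    assert (Hw := Hroot u w ltac:(lra) Ew).
    assert (Hw0 : w <> RtoC 0).
    { intros E. apply Eu. rewrite <- Ew, E, Cpow_0_l by exact Hm. ring. }
    assert (hw0 := Cmod_ge_0 w).
    assert (Hwm : Cmod w ^ m = Cmod u / Cmod kap).
    { apply Rmult_eq_reg_l with (Cmod kap); [|lra]. rewrite <- Cmod_pow, <- Cmod_mult, Ew. field. lra. }
    destruct (Hfac w (w ^ m)%C v Hw0 ltac:(lra) ltac:(lra)) as [xi [Hxi [F1 F2]]].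
    { replace (w ^ m - w ^ m)%C with (RtoC 0) by ring. rewrite Cmod_0.
      apply Rmult_le_pos; [lra|now apply pow_le]. }
    rewrite Ew in F1, F2. fold p in F1, F2.
    apply (Hgen (fun i => Cmod (v - snd (q (zeta m ^ i * w * xi i)%C))) K3); [lra|lra| |exact F1|exact F2].
    intros i Hi. destruct (Hxi i) as [[Hxi1 Hxi2] [_ Hxi5]]. rewrite Ew in Hxi5.
    destruct (branch_norm w (xi i) i ltac:(lra) Hxi2) as [_ hn].
    set (x := (zeta m ^ i * w * xi i)%C) in *.
    assert (Ex : Cmod x <= 2 * Cmod w).
    { unfold x. rewrite !Cmod_mult, Cmod_zeta_pow, Rmult_1_l, Rmult_comm. apply Rmult_le_compat_r; lra. }
    assert (ED : norm2 (sub2 p (q x)) = Cmod (v - snd (q x))).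
    { unfold p. rewrite (surjective_pairing (q x)) at 1. rewrite Hxi5. apply norm2_pair_eq. }
    split; [apply Cmod_ge_0|]. split.
    + rewrite <- ED. apply Hsph; [lra|exact Edd].
    + rewrite <- ED. eapply Rle_trans; [apply norm2_sub_le|]. fold P.
      rewrite Hwm in hn. unfold G. rewrite Rmult_plus_distr_r, Rmult_1_l. apply Rplus_le_compat_l.
      eapply Rle_trans; [exact hn|].
      replace (K1 * 2 ^ m * (Cmod u / Cmod kap)) with (K1 * 2 ^ m / Cmod kap * Cmod u) by (field; lra).
      apply Rmult_le_compat_l; [unfold G in HG; lra|exact hu].
Qed.

(** The far case accepts any threshold, so it is invoked with the one that the near case
    produces. *)
Theorem branch_distances_exist : exists dg K', 0 < dg /\ 0 < K' /\ forall p dd r,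
  0 < norm2 p < dg -> dist_set p (Xr f (norm2 p)) = Finite dd -> 0 < dd ->
  0 < r -> r ^ m = norm2 p -> branch_distances m B f K' p r dd.
Proof.
  destruct branch_distances_near as [d1 [g1 [k1 [Hd1 [Hg1 H1]]]]].
  destruct (branch_distances_far d1 Hd1) as [g2 [k2 [Hg2 H2]]].
  exists (Rmin g1 g2), (Rmax (Rmax k1 k2) 1).
  assert (i1 := Rmin_l g1 g2). assert (i2 := Rmin_r g1 g2).
  assert (j1 := Rle_trans _ _ _ (Rmax_l k1 k2) (Rmax_l _ 1)).
  assert (j2 := Rle_trans _ _ _ (Rmax_r k1 k2) (Rmax_l _ 1)). assert (j3 := Rmax_r (Rmax k1 k2) 1).
  split; [now apply Rmin_glb_lt|]. split; [lra|].
  intros p dd r Hp E Hdd Hr Erm. destruct (Rle_dec dd (d1 * norm2 p)) as [h|h].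
  - apply branch_distances_mono with k1; [lra|lra|lra|]. apply H1; auto; lra.
  - apply branch_distances_mono with k2; [lra|lra|lra|]. apply H2; auto; lra.
Qed.
End Geometry.

(** * Puiseux pairs *)

Section PuiseuxLevels.
Variables (m : nat) (a : nat -> C) (s : nat) (beta e : nat -> nat).
Hypothesis Hm : (1 <= m)%nat.
Hypothesis Hpairs : puiseux_pairs m a s beta e.
Hypothesis Hlow : forall j, (j <= m)%nat -> a j = RtoC 0.

Lemma e_divides (l : nat) : (l < s)%nat -> Nat.divide (e (S l)) (e l).
Proof.
  intros Hl. destruct Hpairs as [_ [_ [_ H]]]. destruct (H l Hl) as [_ [_ [_ E]]].
  rewrite E. apply Nat.gcd_divide_l.
Qed.

Lemma e_divides_le (l k : nat) : (l <= k <= s)%nat -> Nat.divide (e k) (e l).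
Proof.
  intros [H1 H2]. induction H1 as [|k H1 IH]; [apply Nat.divide_refl|].
  apply Nat.divide_trans with (e k); [apply e_divides; lia|apply IH; lia].
Qed.

Lemma e_divides_m (l : nat) : (l <= s)%nat -> Nat.divide (e l) m.
Proof.
  intros Hl. destruct Hpairs as [E0 _]. rewrite <- E0. apply e_divides_le. lia.
Qed.

(** beta_(k+2) is not divisible by e_(k+1), hence not by its multiple e_k, so the minimality of
    beta_(k+1) applies to it. *)
Lemma beta_mono (l k : nat) : (l <= k)%nat -> (k < s)%nat -> (beta (S l) <= beta (S k))%nat.
Proof.
  intros Hlk. induction Hlk as [|k Hlk IH]; intros Hk; [lia|].
  eapply Nat.le_trans; [apply IH; lia|].
  destruct Hpairs as [_ [_ [_ H]]].
  destruct (H k ltac:(lia)) as [_ [_ [Hmin _]]]. destruct (H (S k) Hk) as [Ha [Hnd _]].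
  apply Hmin; [exact Ha|]. intros Hd. apply Hnd.
  apply Nat.divide_trans with (e k); [apply e_divides; lia|exact Hd].
Qed.

Lemma beta_gt_m (l : nat) : (l < s)%nat -> (m < beta (S l))%nat.
Proof.
  intros Hl. destruct Hpairs as [_ [_ [_ H]]]. destruct (H l Hl) as [Ha _].
  apply Nat.nle_gt. intros Hle. apply Ha. now apply Hlow.
Qed.

(** Levels sort the conjugates: the power e_l of zeta^i is 1, the power e_(l+1) is not. At this
    level [beta (S l)] turns out to be the order of Psi x - Psi (zeta^i x). *)
Definition at_level (i l : nat) : Prop :=
  (l < s)%nat /\ Nat.divide m (i * e l) /\ ~ Nat.divide m (i * e (S l)).

(** m divides i e_0 = i m but not i e_s = i, so divisibility is lost at some step. *)
Lemma level_exists (i : nat) : (0 < i < m)%nat -> exists l, at_level i l.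
Proof.
  intros Hi. apply NNPP. intros Hn.
  assert (H : forall l, (l <= s)%nat -> Nat.divide m (i * e l)).
  { induction l as [|l IH]; intros Hl.
    - destruct Hpairs as [E0 _]. rewrite E0. now exists i.
    - apply NNPP. intros Hd. apply Hn. exists l. split; [lia|]. split; [apply IH; lia|exact Hd]. }
  specialize (H s (le_n _)). destruct Hpairs as [_ [_ [Es _]]]. rewrite Es, Nat.mul_1_r in H.
  apply Nat.divide_pos_le in H; lia.
Qed.

Lemma branch_levels : exists B : nat -> nat, forall i, (0 < i < m)%nat ->
  exists l, at_level i l /\ B i = beta (S l).
Proof.
  assert (H : forall i, exists b, (0 < i < m)%nat -> exists l, at_level i l /\ b = beta (S l)).
  { intros i. destruct (classic (0 < i < m)%nat) as [h|h]; [|exists 0%nat; contradiction].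
    destruct (level_exists i h) as [l Hl]. exists (beta (S l)). intros _. now exists l. }
  exact (choice_fun _ H).
Qed.

Lemma divide_mul_trans (i x y : nat) : Nat.divide x y -> Nat.divide m (i * x) -> Nat.divide m (i * y).
Proof.
  intros H1 H2. apply Nat.divide_trans with (i * x)%nat; [exact H2|]. now apply Nat.mul_divide_mono_l.
Qed.

(** Below beta_(l+1) a nonzero coefficient has an index j divisible by e_l, and then zeta^(i j) =
    1. *)
Lemma level_coef_low (i l j : nat) : at_level i l -> (j < beta (S l))%nat ->
  (a j * (1 - zeta m ^ (i * j)%nat))%C = RtoC 0.
Proof.
  intros [Hl [Hd _]] Hj. destruct (Ceq_dec (a j) (RtoC 0)) as [->|Ha]; [ring|].
  destruct Hpairs as [_ [_ [_ H]]]. destruct (H l Hl) as [_ [_ [Hmin _]]].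
  assert (Hej : Nat.divide (e l) j).
  { apply NNPP. intros Hn. specialize (Hmin j Ha Hn). lia. }
  rewrite (proj2 (zeta_pow_eq_1 m (i * j) Hm)); [ring|]. now apply divide_mul_trans with (e l).
Qed.

(** If m divided i beta_(l+1) as well as i e_l, it would divide i gcd(e_l, beta_(l+1)) = i
    e_(l+1). *)
Lemma level_coef_lead (i l : nat) : at_level i l ->
  (a (beta (S l)) * (1 - zeta m ^ (i * beta (S l))%nat))%C <> RtoC 0.
Proof.
  intros [Hl [Hd Hnd]]. destruct Hpairs as [_ [_ [_ H]]]. destruct (H l Hl) as [Ha [_ [_ Eg]]].
  apply Cmult_neq_0; [exact Ha|]. apply Cminus_eq_contra. intros E. symmetry in E.
  apply zeta_pow_eq_1 in E; [|exact Hm]. apply Hnd. rewrite Eg.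
  rewrite <- Nat.gcd_mul_mono_l. now apply Nat.gcd_greatest.
Qed.

Lemma level_order (i l k : nat) : at_level i l -> (k <= s)%nat ->
  (Nat.divide m (i * e k) <-> (k <= l)%nat).
Proof.
  intros [Hl [Hd Hnd]] Hk. split.
  - intros H. apply Nat.nlt_ge. intros Hlt. apply Hnd. apply divide_mul_trans with (e k); [|exact H].
    apply e_divides_le. lia.
  - intros H. apply divide_mul_trans with (e l); [|exact Hd]. apply e_divides_le. lia.
Qed.
End PuiseuxLevels.

(** * From the Puiseux data to the branch distances *)

Lemma uniform_prefix (P : nat -> R -> R -> Prop) (n : nat) :
  (forall i d d' K K', 0 < d' <= d -> 0 < K <= K' -> P i d K -> P i d' K') ->
  (forall i, (i < n)%nat -> exists d K, 0 < d /\ 0 < K /\ P i d K) ->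
  exists d K, 0 < d /\ 0 < K /\ forall i, (i < n)%nat -> P i d K.
Proof.
  intros Hmono. induction n as [|n IH]; intros H.
  - exists 1, 1. split; [lra|]. split; [lra|]. intros i Hi. lia.
  - destruct IH as [d [K [Hd [HK IH]]]]; [intros i Hi; apply H; lia|].
    destruct (H n ltac:(lia)) as [d' [K' [Hd' [HK' Hn]]]].
    exists (Rmin d d'), (K + K'). assert (h1 := Rmin_l d d'). assert (h2 := Rmin_r d d').
    assert (h3 : 0 < Rmin d d') by now apply Rmin_glb_lt.
    split; [exact h3|]. split; [lra|]. intros i Hi.
    destruct (Nat.eq_dec i n) as [->|Ei].
    + apply Hmono with d' K'; [lra|lra|exact Hn].
    + apply Hmono with d K; [lra|lra|]. apply IH. lia.
Qed.

Lemma ser1_order (M r : R) (b : nat -> C) (n : nat) :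
  0 < r -> coef_bound M r b -> (forall j, (j < n)%nat -> b j = RtoC 0) -> b n <> RtoC 0 ->
  exists d K, 0 < d /\ 0 < K /\ forall x l, Cmod x < d -> ser1 b x l ->
    Cmod x ^ n <= K * Cmod l /\ Cmod l <= K * Cmod x ^ n.
Proof.
  intros Hr Hb H0 Hn. assert (Hbn := proj1 (Cmod_gt_0 _) Hn). set (c0 := Cmod (b n)) in *.
  assert (HM := coef_bound_ge0 _ _ _ Hb).
  set (L := 2 * M / r ^ S n).
  assert (HL : 0 <= L) by (apply Rmult_le_pos; [lra|apply Rlt_le, Rinv_0_lt_compat; now apply pow_lt]).
  set (d := Rmin (r / 2) (c0 / (2 * (L + 1)))).
  assert (Hq : 0 < c0 / (2 * (L + 1))) by (apply Rdiv_lt_0_compat; lra).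
  assert (i1 : d <= r / 2) by apply Rmin_l. assert (i2 : d <= c0 / (2 * (L + 1))) by apply Rmin_r.
  assert (Hc2 : 0 < 2 / c0) by (apply Rdiv_lt_0_compat; lra).
  exists d, (2 * c0 + 2 / c0). split; [apply Rmin_glb_lt; lra|]. split; [lra|].
  intros x l Hx Hl. assert (h := ser1_leading M r b n x l Hr Hb H0 ltac:(lra) Hl).
  fold L in h. rewrite <- tech_pow_Rmult in h.
  assert (hx := Cmod_ge_0 x). set (X := Cmod x ^ n) in *. assert (HX : 0 <= X) by now apply pow_le.
  assert (k1 := Cmod_minus_ge l (b n * x ^ n)%C).
  assert (k2 := Cmod_minus_ge (b n * x ^ n)%C l). rewrite (Cmod_minus_sym (_ * _)%C) in k2.
  rewrite Cmod_mult, Cmod_pow in k1, k2. fold c0 X in k1, k2.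
  assert (hL : L * Cmod x <= c0 / 2).
  { apply Rle_trans with ((L + 1) * (c0 / (2 * (L + 1)))); [apply Rmult_le_compat; lra|right; field; lra]. }
  assert (h2 : L * Cmod x * X <= c0 / 2 * X) by now apply Rmult_le_compat_r.
  split.
  - apply Rle_trans with (2 / c0 * (c0 / 2 * X)); [right; field; lra|].
    apply Rmult_le_compat; [lra|apply Rmult_le_pos; lra|lra|lra].
  - assert (0 <= c0 * X) by (apply Rmult_le_pos; lra).
    apply Rle_trans with (2 * c0 * X); [lra|]. apply Rmult_le_compat_r; lra.
Qed.

Lemma strict_diff_swap (F : C2 -> C) (a b : C) :
  strict_diff F a b -> strict_diff (fun p => F (snd p, fst p)) b a.
Proof.
  intros H eps He. destruct (H eps He) as [d [Hd H']]. exists d. split; [exact Hd|].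
  assert (Es : forall p : C2, norm2 (snd p, fst p) = norm2 p).
  { intros p. unfold norm2; simpl. f_equal. ring. }
  intros P Q HP HQ. specialize (H' (snd P, fst P) (snd Q, fst Q)). rewrite !Es in H'.
  specialize (H' HP HQ). simpl fst in H'. simpl snd in H'.
  change (sub2 (snd P, fst P) (snd Q, fst Q)) with (snd (sub2 P Q), fst (sub2 P Q)) in H'.
  rewrite Es in H'. rewrite Cplus_comm. exact H'.
Qed.

Lemma ser2_at_0 (c : nat -> nat -> C) (l : C) : ser2 c (RtoC 0) (RtoC 0) l -> l = c 0%nat 0%nat.
Proof.
  intros H. assert (H2 : dser (fun i j => (c i j * (0 ^ i * 0 ^ j) - (if Nat.eqb i 0 then if Nat.eqb j 0 then c 0%nat 0%nat else RtoC 0 else RtoC 0))%C) (l - c 0%nat 0%nat)%C).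
  { apply dser_minus; [exact H|apply dser_single]. }
  apply Ceq_minus, Cmod_le_0. replace 0 with (4 * 0) by ring.
  eapply dser_half_le; [|exact H2]. intros i j. cbv beta. rewrite Rmult_0_l.
  match goal with |- Cmod ?z <= 0 => replace z with (RtoC 0); [rewrite Cmod_0; lra|] end.
  destruct i as [|i]; [destruct j as [|j]|]; simpl Nat.eqb; cbv iota.
  - simpl Cpow. ring.
  - rewrite (Cpow_S _ j). ring.
  - rewrite (Cpow_S _ i). ring.
Qed.

Theorem branch_distances_of_param (f : C2 -> C) (m : nat) (Phi : C2 -> C2) (a : nat -> C)
  (s : nat) (beta e : nat -> nat) :
  (1 <= m)%nat -> germ_mult f m -> puiseux_param f Phi m a -> puiseux_pairs m a s beta e ->
  exists (B : nat -> nat) (dg K : R),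
    (forall i, (0 < i < m)%nat -> exists l, at_level m s e i l /\ B i = beta (S l)) /\
    0 < dg /\ 0 < K /\ forall p dd r,
      0 < norm2 p < dg -> dist_set p (Xr f (norm2 p)) = Finite dd -> 0 < dd ->
      0 < r -> r ^ m = norm2 p -> branch_distances m B f K p r dd.
Proof.
  intros Hm [rf [cf [Hrep [Htop Hlowf]]]] [Hloc [Hlow [rho [Hrho [Hconv [eps [Heps Hzero]]]]]]] Hpairs.
  destruct (branch_levels m a s beta e Hm Hpairs) as [B HB].
  assert (HBm : forall i, (0 < i < m)%nat -> (m <= B i)%nat).
  { intros i Hi. destruct (HB i Hi) as [l [[Hl _] ->]].
    apply Nat.lt_le_incl. now apply (beta_gt_m m a s beta e Hpairs Hlow). }
  destruct (ser1_coef_bound a rho Hrho Hconv) as [M HM].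
  assert (HM0 := coef_bound_ge0 _ _ _ HM).
  (* A total function; outside the disc of convergence its values are arbitrary. *)
  set (Psi := fun x => epsilon (inhabits (RtoC 0)) (fun l => ser1 a x l)).
  assert (HPsi_ser : forall x, Cmod x < rho -> ser1 a x (Psi x)).
  { intros x Hx. apply epsilon_spec. now apply Hconv. }
  (* The coefficient bound holds at radius rho / 2, and [ser1_lipschitz] asks for a quarter of
     it. *)
  set (rho0 := rho / 8). set (KP := 2 * M * (2 / (rho / 2)) ^ S m).
  assert (HKP : 0 <= KP).
  { apply Rmult_le_pos; [lra|]. apply pow_le, Rlt_le, Rdiv_lt_0_compat; lra. }
  assert (HPsi : forall X x y, Cmod x <= X -> Cmod y <= X -> X <= rho0 ->
    Cmod (Psi x - Psi y) <= KP * X ^ m * Cmod (x - y)).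
  { intros X x y Hx Hy HX. unfold rho0 in HX.
    apply (ser1_lipschitz M (rho / 2) a m X x y); try assumption; try lra; apply HPsi_ser; lra. }
  assert (Psi0 : Psi (RtoC 0) = RtoC 0).
  { apply cser_unique with (fun n => (a n * 0 ^ n)%C).
    - apply HPsi_ser. rewrite Cmod_0. exact Hrho.
    - eapply cser_ext; [|apply cser_zero]. intros [|n]; cbv beta; [rewrite Hlow by lia; ring|].
      rewrite Cpow_S. ring. }
  (* Psi x - Psi (zeta^i x) is the series with coefficients a_j (1 - zeta^(i j)), the first nonzero
     one at j = B_i. There are finitely many i, so the constants can be made common. *)
  destruct (uniform_prefix (fun i d K => (0 < i)%nat -> forall x, Cmod x < d ->
     Cmod x ^ B i <= K * Cmod (Psi x - Psi (zeta m ^ i * x)%C) /\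
     Cmod (Psi x - Psi (zeta m ^ i * x)%C) <= K * Cmod x ^ B i) m) as [dB [KB [HdB [HKB Hsep]]]].
  { intros i d d' K K' Hd HK H Hi x Hx. destruct (H Hi x ltac:(lra)) as [h1 h2]. split.
    - eapply Rle_trans; [exact h1|]. apply Rmult_le_compat_r; [apply Cmod_ge_0|lra].
    - eapply Rle_trans; [exact h2|]. apply Rmult_le_compat_r; [apply pow_le, Cmod_ge_0|lra]. }
  { intros i Hi. destruct (Nat.eq_dec i 0) as [->|Ei].
    { exists 1, 1. split; [lra|]. split; [lra|]. intros; lia. }
    destruct (HB i ltac:(lia)) as [l [Hl EB]].
    destruct (ser1_order (2 * M) (rho / 2) (fun j => (a j * (1 - zeta m ^ (i * j)%nat))%C) (B i)) as [d [K [Hd [HK Hord]]]].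
    - lra.
    - intros n. rewrite Cmod_mult.
      assert (h : Cmod (1 - zeta m ^ (i * n)%nat) <= 2).
      { eapply Rle_trans; [apply Cmod_minus_le|]. rewrite Cmod_1, Cmod_zeta_pow. lra. }
      specialize (HM n). assert (h0 := Cmod_ge_0 (a n)). assert (h1 : 0 <= (rho / 2) ^ n) by (apply pow_le; lra).
      apply Rle_trans with (2 * (Cmod (a n) * (rho / 2) ^ n)); [|lra].
      replace (2 * (Cmod (a n) * (rho / 2) ^ n)) with (Cmod (a n) * 2 * (rho / 2) ^ n) by ring.
      apply Rmult_le_compat_r; [exact h1|]. now apply Rmult_le_compat_l.
    - intros j Hj. rewrite EB in Hj. now apply (level_coef_low m a s beta e Hm Hpairs i l).
    - rewrite EB. now apply (level_coef_lead m a s beta e Hm Hpairs i l).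
    - exists (Rmin d rho), K. assert (h1 := Rmin_l d rho). assert (h2 := Rmin_r d rho).
      split; [now apply Rmin_glb_lt|]. split; [exact HK|]. intros _ x Hx.
      apply Hord; [lra|]. unfold ser1.
      assert (Hz : Cmod (zeta m ^ i * x) < rho) by (rewrite Cmod_mult, Cmod_zeta_pow; lra).
      eapply cser_ext; [|apply cser_minus; [apply (HPsi_ser x); lra|apply (HPsi_ser _ Hz)]].
      intros n. cbv beta. rewrite Cpow_mult_l, Cpow_mult_r. ring. }
  (* Stated for any function and chart, in order to serve both f and f with exchanged coordinates.
     The condition c22 <> 0 makes kap nonzero, that is, the slices transverse to the curve. *)
  assert (Hcore : forall (g : C2 -> C) (Ph : C2 -> C2) (c11 c12 c21 c22 : C) (cg : nat -> nat -> C) (rg : R),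
    Ph zero2 = zero2 ->
    strict_diff (fun p => fst (Ph p)) c11 c12 -> strict_diff (fun p => snd (Ph p)) c21 c22 ->
    (c11 * c22 - c12 * c21)%C <> RtoC 0 -> c22 <> RtoC 0 ->
    (forall p, norm2 p < eps -> (g p = RtoC 0 <->
       exists x, Cmod x < rho /\ fst (Ph p) = (x ^ m)%C /\ ser1 a x (snd (Ph p)))) ->
    ser2_rep rg cg g -> (forall i j, (i + j < m)%nat -> cg i j = RtoC 0) ->
    (exists i j, (i + j = m)%nat /\ cg i j <> RtoC 0) ->
    exists dg K, 0 < dg /\ 0 < K /\ forall p dd r,
      0 < norm2 p < dg -> dist_set p (Xr g (norm2 p)) = Finite dd -> 0 < dd ->
      0 < r -> r ^ m = norm2 p -> branch_distances m B g K p r dd).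
  { intros g Ph c11 c12 c21 c22 cg rg HPh0 HD1 HD2 Hdet Hc22 Hz Hrepg Hlg Htg.
    destruct (curve_exists Ph c11 c12 c21 c22 HPh0 HD1 HD2 Hdet m Psi rho0 KP Hm ltac:(unfold rho0; lra) HKP Psi0 HPsi
      g eps rho Heps Hrho) as [q [delta [K [Hdel [Hdel1 [HK [Hq0 [Hfq [Hqf [Hbil [Hstr Hray]]]]]]]]]]].
    { intros p Hp. rewrite (Hz p Hp). split; intros [x [h1 [h2 h3]]]; exists x.
      - split; [exact h1|]. split; [exact h2|]. apply cser_unique with (fun n => (a n * x ^ n)%C); [now apply HPsi_ser|exact h3].
      - split; [exact h1|]. split; [exact h2|]. rewrite <- h3. now apply HPsi_ser. }
    set (delta' := Rmin delta dB).
    assert (j1 : delta' <= delta) by apply Rmin_l. assert (j2 : delta' <= dB) by apply Rmin_r.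
    assert (j3 : 0 < delta') by (apply Rmin_glb_lt; lra).
    apply (branch_distances_exist m Psi rho0 KP Hm HKP Psi0 HPsi g q delta' K
      (c22 / (c11 * c22 - c12 * c21))%C) with (KB := KB) (rf := rg) (cf := cg); try assumption; try lra.
    - intros E. apply Hc22.
      replace c22 with (c22 / (c11 * c22 - c12 * c21) * (c11 * c22 - c12 * c21))%C by (field; exact Hdet).
      rewrite E. ring.
    - intros x Hx. apply Hfq. lra.
    - destruct Hqf as [e0 [He0 Hq']].
      (* With a smaller disc of parameters, all zeros are reached only in a correspondingly smaller
         neighbourhood of 0. *)
      set (e1 := Rmin e0 (delta' ^ m / K)).
      assert (Hdm : 0 < delta' ^ m / K) by (apply Rdiv_lt_0_compat; [now apply pow_lt|exact HK]).
      exists e1. split; [now apply Rmin_glb_lt|]. intros p Hp Hgp.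
      assert (i1 : e1 <= e0) by apply Rmin_l. assert (i2 : e1 <= delta' ^ m / K) by apply Rmin_r.
      destruct (Hq' p ltac:(lra) Hgp) as [x [Hx Ex]]. exists x. split; [|exact Ex].
      apply pow_lt_inv with m; [lra|].
      destruct (Hbil x (RtoC 0) Hx ltac:(rewrite Cmod_0; lra)) as [_ [h _]].
      rewrite Hq0, norm2_sub_0, Cpow_0_l, Ex in h by exact Hm.
      replace (x ^ m - 0)%C with (x ^ m)%C in h by ring. rewrite Cmod_pow in h.
      eapply Rle_lt_trans; [exact h|]. apply Rlt_le_trans with (K * (delta' ^ m / K)).
      + apply Rmult_lt_compat_l; lra.
      + right. field. lra.
    - intros x y Hx Hy. apply Hbil; lra.
    - intros i x Hi Hx. apply Hsep; [lia|lia|lra]. }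
  destruct Hloc as [rp [c1 [c2 [Hr1 [Hr2 [H10 [H20 Hdet]]]]]]].
  assert (HPhi0 : Phi zero2 = zero2).
  { rewrite (surjective_pairing (Phi zero2)). unfold zero2 at 3. f_equal.
    - rewrite <- H10. apply ser2_at_0. apply Hr1; rewrite Cmod_0; apply Hr1.
    - rewrite <- H20. apply ser2_at_0. apply Hr2; rewrite Cmod_0; apply Hr2. }
  assert (HD1 := ser2_rep_strict_diff _ _ _ Hr1). assert (HD2 := ser2_rep_strict_diff _ _ _ Hr2).
  exists B. destruct (Ceq_dec (c2 0%nat 1%nat) (RtoC 0)) as [E22|E22].
  2:{ destruct (Hcore f Phi _ _ _ _ cf rf HPhi0 HD1 HD2 Hdet E22 Hzero Hrep Hlowf Htop) as [dg [K H]].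
      exists dg, K. split; [exact HB|exact H]. }
  (* the slices u = const are tangent to the curve: exchange the two coordinates *)
  set (sw := fun p : C2 => (snd p, fst p) : C2).
  assert (Hsw : forall p, norm2 (sw p) = norm2 p) by (intros p; unfold norm2, sw; simpl; f_equal; ring).
  destruct (ser2_rep_swap rf cf f Hrep) as [rg Hrepg].
  destruct (Hcore (fun p => f (sw p)) (fun p => Phi (sw p)) (c1 0%nat 1%nat) (c1 1%nat 0%nat) (c2 0%nat 1%nat) (c2 1%nat 0%nat)
     (fun i j => cf j i) rg) as [dg [K [Hdg [HK H]]]].
  - exact HPhi0.
  - exact (strict_diff_swap _ _ _ HD1).
  - exact (strict_diff_swap _ _ _ HD2).
  - intros E. apply Hdet. rewrite E22 in E |- *.
    replace (c1 1%nat 0%nat * 0 - c1 0%nat 1%nat * c2 1%nat 0%nat)%C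
      with (- (c1 0%nat 1%nat * c2 1%nat 0%nat - c1 1%nat 0%nat * 0))%C by ring.
    rewrite E. ring.
  - intros E. apply Hdet. rewrite E, E22. ring.
  - intros p Hp. apply Hzero. now rewrite Hsw.
  - exact Hrepg.
  - intros i j Hij. apply Hlowf. lia.
  - destruct Htop as [i [j [h1 h2]]]. exists j, i. split; [lia|exact h2].
  - exists dg, K. split; [exact HB|]. split; [exact Hdg|]. split; [exact HK|]. intros p dd r Hp Edd Hdd Hr Er.
    assert (Hss : forall p : C2, sw (sw p) = p) by (intros [? ?]; reflexivity).
    destruct (H (sw p) dd r) as [D HD]; try assumption; try (rewrite Hsw; assumption).
    + rewrite Hsw, <- Edd. apply Glb_Rbar_eqset. intros x. split; intros [z [[Hz1 Hz2] ->]]; exists (sw z).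
      * split; [split; [exact Hz1|now rewrite Hsw]|].
        rewrite <- (Hsw (sub2 (sw p) z)). reflexivity.
      * split; [split; [now rewrite Hss|now rewrite Hsw]|].
        rewrite <- (Hsw (sub2 p z)). reflexivity.
    + exists D. rewrite Hss in HD. exact HD.
Qed.

(** * Restriction of a power series to an arc *)

(** A bound on the weighted l^1 norm, in terms of partial sums. It is a Banach algebra norm on power
    series, so sums, products and hence substitutions are controlled without loss of radius. *)
Definition ps_norm_le (tau K : R) (b : nat -> C) : Prop :=
  forall N, sum_n (fun n => Cmod (b n) * tau ^ n) N <= K.

Lemma sum_n_R_ge0 (g : nat -> R) (n : nat) : (forall n, 0 <= g n) -> 0 <= sum_n g n.
Proof.
  intros H. induction n as [|n IH]; [rewrite sum_O; apply H|]. rewrite sum_n_S_R. specialize (H (S n)). lra.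
Qed.

Lemma sum_n_R_le (g h : nat -> R) (n : nat) : (forall n, g n <= h n) -> sum_n g n <= sum_n h n.
Proof.
  intros H. induction n as [|n IH]; [rewrite !sum_O; apply H|]. rewrite !sum_n_S_R. specialize (H (S n)). lra.
Qed.

Lemma bounded_sums_is_series (g : nat -> R) (S : R) :
  (forall n, 0 <= g n) -> (forall N, sum_n g N <= S) -> exists L, is_series g L /\ L <= S.
Proof.
  intros H0 HS.
  destruct (ex_finite_lim_seq_incr (sum_n g) S) as [L HL].
  - intros n. rewrite sum_n_S_R. specialize (H0 (Datatypes.S n)). lra.
  - exact HS.
  - exists L. split; [exact HL|]. 
    apply (is_lim_seq_le (sum_n g) (fun _ => S) L S HS HL). apply is_lim_seq_const.
Qed.

Lemma ps_norm_term (tau K : R) (b : nat -> C) (n : nat) :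
  0 < tau -> ps_norm_le tau K b -> Cmod (b n) * tau ^ n <= K.
Proof.
  intros Ht H.
  assert (Hp : forall n, 0 <= Cmod (b n) * tau ^ n).
  { intros k. apply Rmult_le_pos; [apply Cmod_ge_0|apply pow_le; lra]. }
  specialize (H n). destruct n as [|n]; [rewrite sum_O in H; exact H|].
  rewrite sum_n_S_R in H. assert (h := sum_n_R_ge0 _ n Hp). lra.
Qed.

Lemma is_series_R_le (u v : nat -> R) (U V : R) :
  (forall n, 0 <= u n <= v n) -> is_series u U -> is_series v V -> U <= V.
Proof.
  intros H Hu Hv. rewrite <- (is_series_unique _ _ Hu), <- (is_series_unique _ _ Hv).
  apply Series_le; [exact H|now exists V].
Qed.

Lemma is_series_R_sum_n (u : nat -> nat -> R) (T : nat -> R) (N : nat) :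
  (forall n, is_series (fun k => u k n) (T n)) -> is_series (fun k => sum_n (u k) N) (sum_n T N).
Proof.
  intros H. induction N as [|N IH].
  - rewrite sum_O. eapply is_series_ext; [|apply (H 0%nat)]. intros k. now rewrite sum_O.
  - rewrite sum_n_S_R. eapply is_series_ext; [|apply (is_series_plus _ _ _ _ IH (H (S N)))].
    intros k. cbv beta. rewrite sum_n_S_R. reflexivity.
Qed.

(** Completeness of the normed algebra: an absolutely summable family of power series has a sum, and
    Fubini identifies its values. *)
Lemma ps_sum (tau : R) (A : nat -> nat -> C) (S : nat -> R) (T : R) :
  0 < tau -> (forall k, ps_norm_le tau (S k) (A k)) -> is_series S T ->
  exists Cs, ps_norm_le tau T Cs /\ forall t g l, 0 <= t <= tau ->
    (forall k, ser1 (A k) (RtoC t) (g k)) -> cser g l -> ser1 Cs (RtoC t) l.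
Proof.
  intros Ht HA HS.
  assert (Hterm : forall k n, 0 <= Cmod (A k n) * tau ^ n <= S k).
  { intros k n. split; [apply Rmult_le_pos; [apply Cmod_ge_0|apply pow_le; lra]|].
    now apply ps_norm_term. }
  assert (HTn : forall n, exists Tn, is_series (fun k => Cmod (A k n) * tau ^ n) Tn).
  { intros n. apply (ex_series_le (V := R_CompleteNormedModule)) with S; [|now exists T].
    intros k. unfold norm; simpl. unfold abs; simpl. rewrite Rabs_pos_eq; apply Hterm. }
  assert (HCn : forall n, exists Cn, cser (fun k => A k n) Cn).
  { intros n. assert (Hp : 0 < tau ^ n) by now apply pow_lt.
    apply cser_dominated with (fun k => / tau ^ n * S k).
    - intros k. apply Rmult_le_reg_r with (tau ^ n); [exact Hp|].
      replace (/ tau ^ n * S k * tau ^ n) with (S k) by (field; lra). apply Hterm.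
    - exists (/ tau ^ n * T). exact (is_series_scal (/ tau ^ n) S T HS). }
  destruct (choice_fun _ HCn) as [Cs HCs].
  destruct (choice_fun _ HTn) as [Tn HTs].
  exists Cs. split.
  - intros N. apply Rle_trans with (sum_n Tn N).
    + apply sum_n_R_le. intros n.
      assert (Hp : 0 <= tau ^ n) by (apply pow_le; lra).
      replace (Cmod (Cs n) * tau ^ n) with (Cmod (RtoC (tau ^ n)%R * Cs n)).
      2:{ rewrite Cmod_mult, Cmod_R, Rabs_pos_eq by exact Hp. ring. }
      eapply cser_norm_le; [|apply cser_scal, HCs|apply HTs].
      intros k. cbv beta. rewrite Cmod_mult, Cmod_R, Rabs_pos_eq by exact Hp. lra.
    + eapply is_series_R_le; [|apply (is_series_R_sum_n _ _ N HTs)|exact HS].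
      intros k. cbv beta. split; [apply sum_n_R_ge0; intros; apply Hterm|apply HA].
  - intros t g l Htt Hg Hl.
    assert (Hle : forall k n, 0 <= Cmod (A k n * RtoC t ^ n) <= Cmod (A k n) * tau ^ n).
    { intros k n. split; [apply Cmod_ge_0|]. rewrite Cmod_mult, Cmod_pow, Cmod_R, Rabs_pos_eq by lra.
      apply Rmult_le_compat_l; [apply Cmod_ge_0|]. apply pow_incr. lra. }
    assert (Hrow : forall k, exists L, is_series (fun n => Cmod (A k n * RtoC t ^ n)) L /\ L <= S k).
    { intros k. apply bounded_sums_is_series; [intros n; apply Hle|]. intros N.
      eapply Rle_trans; [apply sum_n_R_le; intros n; apply (Hle k n)|apply HA]. }
    destruct (choice_fun _ Hrow) as [Sr HSr].
    destruct (cser_fubini (fun k n => (A k n * RtoC t ^ n)%C) Sr g l) as [Q [HQ1 HQ2]].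
    + intros k. apply HSr.
    + apply (ex_series_le (V := R_CompleteNormedModule)) with S; [|now exists T].
      intros k. unfold norm; simpl. unfold abs; simpl. rewrite Rabs_pos_eq; [apply HSr|].
      eapply Rle_trans; [|apply (is_series_term_le _ _ 0%nat (fun n => Cmod_ge_0 _) (proj1 (HSr k)))].
      apply Cmod_ge_0.
    + exact Hg.
    + exact Hl.
    + eapply cser_ext; [|exact HQ2]. intros n. cbv beta.
      apply cser_unique with (fun k => (A k n * RtoC t ^ n)%C); [apply HQ1|].
      rewrite Cmult_comm. eapply cser_ext; [|apply cser_scal, (HCs n)]. intros k. cbv beta. ring.
Qed.

Lemma ps_scale (tau K : R) (k : C) (b : nat -> C) :
  ps_norm_le tau K b -> ps_norm_le tau (Cmod k * K) (fun n => (k * b n)%C).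
Proof.
  intros H N.
  assert (E : forall N, sum_n (fun n => Cmod (k * b n) * tau ^ n) N = Cmod k * sum_n (fun n => Cmod (b n) * tau ^ n) N :> R).
  { clear. induction N as [|N IH]; [rewrite !sum_O, Cmod_mult; ring|]. rewrite !sum_n_S_R, IH, Cmod_mult. ring. }
  rewrite E. apply Rmult_le_compat_l; [apply Cmod_ge_0|apply H].
Qed.

(** Prepared for products: the Cauchy product is the sum over k of a_k times the k-th shift of b. *)
Definition ps_shift (k : nat) (b : nat -> C) (n : nat) : C := if Nat.leb k n then b (n - k)%nat else RtoC 0.

Lemma ps_shift_norm (tau K : R) (k : nat) (b : nat -> C) :
  0 < tau -> ps_norm_le tau K b -> ps_norm_le tau (tau ^ k * K) (ps_shift k b).
Proof.
  intros Ht. revert b. induction k as [|k IH]; intros b H N.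
  - simpl. rewrite Rmult_1_l. eapply Rle_trans; [|apply (H N)]. apply sum_n_R_le. intros n.
    unfold ps_shift. simpl. rewrite Nat.sub_0_r. lra.
  - specialize (IH b H). destruct N as [|N].
    + rewrite sum_O. unfold ps_shift. simpl Nat.leb. cbv iota. rewrite Cmod_0, Rmult_0_l.
      apply Rmult_le_pos; [apply pow_le; lra|]. eapply Rle_trans; [|apply (H 0%nat)].
      apply sum_n_R_ge0. intros n. apply Rmult_le_pos; [apply Cmod_ge_0|apply pow_le; lra].
    + assert (E : forall N, sum_n (fun n => Cmod (ps_shift (S k) b n) * tau ^ n) (S N)
          = tau * sum_n (fun n => Cmod (ps_shift k b n) * tau ^ n) N :> R).
      { clear. induction N as [|N IHN].
        - rewrite sum_n_S_R, !sum_O. unfold ps_shift at 1. simpl Nat.leb. cbv iota. rewrite Cmod_0.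
          unfold ps_shift. simpl. ring.
        - rewrite sum_n_S_R, IHN, sum_n_S_R. unfold ps_shift. simpl. ring. }
      rewrite E. simpl. rewrite Rmult_assoc. apply Rmult_le_compat_l; [lra|apply IH].
Qed.

Lemma ps_shift_ser (k : nat) (b : nat -> C) (x l : C) :
  ser1 b x l -> ser1 (ps_shift k b) x (x ^ k * l)%C.
Proof.
  intros H. unfold ser1. apply (cser_shift_zero k).
  - intros j Hj. unfold ps_shift. destruct (Nat.leb_spec k j); [lia|ring].
  - eapply cser_ext; [|apply cser_scal, H]. intros n. cbv beta. unfold ps_shift.
    destruct (Nat.leb_spec k (k + n)); [|lia]. replace (k + n - k)%nat with n by lia.
    rewrite Cpow_add_r. ring.
Qed.

Lemma ps_mult (tau K L : R) (a b : nat -> C) :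
  0 < tau -> ps_norm_le tau K a -> ps_norm_le tau L b ->
  exists d, ps_norm_le tau (K * L) d /\ forall t x y, 0 <= t <= tau ->
    ser1 a (RtoC t) x -> ser1 b (RtoC t) y -> ser1 d (RtoC t) (x * y)%C.
Proof.
  intros Ht Ha Hb.
  assert (HL : 0 <= L).
  { eapply Rle_trans; [|apply (Hb 0%nat)]. rewrite sum_O. simpl. rewrite Rmult_1_r. apply Cmod_ge_0. }
  destruct (bounded_sums_is_series (fun n => Cmod (a n) * tau ^ n) K) as [K' [HK' HKK]].
  { intros n. apply Rmult_le_pos; [apply Cmod_ge_0|apply pow_le; lra]. }
  { exact Ha. }
  destruct (ps_sum tau (fun k n => (a k * ps_shift k b n)%C) (fun k => Cmod (a k) * (tau ^ k * L)) (K' * L) Ht) as [d [Hd Hser]].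
  - intros k. apply ps_scale. now apply ps_shift_norm.
  - rewrite Rmult_comm. eapply is_series_ext; [|apply (is_series_scal L _ _ HK')].
    intros n. unfold scal; simpl. unfold mult; simpl. ring.
  - exists d. split.
    + intros N. eapply Rle_trans; [apply Hd|]. now apply Rmult_le_compat_r.
    + intros t x y Htt Hx Hy. apply Hser with (fun k => (a k * RtoC t ^ k * y)%C); [exact Htt| |].
      * intros k. rewrite <- Cmult_assoc. unfold ser1.
        eapply cser_ext; [|apply cser_scal, (ps_shift_ser k b _ _ Hy)]. intros n. cbv beta. ring.
      * rewrite (Cmult_comm x). eapply cser_ext; [|apply (cser_scal y _ _ Hx)]. intros n. cbv beta. ring.
Qed.

Lemma ps_pow (tau K : R) (a : nat -> C) (i : nat) :
  0 < tau -> ps_norm_le tau K a ->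
  exists d, ps_norm_le tau (K ^ i) d /\ forall t x, 0 <= t <= tau ->
    ser1 a (RtoC t) x -> ser1 d (RtoC t) (x ^ i)%C.
Proof.
  intros Ht Ha. induction i as [|i [d [Hd Hs]]].
  - exists (fun n => if Nat.eqb n 0 then RtoC 1 else RtoC 0). split.
    + assert (E : forall N, sum_n (fun n => Cmod (if Nat.eqb n 0 then RtoC 1 else RtoC 0) * tau ^ n) N = 1 :> R).
      { induction N as [|N IH]; [rewrite sum_O; simpl; rewrite Cmod_1; ring|].
        rewrite sum_n_S_R, IH. simpl Nat.eqb. cbv iota. rewrite Cmod_0. ring. }
      intros N. rewrite E. simpl. lra.
    + intros t x _ _. simpl Cpow. unfold ser1. eapply cser_ext; [|apply (cser_single 0 (RtoC 1))].
      intros [|n]; simpl Nat.eqb; cbv iota; [simpl; ring|ring].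
  - destruct (ps_mult tau K (K ^ i) a d Ht Ha Hd) as [d' [Hd' Hs']]. exists d'. split; [exact Hd'|].
    intros t x Htt Hx. rewrite Cpow_S. apply Hs'; auto.
Qed.

(** When both inner series have norm at most r / 2, the monomial of index (i, j) contributes at most
    M 2^(-i-j), so the double sum converges in norm. *)
Theorem ser2_compose (r tau : R) (c : nat -> nat -> C) (f : C2 -> C) (d1 d2 : nat -> C) :
  0 < tau -> ser2_rep r c f -> ps_norm_le tau (r / 2) d1 -> ps_norm_le tau (r / 2) d2 ->
  exists b K, ps_norm_le tau K b /\ forall t x y, 0 <= t <= tau ->
    ser1 d1 (RtoC t) x -> ser1 d2 (RtoC t) y -> ser1 b (RtoC t) (f (x, y)).
Proof.
  intros Ht [Hr [[M HM] Hf]] H1 H2.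
  assert (Hij : forall i j, exists d, ps_norm_le tau (M * (/ 2) ^ i * (/ 2) ^ j) d /\ forall t x y, 0 <= t <= tau ->
    ser1 d1 (RtoC t) x -> ser1 d2 (RtoC t) y -> ser1 d (RtoC t) (c i j * (x ^ i * y ^ j))%C).
  { intros i j. destruct (ps_pow tau (r / 2) d1 i Ht H1) as [p1 [Hp1 Hs1]].
    destruct (ps_pow tau (r / 2) d2 j Ht H2) as [p2 [Hp2 Hs2]].
    destruct (ps_mult tau _ _ p1 p2 Ht Hp1 Hp2) as [p [Hp Hs]].
    exists (fun n => (c i j * p n)%C). split.
    - intros N. eapply Rle_trans; [apply (ps_scale tau _ (c i j) p Hp)|].
      rewrite <- pow_add. specialize (HM i j).
      replace (M * (/ 2) ^ i * (/ 2) ^ j) with (M * (/ 2) ^ (i + j)) by (rewrite pow_add; ring).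
      unfold Rdiv. rewrite Rpow_mult_distr, <- Rmult_assoc. apply Rmult_le_compat_r; [apply pow_le; lra|exact HM].
    - intros t x y Htt Hx Hy. unfold ser1. eapply cser_ext; [|apply cser_scal, (Hs t (x ^ i)%C (y ^ j)%C); auto].
      intros n. cbv beta. ring. }
  destruct (choice_fun _ (fun i => choice_fun _ (Hij i))) as [A HA].
  assert (Hi : forall i, exists d, ps_norm_le tau (2 * (M * (/ 2) ^ i)) d /\ forall t g l, 0 <= t <= tau ->
    (forall j, ser1 (A i j) (RtoC t) (g j)) -> cser g l -> ser1 d (RtoC t) l).
  { intros i. apply (ps_sum tau (A i) (fun j => M * (/ 2) ^ i * (/ 2) ^ j)); [exact Ht| |apply is_series_half].
    intros j. apply HA. }
  destruct (choice_fun _ Hi) as [E HE].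
  destruct (ps_sum tau E (fun i => 2 * M * (/ 2) ^ i) (2 * (2 * M)) Ht) as [b [Hb Hbs]].
  - intros i N. eapply Rle_trans; [apply HE|]. right. ring.
  - apply is_series_half.
  - exists b, (2 * (2 * M)). split; [exact Hb|]. intros t x y Htt Hx Hy.
    assert (Hxy : forall d z, ps_norm_le tau (r / 2) d -> ser1 d (RtoC t) z -> Cmod z < r).
    { intros d z Hd Hz. destruct (bounded_sums_is_series (fun n => Cmod (d n) * tau ^ n) (r / 2)) as [L [HL HLr]].
      - intros n. apply Rmult_le_pos; [apply Cmod_ge_0|apply pow_le; lra].
      - exact Hd.
      - apply Rle_lt_trans with L; [|lra]. eapply cser_norm_le; [|exact Hz|exact HL].
        intros n. cbv beta. rewrite Cmod_mult, Cmod_pow, Cmod_R, Rabs_pos_eq by lra.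
        apply Rmult_le_compat_l; [apply Cmod_ge_0|]. apply pow_incr. lra. }
    destruct (Hf x y (Hxy d1 x H1 Hx) (Hxy d2 y H2 Hy)) as [g [Hg Hl]].
    apply Hbs with g; [exact Htt| |exact Hl]. intros i.
    apply (proj2 (HE i)) with (fun j => (c i j * (x ^ i * y ^ j))%C); [exact Htt| |apply Hg].
    intros j. now apply HA.
Qed.

(** Because d_0 = 0, the norm is O(tau / rho) as tau tends to 0. *)
Lemma ps_norm_small (d : nat -> C) (rho eps : R) :
  0 < rho -> 0 < eps -> d 0%nat = RtoC 0 -> (exists l, ser1 d (RtoC rho) l) ->
  exists tau0, 0 < tau0 <= rho /\ forall tau, 0 < tau <= tau0 -> ps_norm_le tau eps d.
Proof.
  intros Hr He H0 [l Hl]. destruct (cser_bounded _ _ Hl) as [M [HM Hb]].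
  set (th := Rmin (/ 2) (eps / (4 * M))).
  assert (Hq : 0 < eps / (4 * M)) by (apply Rdiv_lt_0_compat; lra).
  assert (Hth : 0 < th) by (apply Rmin_glb_lt; lra).
  assert (i1 : th <= / 2) by apply Rmin_l. assert (i2 : th <= eps / (4 * M)) by apply Rmin_r.
  exists (th * rho). split; [split; [now apply Rmult_lt_0_compat|nra]|]. intros tau Htau N.
  apply Rle_trans with (2 * (2 * M * th)).
  2:{ apply Rle_trans with (4 * M * (eps / (4 * M))); [|right; field; lra].
      replace (2 * (2 * M * th)) with (4 * M * th) by ring. apply Rmult_le_compat_l; lra. }
  assert (Hpos : forall n, 0 <= 2 * M * th * (/ 2) ^ n).
  { intros n. apply Rmult_le_pos; [apply Rmult_le_pos; lra|apply pow_le; lra]. }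
  eapply Rle_trans; [|apply (is_series_nonneg_partial _ _ Hpos (is_series_half (2 * M * th)) N)].
  apply sum_n_R_le. intros n. assert (Hp := Hpos n).
  destruct n as [|n]; [rewrite H0, Cmod_0, Rmult_0_l; exact Hp|].
  specialize (Hb (S n)). rewrite Cmod_mult, Cmod_pow, Cmod_R, Rabs_pos_eq in Hb by lra.
  apply Rle_trans with (Cmod (d (S n)) * (th * rho) ^ S n).
  { apply Rmult_le_compat_l; [apply Cmod_ge_0|]. apply pow_incr. lra. }
  rewrite Rpow_mult_distr.
  replace (Cmod (d (S n)) * (th ^ S n * rho ^ S n)) with (th ^ S n * (Cmod (d (S n)) * rho ^ S n)) by ring.
  apply Rle_trans with (th * (/ 2) ^ n * M).
  - apply Rmult_le_compat; [apply pow_le; lra| | |exact Hb].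
    + apply Rmult_le_pos; [apply Cmod_ge_0|apply pow_le; lra].
    + simpl. apply Rmult_le_compat_l; [lra|]. apply pow_incr. lra.
  - simpl. right. field.
Qed.

(** * Asymptotic exponents *)

(** This says that log F(t) / log t tends to nu, with the positivity of F near 0 built in. The loss
    of eps absorbs constant factors. *)
Definition has_exponent (F : R -> R) (nu : R) : Prop :=
  forall eps, 0 < eps -> exists del, 0 < del < 1 /\ forall t, 0 < t < del ->
    Rpower t (nu + eps) <= F t <= Rpower t (nu - eps).

Lemma Rpower_pos (x y : R) : 0 < Rpower x y.
Proof. apply exp_pos. Qed.

Lemma Rpower_anti (t x y : R) : 0 < t < 1 -> x <= y -> Rpower t y <= Rpower t x.
Proof.
  intros Ht Hxy. unfold Rpower.
  assert (hl : ln t < 0) by (rewrite <- ln_1; apply ln_increasing; lra).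
  destruct (Req_dec x y) as [->|h]; [lra|]. apply Rlt_le, exp_increasing. nra.
Qed.

Lemma const_le_Rpower (K eps : R) : 0 < eps ->
  exists del, 0 < del < 1 /\ forall t, 0 < t < del -> K <= Rpower t (- eps).
Proof.
  intros He. set (L := Rmax K 1). assert (h1 : K <= L) by apply Rmax_l. assert (h2 : 1 <= L) by apply Rmax_r.
  exists (Rmin (/ 2) (exp (- ln L / eps))). assert (i1 := Rmin_l (/ 2) (exp (- ln L / eps))).
  assert (i2 := Rmin_r (/ 2) (exp (- ln L / eps))).
  split; [split; [apply Rmin_glb_lt; [lra|apply exp_pos]|lra]|]. intros t Ht.
  assert (hl : ln t < - ln L / eps).
  { rewrite <- (ln_exp (- ln L / eps)). apply ln_increasing; lra. }
  assert (hl2 : ln L <= - eps * ln t).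
  { assert (h : eps * ln t < eps * (- ln L / eps)) by now apply Rmult_lt_compat_l.
    replace (eps * (- ln L / eps)) with (- ln L) in h by (field; lra). lra. }
  eapply Rle_trans; [exact h1|]. unfold Rpower. rewrite <- (exp_ln L) at 1 by lra.
  destruct (Req_dec (ln L) (- eps * ln t)) as [->|h]; [lra|]. apply Rlt_le, exp_increasing. lra.
Qed.

Lemma has_exponent_near (F G : R -> R) (nu K d0 : R) :
  0 < K -> 0 < d0 -> has_exponent F nu ->
  (forall t, 0 < t < d0 -> F t <= K * G t /\ G t <= K * F t) -> has_exponent G nu.
Proof.
  intros HK Hd0 HF HFG eps He.
  destruct (HF (eps / 2) ltac:(lra)) as [d1 [Hd1 H1]].
  destruct (const_le_Rpower K (eps / 2) ltac:(lra)) as [d2 [Hd2 H2]].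
  exists (Rmin d0 (Rmin d1 d2)). assert (i1 := Rmin_l d0 (Rmin d1 d2)). assert (i2 := Rmin_r d0 (Rmin d1 d2)).
  assert (i3 := Rmin_l d1 d2). assert (i4 := Rmin_r d1 d2).
  split; [split; [repeat apply Rmin_glb_lt; lra|lra]|]. intros t Ht.
  destruct (HFG t ltac:(lra)) as [g1 g2]. destruct (H1 t ltac:(lra)) as [f1 f2]. specialize (H2 t ltac:(lra)).
  assert (p1 := Rpower_pos t (nu + eps)). assert (p2 := Rpower_pos t (nu - eps / 2)). split.
  - apply Rmult_le_reg_l with K; [exact HK|]. eapply Rle_trans; [|exact g1]. eapply Rle_trans; [|exact f1].
    replace (nu + eps / 2) with (- (eps / 2) + (nu + eps)) by field. rewrite (Rpower_plus (- (eps / 2))).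
    apply Rmult_le_compat_r; lra.
  - eapply Rle_trans; [exact g2|]. replace (nu - eps) with (- (eps / 2) + (nu - eps / 2)) by field.
    rewrite (Rpower_plus (- (eps / 2))). apply Rmult_le_compat; try lra. eapply Rle_trans; [|exact f1]. apply Rlt_le, Rpower_pos.
Qed.

Lemma has_exponent_power (x : R) : has_exponent (fun t => Rpower t x) x.
Proof.
  intros eps He. exists (/ 2). split; [lra|]. intros t Ht. split; apply Rpower_anti; lra.
Qed.

Lemma has_exponent_mult (F G : R -> R) (nu mu : R) :
  has_exponent F nu -> has_exponent G mu -> has_exponent (fun t => F t * G t) (nu + mu).
Proof.
  intros HF HG eps He.
  destruct (HF (eps / 2) ltac:(lra)) as [d1 [Hd1 H1]]. destruct (HG (eps / 2) ltac:(lra)) as [d2 [Hd2 H2]].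
  exists (Rmin d1 d2). assert (i3 := Rmin_l d1 d2). assert (i4 := Rmin_r d1 d2).
  split; [split; [apply Rmin_glb_lt; lra|lra]|]. intros t Ht.
  destruct (H1 t ltac:(lra)) as [f1 f2]. destruct (H2 t ltac:(lra)) as [g1 g2].
  replace (nu + mu + eps) with ((nu + eps / 2) + (mu + eps / 2)) by field.
  replace (nu + mu - eps) with ((nu - eps / 2) + (mu - eps / 2)) by field.
  rewrite (Rpower_plus (nu + eps / 2)), (Rpower_plus (nu - eps / 2)).
  assert (p1 := Rpower_pos t (nu + eps / 2)). assert (p2 := Rpower_pos t (mu + eps / 2)).
  split; apply Rmult_le_compat; lra.
Qed.

Lemma has_exponent_rprod (D : R -> nat -> R) (E : nat -> R) (n : nat) :
  (forall i, (i < n)%nat -> has_exponent (fun t => D t i) (E i)) ->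
  has_exponent (fun t => rprod (D t) n) (rsum E n).
Proof.
  induction n as [|n IH]; intros H; simpl.
  - intros eps He. exists (/ 2). split; [lra|]. intros t Ht.
    rewrite <- (Rpower_O t) by lra. split; apply Rpower_anti; lra.
  - apply (has_exponent_mult (fun t => rprod (D t) n) (fun t => D t n)); [apply IH; intros i Hi|]; apply H; lia.
Qed.

Lemma has_exponent_unique (F : R -> R) (nu mu : R) :
  has_exponent F nu -> has_exponent F mu -> nu = mu.
Proof.
  assert (H : forall nu mu, has_exponent F nu -> has_exponent F mu -> mu <= nu).
  { clear. intros nu mu H1 H2. apply Rnot_lt_le. intros Hlt. set (eps := (mu - nu) / 4).
    destruct (H1 eps ltac:(unfold eps; lra)) as [d1 [Hd1 h1]]. destruct (H2 eps ltac:(unfold eps; lra)) as [d2 [Hd2 h2]].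
    set (t := Rmin d1 d2 / 2). assert (i3 := Rmin_l d1 d2). assert (i4 := Rmin_r d1 d2).
    assert (i5 : 0 < Rmin d1 d2) by (apply Rmin_glb_lt; lra).
    destruct (h1 t ltac:(unfold t; lra)) as [f1 _]. destruct (h2 t ltac:(unfold t; lra)) as [_ g2].
    assert (hl : ln t < 0) by (rewrite <- ln_1; apply ln_increasing; unfold t; lra).
    assert (h : Rpower t (mu - eps) < Rpower t (nu + eps)).
    { unfold Rpower. apply exp_increasing. unfold eps. nra. }
    lra. }
  intros H1 H2. apply Rle_antisym; apply H; assumption.
Qed.

(** The lower bound has two cases. If c <= b, it comes from d <= K D. If b < c, it comes from sg <=
    K (D + d), where the term in d is negligible against sg. *)
Lemma has_exponent_min (d sg D : R -> R) (c b K d0 : R) :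
  0 < K -> 0 < d0 -> has_exponent d c -> has_exponent sg b ->
  (forall t, 0 < t < d0 -> d t <= K * D t /\ D t <= K * (d t + sg t) /\ sg t <= K * (D t + d t)) ->
  has_exponent D (Rmin c b).
Proof.
  intros HK Hd0 Hd Hs H eps He.
  assert (m1 := Rmin_l c b). assert (m2 := Rmin_r c b).
  (* The gap c - b within which K d becomes negligible; when c <= b it is given the harmless value
     eps. *)
  set (gam := if Rle_dec c b then eps else c - b).
  assert (Hgam : 0 < gam) by (unfold gam; destruct (Rle_dec c b); lra).
  set (e1 := Rmin (eps / 2) (gam / 4)).
  assert (He1 : 0 < e1) by (apply Rmin_glb_lt; lra).
  assert (j1 : e1 <= eps / 2) by apply Rmin_l. assert (j2 : e1 <= gam / 4) by apply Rmin_r.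
  destruct (Hd e1 He1) as [d1 [Hd1 h1]]. destruct (Hs e1 He1) as [d2 [Hd2 h2]].
  destruct (const_le_Rpower (2 * K) (eps / 2) ltac:(lra)) as [d3 [Hd3 h3]].
  destruct (const_le_Rpower (2 * K) (gam / 2) ltac:(lra)) as [d4 [Hd4 h4]].
  exists (Rmin (Rmin d0 d1) (Rmin d2 (Rmin d3 d4))).
  assert (g0 : Rmin (Rmin d0 d1) (Rmin d2 (Rmin d3 d4)) <= d0) by rmin_le.
  assert (g1 : Rmin (Rmin d0 d1) (Rmin d2 (Rmin d3 d4)) <= d1) by rmin_le.
  assert (g2 : Rmin (Rmin d0 d1) (Rmin d2 (Rmin d3 d4)) <= d2) by rmin_le.
  assert (g3 : Rmin (Rmin d0 d1) (Rmin d2 (Rmin d3 d4)) <= d3) by rmin_le.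
  assert (g4 : Rmin (Rmin d0 d1) (Rmin d2 (Rmin d3 d4)) <= d4) by rmin_le.
  split; [split; [repeat apply Rmin_glb_lt; lra|lra]|]. intros t Ht.
  destruct (H t ltac:(lra)) as [k1 [k2 k3]].
  destruct (h1 t ltac:(lra)) as [a1 a2]. destruct (h2 t ltac:(lra)) as [b1 b2].
  specialize (h3 t ltac:(lra)). specialize (h4 t ltac:(lra)). split.
  - assert (Hlow : Rpower t (Rmin c b + e1) <= 2 * K * D t).
    { destruct (Rle_dec c b) as [hc|hc].
      - rewrite Rmin_left by exact hc. assert (p := Rpower_pos t (c + e1)).
        assert (0 <= K * D t) by lra. lra.
      - rewrite Rmin_right in * by lra. unfold gam in *.
        assert (p := Rpower_pos t (b + e1)).
        assert (q1 : 2 * K * Rpower t (c - e1) <= Rpower t (b + e1)).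
        { apply Rle_trans with (Rpower t (- ((c - b) / 2)) * Rpower t (c - e1)).
          - apply Rmult_le_compat_r; [apply Rlt_le, Rpower_pos|exact h4].
          - rewrite <- Rpower_plus. apply Rpower_anti; lra. }
        assert (K * d t <= K * Rpower t (c - e1)) by (apply Rmult_le_compat_l; lra). lra. }
    apply Rmult_le_reg_l with (2 * K); [lra|]. eapply Rle_trans; [|exact Hlow].
    apply Rle_trans with (Rpower t (- (eps / 2)) * Rpower t (Rmin c b + eps)).
    + apply Rmult_le_compat_r; [apply Rlt_le, Rpower_pos|exact h3].
    + rewrite <- Rpower_plus. apply Rpower_anti; lra.
  - assert (q1 : Rpower t (c - e1) <= Rpower t (Rmin c b - eps / 2)) by (apply Rpower_anti; lra).
    assert (q2 : Rpower t (b - e1) <= Rpower t (Rmin c b - eps / 2)) by (apply Rpower_anti; lra).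
    assert (q3 : K * (d t + sg t) <= K * (2 * Rpower t (Rmin c b - eps / 2))) by (apply Rmult_le_compat_l; lra).
    apply Rle_trans with (2 * K * Rpower t (Rmin c b - eps / 2)); [lra|].
    replace (Rmin c b - eps) with (- (eps / 2) + (Rmin c b - eps / 2)) by field. rewrite (Rpower_plus (- (eps / 2))).
    apply Rmult_le_compat_r; [apply Rlt_le, Rpower_pos|exact h3].
Qed.

Lemma contact_exponent (f : C2 -> C) (alpha : R -> C2) (c : R) :
  contact_eq f alpha c -> exists del, 0 < del /\
    (forall t, 0 < t < del ->
       dist_set (alpha t) (Xr f (norm2 (alpha t))) = Finite (real (dist_set (alpha t) (Xr f (norm2 (alpha t))))) /\
       0 < real (dist_set (alpha t) (Xr f (norm2 (alpha t))))) /\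
    has_exponent (fun t => real (dist_set (alpha t) (Xr f (norm2 (alpha t))))) c.
Proof.
  intros [[del [Hdel Hfin]] Hlim]. exists del. split; [exact Hdel|].
  set (dd := fun t => real (dist_set (alpha t) (Xr f (norm2 (alpha t))))) in *.
  assert (Hd : forall t, 0 < t < del -> dist_set (alpha t) (Xr f (norm2 (alpha t))) = Finite (dd t) /\ 0 < dd t).
  { intros t Ht. destruct (Hfin t Ht) as [h1 h2]. unfold dd.
    destruct (dist_set (alpha t) (Xr f (norm2 (alpha t)))) as [x| |]; simpl in *; [now split|contradiction|contradiction]. }
  split; [exact Hd|]. intros eps He.
  assert (Hloc : locally c (fun y => Rabs (y - c) < eps)).
  { exists (mkposreal eps He). intros y Hy. exact Hy. }
  destruct (Hlim _ Hloc) as [d1 H1].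
  exists (Rmin (Rmin del d1) (/ 2)).
  assert (g1 : Rmin (Rmin del d1) (/ 2) <= del) by rmin_le.
  assert (g2 : Rmin (Rmin del d1) (/ 2) <= d1) by rmin_le.
  assert (g3 := Rmin_r (Rmin del d1) (/ 2)). assert (hd1 := cond_pos d1).
  split; [split; [repeat apply Rmin_glb_lt; lra|lra]|]. intros t Ht.
  assert (Hb : ball 0 d1 t).
  { change (Rabs (t - 0) < d1). rewrite Rminus_0_r, Rabs_pos_eq; lra. }
  assert (h := H1 t Hb ltac:(lra)). cbv beta in h. fold (dd t) in h. apply Rabs_def2 in h.
  destruct (Hd t ltac:(lra)) as [_ hp].
  assert (hl : ln t < 0) by (rewrite <- ln_1; apply ln_increasing; lra).
  assert (E : ln (dd t) = ln (dd t) / ln t * ln t) by (field; lra).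
  unfold Rpower. rewrite <- (exp_ln (dd t)) by exact hp. rewrite E.
  split; apply Rlt_le, exp_increasing; nra.
Qed.

(** * Summation of the branch exponents *)

Lemma rsum_ext (g h : nat -> R) (n : nat) : (forall i, (i < n)%nat -> g i = h i) -> rsum g n = rsum h n.
Proof.
  induction n as [|n IH]; intros H; simpl; [reflexivity|]. rewrite IH, H by (intros; try apply H; lia). reflexivity.
Qed.

Lemma rsum_plus (g h : nat -> R) (n : nat) : rsum (fun i => g i + h i) n = rsum g n + rsum h n.
Proof. induction n as [|n IH]; simpl; [ring|]. rewrite IH. ring. Qed.

Lemma rsum_scal (x : R) (g : nat -> R) (n : nat) : rsum (fun i => g i * x) n = rsum g n * x.
Proof. induction n as [|n IH]; simpl; [ring|]. rewrite IH. ring. Qed.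

Lemma rsum_zero (n : nat) : rsum (fun _ => 0) n = 0.
Proof. induction n as [|n IH]; simpl; [reflexivity|]. rewrite IH. ring. Qed.

Lemma rsum_swap (g : nat -> nat -> R) (n k : nat) :
  rsum (fun i => rsum (g i) k) n = rsum (fun l => rsum (fun i => g i l) n) k.
Proof.
  induction k as [|k IH]; simpl; [apply rsum_zero|]. rewrite <- IH, <- rsum_plus. reflexivity.
Qed.

Lemma rsum_app (g : nat -> R) (n k : nat) : rsum g (n + k) = rsum g n + rsum (fun j => g (n + j)%nat) k.
Proof.
  induction k as [|k IH]; [rewrite Nat.add_0_r; simpl; ring|]. rewrite Nat.add_succ_r. simpl. rewrite IH. ring.
Qed.

Lemma rsum_single (x : R) (l k : nat) : (l < k)%nat -> rsum (fun i => if Nat.eqb i l then x else 0) k = x.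
Proof.
  intros H. induction k as [|k IH]; [lia|]. simpl. destruct (Nat.eqb_spec k l) as [->|E].
  - rewrite (rsum_ext _ (fun _ => 0)); [rewrite rsum_zero; ring|].
    intros i Hi. destruct (Nat.eqb_spec i l); [lia|reflexivity].
  - rewrite IH by lia. ring.
Qed.

Definition divides_ind (m x : nat) : R := if Nat.eqb (x mod m) 0 then 1 else 0.

Lemma divides_ind_true (m x : nat) : Nat.divide m x -> divides_ind m x = 1.
Proof. intros H. unfold divides_ind. apply Nat.Lcm0.mod_divide in H. now rewrite H. Qed.

Lemma divides_ind_false (m x : nat) : ~ Nat.divide m x -> divides_ind m x = 0.
Proof.
  intros H. unfold divides_ind. destruct (Nat.eqb_spec (x mod m) 0) as [E|E]; [|reflexivity].
  exfalso. apply H. now apply Nat.Lcm0.mod_divide.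
Qed.

Lemma count_multiples (g n : nat) : (1 <= g)%nat -> rsum (divides_ind g) (n * g) = INR n.
Proof.
  intros Hg. induction n as [|n IH]; [reflexivity|].
  replace (S n * g)%nat with (n * g + g)%nat by lia. rewrite rsum_app, IH, S_INR. f_equal.
  rewrite (rsum_ext _ (fun i => if Nat.eqb i 0 then 1 else 0)); [apply rsum_single; lia|].
  intros i Hi. destruct (Nat.eqb_spec i 0) as [->|E].
  - apply divides_ind_true. exists n. lia.
  - apply divides_ind_false. intros [k Hk]. assert (i = (k - n) * g)%nat by nia.
    destruct (k - n)%nat as [|z]; [lia|nia].
Qed.

(** With m = g e the condition m | i e becomes g | i, and there are e multiples of g below g e. *)
Lemma count_level (m e : nat) : (1 <= m)%nat -> Nat.divide e m ->
  rsum (fun i => divides_ind m (i * e)) m = INR e.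
Proof.
  intros Hm [g Eg]. assert (He : (1 <= e)%nat) by nia. assert (Hg : (1 <= g)%nat) by nia.
  rewrite <- (count_multiples g e Hg). replace (e * g)%nat with m by lia.
  apply rsum_ext. intros i Hi.
  destruct (classic (Nat.divide g i)) as [h|h].
  - rewrite (divides_ind_true g i h). apply divides_ind_true. destruct h as [k ->]. exists k. nia.
  - rewrite (divides_ind_false g i h). apply divides_ind_false. intros [k Hk]. apply h. exists k. nia.
Qed.

(** For i at level l0 the indicator of m | i e_l is 1 up to l = l0 and 0 afterwards, so the
    difference of two consecutive indicators picks out l0. Each exponent thus becomes an indicator
    times c plus a combination of such differences, and summing over i first turns the indicators
    into the numbers e_l. The index 0 acts as an infinite level and yields c. *)
Lemma branch_exponent_sum (m : nat) (a : nat -> C) (s : nat) (beta e : nat -> nat) (B : nat -> nat) (c : R) (k : nat) :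
  (1 <= m)%nat -> puiseux_pairs m a s beta e ->
  (forall i, (0 < i < m)%nat -> exists l, at_level m s e i l /\ B i = beta (S l)) ->
  (k <= s)%nat -> INR (beta k) <= INR m * c -> ((k < s)%nat -> INR m * c < INR (beta (S k))) ->
  rsum (fun i => if Nat.eqb i 0 then c else Rmin c (INR (B i) / INR m)) m =
  INR (e k) * c + rsum (fun i => (INR (e i) - INR (e (S i))) * (INR (beta (S i)) / INR m)) k.
Proof.
  intros Hm Hp HB Hk Hc1 Hc2.
  assert (HmR : 0 < INR m) by (apply lt_0_INR; lia).
  rewrite (rsum_ext _ (fun i => divides_ind m (i * e k) * c +
    rsum (fun l => (divides_ind m (i * e l) - divides_ind m (i * e (S l))) * (INR (beta (S l)) / INR m)) k)).
  - rewrite rsum_plus, rsum_scal, rsum_swap, (count_level m (e k) Hm (e_divides_m m a s beta e Hm Hp k Hk)). f_equal.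
    apply rsum_ext. intros l Hl. rewrite rsum_scal. f_equal.
    rewrite (rsum_ext _ (fun i => divides_ind m (i * e l) + divides_ind m (i * e (S l)) * -1)) by (intros; ring).
    rewrite rsum_plus, rsum_scal, !count_level by (try exact Hm; apply (e_divides_m m a s beta e Hm Hp); lia). ring.
  - intros i Hi. destruct (Nat.eqb_spec i 0) as [->|Ei].
    + rewrite (rsum_ext _ (fun _ => 0)).
      * rewrite rsum_zero, divides_ind_true by (apply Nat.divide_0_r). ring.
      * intros l _. rewrite !divides_ind_true by (apply Nat.divide_0_r). ring.
    + destruct (HB i ltac:(lia)) as [l0 [Hl0 ->]].
      assert (Hord := fun j Hj => level_order m a s beta e Hm Hp i l0 j Hl0 Hj).
      assert (Hl0s : (l0 < s)%nat) by apply Hl0.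
      (* For k <= l0, beta_(l0+1) >= beta_(k+1) > m c and the minimum is c; otherwise beta_(l0+1) <=
         beta_k <= m c and the minimum is beta_(l0+1) / m. *)
      destruct (le_lt_dec k l0) as [h|h].
      * rewrite (rsum_ext _ (fun _ => 0)).
        -- rewrite rsum_zero, divides_ind_true by (apply Hord; lia). rewrite Rmin_left; [ring|].
           specialize (Hc2 ltac:(lia)).
           assert (hb : INR (beta (S k)) <= INR (beta (S l0))) by (apply le_INR, (beta_mono m a s beta e Hm Hp); lia).
           apply Rmult_le_reg_l with (INR m); [exact HmR|]. replace (INR m * (INR (beta (S l0)) / INR m)) with (INR (beta (S l0))) by (field; lra). lra.
        -- intros l Hl. rewrite !divides_ind_true by (apply Hord; lia). ring.
      * rewrite (rsum_ext _ (fun l => if Nat.eqb l l0 then INR (beta (S l0)) / INR m else 0)).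
        -- rewrite rsum_single by lia. rewrite divides_ind_false by (rewrite Hord; lia).
           rewrite Rmin_right; [ring|].
           assert (hb : INR (beta (S l0)) <= INR (beta k)).
           { destruct k as [|k']; [lia|]. apply le_INR, (beta_mono m a s beta e Hm Hp); lia. }
           apply Rmult_le_reg_l with (INR m); [exact HmR|]. replace (INR m * (INR (beta (S l0)) / INR m)) with (INR (beta (S l0))) by (field; lra). lra.
        -- intros l Hl. destruct (Nat.eqb_spec l l0) as [->|E].
           ++ rewrite divides_ind_true, divides_ind_false by (rewrite Hord; lia). ring.
           ++ destruct (le_lt_dec l l0) as [g|g].
              ** rewrite !divides_ind_true by (apply Hord; lia). ring.
              ** rewrite !divides_ind_false by (rewrite Hord; lia). ring.
Qed.

(** * The exponent of f along the arc *)

Lemma Rpower_root_pow (P : R) (m n : nat) : (1 <= m)%nat -> 0 < P ->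
  Rpower P (/ INR m) ^ n = Rpower P (INR n / INR m).
Proof.
  intros Hm HP. rewrite <- Rpower_pow, Rpower_mult by apply Rpower_pos. f_equal. unfold Rdiv. ring.
Qed.

(** The branch distances are taken at each t with r = |alpha t|^(1/m); D_i is then governed by dd,
    of exponent c, and by r^(B_i), of exponent B_i / m. *)
Theorem order_exponent (f : C2 -> C) (m : nat) (Phi : C2 -> C2) (a : nat -> C)
  (s : nat) (beta e : nat -> nat) (alpha : R -> C2) (c : R) (k : nat) :
  (1 <= m)%nat -> germ_mult f m -> puiseux_param f Phi m a -> puiseux_pairs m a s beta e ->
  (exists a b eps, 0 < a < b /\ 0 < eps /\ forall t, 0 <= t < eps -> a * t <= norm2 (alpha t) <= b * t) ->
  contact_eq f alpha c -> (k <= s)%nat -> INR (beta k) <= INR m * c ->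
  ((k < s)%nat -> INR m * c < INR (beta (S k))) ->
  has_exponent (fun t => Cmod (f (alpha t)))
    (INR (e k) * c + rsum (fun i => (INR (e i) - INR (e (S i))) * (INR (beta (S i)) / INR m)) k).
Proof.
  intros Hm Hmult Hparam Hp [a0 [b0 [e0 [Hab [He0 Hnorm]]]]] Hcont Hk Hc1 Hc2.
  destruct (branch_distances_of_param f m Phi a s beta e Hm Hmult Hparam Hp) as [B [dg [K [HB [Hdg [HK Hbd]]]]]].
  destruct (contact_exponent f alpha c Hcont) as [d1 [Hd1 [Hdist Hexp]]].
  set (dd := fun t => real (dist_set (alpha t) (Xr f (norm2 (alpha t))))) in *.
  set (P := fun t => norm2 (alpha t)).
  set (del := Rmin (Rmin e0 d1) (dg / b0)).
  assert (Hdb : 0 < dg / b0) by (apply Rdiv_lt_0_compat; lra).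
  assert (Hdel : 0 < del) by (repeat apply Rmin_glb_lt; lra).
  assert (g1 : del <= e0) by rmin_le.
  assert (g2 : del <= d1) by rmin_le.
  assert (g3 : del <= dg / b0) by apply Rmin_r.
  assert (HP : forall t, 0 < t < del -> a0 * t <= P t <= b0 * t /\ 0 < P t < dg).
  { intros t Ht. assert (h := Hnorm t ltac:(lra)). fold (P t) in h.
    assert (h1 : 0 < a0 * t) by (apply Rmult_lt_0_compat; lra).
    assert (h2 : b0 * t < b0 * (dg / b0)) by (apply Rmult_lt_compat_l; lra).
    replace (b0 * (dg / b0)) with dg in h2 by (field; lra). split; [exact h|lra]. }
  assert (Hex : forall t, exists D : nat -> R, 0 < t < del ->
    (forall i, (i < m)%nat -> 0 <= D i /\ dd t <= K * D i /\
       D i <= K * (dd t + (if Nat.eqb i 0 then 0 else Rpower (P t) (INR (B i) / INR m))) /\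
       ((0 < i)%nat -> Rpower (P t) (INR (B i) / INR m) <= K * (D i + dd t))) /\
    rprod D m <= K * Cmod (f (alpha t)) /\ Cmod (f (alpha t)) <= K * rprod D m).
  { intros t. destruct (classic (0 < t < del)) as [Ht|Ht]; [|exists (fun _ => 0); contradiction].
    destruct (HP t Ht) as [_ hP]. destruct (Hdist t ltac:(lra)) as [E hd].
    destruct (Hbd (alpha t) (dd t) (Rpower (P t) (/ INR m)) hP E hd (Rpower_pos _ _)) as [D [HD1 HD2]].
    { rewrite Rpower_root_pow by (exact Hm || apply hP). unfold Rdiv. rewrite Rinv_r by (apply not_0_INR; lia).
      apply Rpower_1. destruct hP as [hP _]. exact hP. }
    exists D. intros _. split; [|exact HD2]. intros i Hi. specialize (HD1 i Hi).
    rewrite Rpower_root_pow in HD1 by (exact Hm || apply hP). exact HD1. }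
  destruct (choice_fun _ Hex) as [D HD].
  rewrite <- (branch_exponent_sum m a s beta e B c k Hm Hp HB Hk Hc1 Hc2).
  apply (has_exponent_near (fun t => rprod (D t) m) _ _ K del HK Hdel).
  2:{ intros t Ht. apply HD, Ht. }
  apply has_exponent_rprod. intros i Hi. destruct (Nat.eqb_spec i 0) as [Ei|Ei].
  - apply (has_exponent_near dd _ _ K del HK Hdel); [exact Hexp|].
    intros t Ht. destruct (HD t Ht) as [h _]. destruct (h i Hi) as [_ [h1 [h2 _]]].
    rewrite Ei, Nat.eqb_refl, Rplus_0_r in h2. rewrite Ei in *. split; assumption.
  - set (x := INR (B i) / INR m) in *.
    assert (Hx : 0 <= x).
    { apply Rmult_le_pos; [apply pos_INR|]. apply Rlt_le, Rinv_0_lt_compat, lt_0_INR. lia. }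
    apply (has_exponent_min dd (fun t => Rpower (P t) x) _ c x K del HK Hdel Hexp).
    (* By the definition of an analytic arc |alpha t| lies between a0 t and b0 t, so its powers have
       the same exponents as those of t. *)
    + apply (has_exponent_near (fun t => Rpower t x) _ _ (Rpower b0 x + / Rpower a0 x) del).
      * assert (h1 := Rpower_pos b0 x). assert (h2 := Rinv_0_lt_compat _ (Rpower_pos a0 x)). lra.
      * exact Hdel.
      * apply has_exponent_power.
      * intros t Ht. destruct (HP t Ht) as [[h1 h2] h3].
        assert (q1 := Rpower_pos b0 x). assert (q2 := Rinv_0_lt_compat _ (Rpower_pos a0 x)).
        assert (q3 := Rpower_pos t x). assert (q4 := Rpower_pos (P t) x).
        assert (k1 : Rpower (P t) x <= Rpower b0 x * Rpower t x).
        { rewrite Rpower_mult_distr by lra. apply Rle_Rpower_l; lra. }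
        assert (k2 : Rpower a0 x * Rpower t x <= Rpower (P t) x).
        { rewrite Rpower_mult_distr by lra. apply Rle_Rpower_l; [exact Hx|]. split; [apply Rmult_lt_0_compat; lra|exact h1]. }
        split.
        -- apply Rle_trans with (/ Rpower a0 x * Rpower (P t) x).
           ++ apply Rmult_le_reg_l with (Rpower a0 x); [apply Rpower_pos|].
              rewrite <- Rmult_assoc, Rinv_r, Rmult_1_l by (apply Rgt_not_eq, Rpower_pos). exact k2.
           ++ apply Rmult_le_compat_r; lra.
        -- eapply Rle_trans; [exact k1|]. apply Rmult_le_compat_r; lra.
    + intros t Ht. destruct (HD t Ht) as [h _]. destruct (h i Hi) as [_ [h1 [h2 h3]]].
      specialize (h3 ltac:(lia)). destruct (Nat.eqb_spec i 0); [contradiction|]. split; [exact h1|]. split; assumption.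
Qed.

(** * From the exponent to the order *)

Lemma ps_norm_coef_bound (tau K : R) (b : nat -> C) : 0 < tau -> ps_norm_le tau K b -> coef_bound K tau b.
Proof. intros Ht H n. now apply ps_norm_term. Qed.

Lemma first_nonzero (b : nat -> C) : (exists n, b n <> RtoC 0) ->
  exists n, b n <> RtoC 0 /\ forall j, (j < n)%nat -> b j = RtoC 0.
Proof.
  intros [n Hn]. revert Hn. induction n as [n IH] using lt_wf_ind. intros Hn.
  destruct (classic (exists j, (j < n)%nat /\ b j <> RtoC 0)) as [[j [Hj Hbj]]|Hno].
  - exact (IH j Hj Hbj).
  - exists n. split; [exact Hn|]. intros j Hj. apply NNPP. intros Hbj. apply Hno. now exists j.
Qed.

(** In the variable t^(1/e) the function f along alpha is a power series. If n0 is the index of its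
    first nonzero coefficient, n0 / e is an exponent, equal to nu by uniqueness; the unit is the
    series divided by its leading power. *)
Lemma order_along_of_exponent (f : C2 -> C) (alpha : R -> C2) (nu : R) :
  analytic0 f -> analytic_arc alpha -> has_exponent (fun t => Cmod (f (alpha t))) nu -> order_along f alpha nu.
Proof.
  intros [r [c Hrep]] [Ha0 [_ [[e [d1 [d2 [rho [He [Hrho Hser]]]]]] _]]] Hexp.
  assert (Hr : 0 < r) by apply Hrep.
  assert (Hz : forall d z, ser1 d (RtoC 0) z -> d 0%nat = z).
  { intros d z H. symmetry. apply cser_unique with (fun n => (d n * 0 ^ n)%C); [exact H|].
    eapply cser_ext; [|apply (cser_single 0)]. intros [|n]; simpl Nat.eqb; cbv iota beta; [simpl; ring|].
    rewrite Cpow_S. ring. }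
  assert (E0 : 0 ^ e = 0) by (apply pow_i; lia).
  destruct (Hser 0 ltac:(lra)) as [h1 h2]. rewrite E0, Ha0 in h1, h2.
  apply Hz in h1, h2. simpl in h1, h2.
  destruct (Hser (rho / 2) ltac:(lra)) as [s1 s2].
  destruct (ps_norm_small d1 (rho / 2) (r / 2) ltac:(lra) ltac:(lra) h1 (ex_intro _ _ s1)) as [t1 [Ht1 H1]].
  destruct (ps_norm_small d2 (rho / 2) (r / 2) ltac:(lra) ltac:(lra) h2 (ex_intro _ _ s2)) as [t2 [Ht2 H2]].
  set (tau := Rmin t1 t2). assert (Htau : 0 < tau) by (apply Rmin_glb_lt; lra).
  assert (j1 : tau <= t1) by apply Rmin_l. assert (j2 : tau <= t2) by apply Rmin_r.
  destruct (ser2_compose r tau c f d1 d2 Htau Hrep (H1 tau ltac:(lra)) (H2 tau ltac:(lra))) as [b [K [Hb Hbs]]].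
  assert (Hcb := ps_norm_coef_bound tau K b Htau Hb).
  assert (HeR : 0 < INR e) by (apply lt_0_INR; lia).
  assert (Hfa : forall t, 0 < t < tau ^ e -> 0 < Rpower t (/ INR e) < tau /\
     ser1 b (RtoC (Rpower t (/ INR e))) (f (alpha t))).
  { intros t Ht. assert (Eroot : Rpower t (/ INR e) ^ e = t).
    { rewrite Rpower_root_pow by (try exact He; lra). unfold Rdiv. rewrite Rinv_r by lra. apply Rpower_1. lra. }
    assert (hlt : Rpower t (/ INR e) < tau) by (apply pow_lt_inv with e; [lra|rewrite Eroot; lra]).
    assert (hp := Rpower_pos t (/ INR e)). split; [lra|].
    destruct (Hser (Rpower t (/ INR e)) ltac:(lra)) as [k1 k2]. rewrite Eroot in k1, k2.
    rewrite (surjective_pairing (alpha t)). apply Hbs; [lra|exact k1|exact k2]. }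
  assert (Htaue : 0 < tau ^ e) by now apply pow_lt.
  (* If all coefficients vanished, so would f along the arc, against the positive lower bound in
     [has_exponent]. *)
  assert (Hne : exists n, b n <> RtoC 0).
  { apply NNPP. intros Hno. destruct (Hexp 1 ltac:(lra)) as [del [Hdel Hx]].
    set (t := Rmin del (tau ^ e) / 2). assert (i1 := Rmin_l del (tau ^ e)). assert (i2 := Rmin_r del (tau ^ e)).
    assert (i3 : 0 < Rmin del (tau ^ e)) by (apply Rmin_glb_lt; lra).
    destruct (Hfa t ltac:(unfold t; lra)) as [_ hs]. destruct (Hx t ltac:(unfold t; lra)) as [hx _].
    assert (E : f (alpha t) = RtoC 0).
    { apply cser_unique with (fun n => (b n * RtoC (Rpower t (/ INR e)) ^ n)%C); [exact hs|].
      eapply cser_ext; [|apply cser_zero]. intros n. cbv beta.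
      replace (b n) with (RtoC 0); [ring|]. symmetry. apply NNPP. intros Hn. apply Hno. now exists n. }
    rewrite E, Cmod_0 in hx. assert (hp := Rpower_pos t (nu + 1)). lra. }
  destruct (first_nonzero b Hne) as [n0 [Hn0 Hlow]].
  assert (Enu : nu = INR n0 / INR e).
  { apply (has_exponent_unique (fun t => Cmod (f (alpha t)))); [exact Hexp|].
    destruct (ser1_order K tau b n0 Htau Hcb Hlow Hn0) as [d [L [Hd [HL Hord]]]].
    apply (has_exponent_near (fun t => Rpower t (INR n0 / INR e)) _ _ L (Rmin (tau ^ e) (d ^ e))).
    - exact HL.
    - apply Rmin_glb_lt; [exact Htaue|now apply pow_lt].
    - apply has_exponent_power.
    - intros t Ht. assert (i1 := Rmin_l (tau ^ e) (d ^ e)). assert (i2 := Rmin_r (tau ^ e) (d ^ e)).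
      destruct (Hfa t ltac:(lra)) as [hp hs].
      assert (Em : Cmod (RtoC (Rpower t (/ INR e))) = Rpower t (/ INR e)) by (rewrite Cmod_R, Rabs_pos_eq; lra).
      rewrite <- (Rpower_root_pow t e n0) by (try exact He; lra). rewrite <- Em. apply Hord; [|exact hs].
      rewrite Em. apply pow_lt_inv with e; [lra|]. rewrite Rpower_root_pow by (try exact He; lra).
      unfold Rdiv. rewrite Rinv_r, Rpower_1; lra. }
  exists (fun t => (f (alpha t) / RtoC (Rpower t nu))%C). split.
  - exists 1%nat, e, (fun j => b (n0 + j)%nat), (tau ^ e).
    split; [lia|]. split; [lia|]. split; [reflexivity|]. split; [exact Htaue|].
    split; [now rewrite Nat.add_0_r|]. intros t Ht. destruct (Hfa t Ht) as [hp hs].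
    replace (INR 1 / INR e) with (/ INR e) by (simpl; field; lra).
    replace (RtoC (Rpower t nu)) with (RtoC (Rpower t (/ INR e)) ^ n0)%C.
    + apply ser1_factor; [exact Hlow| |exact hs]. intros E. apply RtoC_inj in E. lra.
    + rewrite <- RtoC_pow, Rpower_root_pow by (try exact He; lra). now rewrite Enu.
  - exists 1. split; [lra|]. intros t Ht. field. intros E. apply RtoC_inj in E.
    assert (hp := Rpower_pos t nu). lra.
Qed.

(** The value beta_(s+1) = +infinity is encoded by the guard k < s, and alpha is any analytic arc
    that parameterizes the half-branch. The other form of the formula is an Abel summation of this
    one, by beta_0 = 0. *)
Theorem mainTheorem2
  (f : C2 -> C) (m : nat) (Phi : C2 -> C2) (a : nat -> C)
  (s : nat) (beta e : nat -> nat)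
  (gamma alpha : R -> C2) (c : R) (k : nat) :
  irreducible_germ f ->
  germ_mult f m ->
  puiseux_param f Phi m a ->
  puiseux_pairs m a s beta e ->
  real_analytic_halfbranch_map gamma ->
  analytic_arc alpha ->
  parameterizes alpha gamma ->
  contact_eq f alpha c ->
  (k <= s)%nat ->
  INR (beta k) <= INR m * c ->
  ((k < s)%nat -> INR m * c < INR (beta (S k))) ->
  order_along f alpha
    (INR (e k) * c
     + rsum (fun i => (INR (e i) - INR (e (S i))) * (INR (beta (S i)) / INR m)) k).
Proof.
  intros [Han [Hf0 _]] Hmult Hparam Hpairs _ Harc _ Hcont Hk Hc1 Hc2.
  apply order_along_of_exponent; [exact Han|exact Harc|].
  (* Multiplicity 0 would mean a nonzero constant coefficient, but f vanishes at 0. *)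
  assert (Hm : (1 <= m)%nat).
  { destruct m as [|m]; [exfalso|lia].
    destruct Hmult as [r [cf [Hrep [[i [j [Hij Hne]]] _]]]].
    assert (i = 0%nat) by lia. assert (j = 0%nat) by lia. subst i j. apply Hne. rewrite <- Hf0. symmetry.
    apply ser2_at_0. apply Hrep; rewrite Cmod_0; apply Hrep. }
  apply (order_exponent f m Phi a s beta e alpha c k); try assumption.
  apply Harc.
Qed.
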